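(* Let $n\ge1$ and let $$\mathcal{F}_n(t)=F_1(|F_2(|\ldots F_{n+1}(t)\ldots|)|),\qquad t>0,$$ be the $n$-th order Fresnel iterated pseudo-process. Its measure density $$\mu\{\mathcal{F}_n(t)\in dx\}/dx=2^n\int_0^\infty\cdots\int_0^\infty\ \prod_{j=0}^{n}\frac{1}{\sqrt{2\pi s_{j+1}}}\cos\left(\frac{s_j^2}{2s_{j+1}}-\frac{\pi}{4}\right)ds_1\cdots ds_n,\qquad s_0=x,\ s_{n+1}=t,$$ satisfies the equation $$\frac{\partial^2u}{\partial t^2}(x,t)=-2^{-2(2^{n+1}-1)}\frac{\partial^{2^{n+2}}u}{\partial x^{2^{n+2}}}(x,t),\qquad x\in\mathbb{R},\ t>0,$$ subject to the initial conditions $u(x,0)=\delta(x)$ and $u_t(x,0)=0$.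
   Context: $F_1,\ldots,F_{n+1}$ are independent copies of the Fresnel pseudo-process $F$, whose one-dimensional law is the signed measure $$\mu\{F(t)\in dx\}=\frac{dx}{\sqrt{2\pi t}}\cos\left(\frac{x^2}{2t}-\frac{\pi}{4}\right),\qquad x\in\mathbb{R},\ t>0.$$ The measure density of the composition $\mathcal{F}_n(t)$ is by definition the displayed iterated (improper) integral. $\delta$ is the Dirac delta; the equation and the initial conditions (limits as $t\to0^+$) are understood in the sense of tempered distributions in $x$. *)

(* Defs.v *)
From Stdlib Require Import Reals Arith.
From Coquelicot Require Import Coquelicot.
Open Scope R_scope.

Definition update (s : nat -> R) (k : nat) (y : R) : nat -> R :=
  fun i => if Nat.eqb i k then y else s i.

(* Iterated improper Riemann integral of [f (s_0, s_1, ...)] over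
   [s_1, ..., s_k] in (0, +oo), with [s_1] the innermost variable and [s_k]
   the outermost one; the other coordinates are read off [s]. *)
Fixpoint iterated_RInt (k : nat) (f : (nat -> R) -> R) (s : nat -> R) : R :=
  match k with
  | O => f s
  | S k' => RInt_gen (fun y => iterated_RInt k' f (update s k y))
              (at_right 0) (Rbar_locally p_infty)
  end.

(* [RInt_gen] is total, so convergence at every level is a separate fact. *)
Fixpoint ex_iterated_RInt (k : nat) (f : (nat -> R) -> R) (s : nat -> R) : Prop :=
  match k with
  | O => True
  | S k' =>
      (forall y, 0 < y -> ex_iterated_RInt k' f (update s k y)) /\
      ex_RInt_gen (fun y => iterated_RInt k' f (update s k y))
        (at_right 0) (Rbar_locally p_infty)
  end.

Definition fresnel_density (x t : R) : R :=
  / sqrt (2 * PI * t) * cos (x ^ 2 / (2 * t) - PI / 4).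

Definition fresnel_chain (n : nat) (s : nat -> R) : R :=
  prod_f_R0 (fun j => fresnel_density (s j) (s (S j))) n.

(* [s_0 = x] and [s_{n+1} = t]; the remaining coordinates are placeholders. *)
Definition fresnel_ends (n : nat) (x t : R) : nat -> R :=
  update (update (fun _ => 0) 0 x) (S n) t.

Definition iterated_fresnel_density (n : nat) (x t : R) : R :=
  2 ^ n * iterated_RInt n (fresnel_chain n) (fresnel_ends n x t).

Definition schwartz (phi : R -> R) : Prop :=
  (forall (j : nat) (x : R), ex_derive_n phi j x) /\
  (forall i j : nat, exists M : R,
     forall x : R, Rabs (x ^ i * Derive_n phi j x) <= M).

(* Real functionals; only their values on Schwartz functions are meaningful. *)
Definition functional : Type := (R -> R) -> R.

(* Continuity is expressed by the seminorms sup |x^i phi^(j)(x)|. *)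
Definition tempered (T : functional) : Prop :=
  (forall (a b : R) (phi psi : R -> R), schwartz phi -> schwartz psi ->
     T (fun x => a * phi x + b * psi x) = a * T phi + b * T psi) /\
  (exists (N : nat) (C : R), forall phi : R -> R, schwartz phi ->
     forall M : R,
       (forall (i j : nat) (x : R), (i <= N)%nat -> (j <= N)%nat ->
          Rabs (x ^ i * Derive_n phi j x) <= M) ->
       Rabs (T phi) <= C * M).

Definition dirac : functional := fun phi => phi 0.

Definition distr_Derive_n (T : functional) (k : nat) : functional :=
  fun phi => (-1) ^ k * T (Derive_n phi k).

Definition regular_distr (f : R -> R) : functional :=
  fun phi => RInt_gen (fun x => f x * phi x)
               (Rbar_locally m_infty) (Rbar_locally p_infty).

(* The pairing integrals converge absolutely and define a tempered
   distribution. *)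
Definition tempered_function (f : R -> R) : Prop :=
  (forall a b : R, ex_RInt f a b) /\
  (forall phi : R -> R, schwartz phi ->
     ex_RInt_gen (fun x => Rabs (f x * phi x))
       (Rbar_locally m_infty) (Rbar_locally p_infty)) /\
  tempered (regular_distr f).

(* Derivative at [t] of a curve of distributions, in the weak-* topology. *)
Definition is_distr_derive (T : R -> functional) (t : R) (T' : functional) : Prop :=
  tempered T' /\
  forall phi : R -> R, schwartz phi -> is_derive (fun s => T s phi) t (T' phi).

Definition distr_lim_0 (T : R -> functional) (L : functional) : Prop :=
  forall phi : R -> R, schwartz phi ->
    filterlim (fun t => T t phi) (at_right 0) (locally (L phi)).

(* Main.v *)
Require Import Defs.
From Stdlib Require Import Reals Arith Lra Lia FunctionalExtensionality.
From Coquelicot Require Import Coquelicot.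
Open Scope R_scope.

(** For a phase theta put
      K theta s t = cos (s^2 / (2 t) - theta) / sqrt (2 pi t),
    so that the Fresnel density is K (pi/4), and write P_theta f (t) for the
    improper integral of f(s) K theta s t over s > 0.  The proof never passes
    to Fourier transforms; everything follows from the two identities
      s K_theta = t d/ds K_{theta + pi/2},
      t d/dt K_theta = - (1/2) d/ds (s K_theta).

    Convergence.  The first identity turns an integration by parts into a gain
    of t/s^2, so the integral of f K_theta over [b, oo) is at most
    4 F sqrt t / b as soon as |f| and |s f'(s)| are bounded by F ([osc_tail]).
    The second one says that P_theta intertwines, up to a factor 1/2, the
    Euler operators s d/ds and t d/dt.  Hence the class of functions g(x, s)
    whose iterated Euler derivatives grow polynomially in x and 1/s and which
    are O(s^(-1/2)) at s = 0 is stable under P_theta acting on s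
    ([smooth_kernel_step]; the interval (0, 1], where g may oscillate wildly,
    has to be treated apart from [1, oo)).  It contains K (pi/4), so all the
    iterated integrals converge and the n-th density [iter_kernel n] is
    polynomially bounded in x and smooth in t.

    The equation.  Fix a Schwartz function phi and let A_k(t) be its pairing
    with the k-th density.  Exchanging integrals on compact rectangles and using
    the uniform rates of convergence, A_{k+1} = 2 P_{pi/4} A_k
    ([pairing_fresnel]), and A_0 = 2 P_{pi/4} applied to the even part of phi.
    If f is a bounded curve with f'(0+) = 0, integration by parts in s gives
    (P_theta f)' = - (1/2) P_{theta + pi/2} f'' ([is_derive_fresnel_int]); done
    twice, and since K_{theta + pi} = - K_theta, it gives
    (P_theta f)'' = - (1/4) P_theta f''''.  So, if f'' = e f_d where f_d is the
    curve attached to the d-th derivative of phi, then g = 2 P_{pi/4} f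
    satisfies g'' = - (e^2/4) g_{2d} ([wave_step]).  The even part of phi has
    (e, d) = (1, 2), and n + 1 steps lead to the announced equation, paired
    with phi.

    The initial values.  P_theta f (0+) = f(0+) P_theta 1, and P_theta 1 does
    not depend on t; its value is 1/2 for theta = pi/4 and 0 for
    theta = 3 pi/4, by the Fresnel integrals ([fresnel_constant]).  The first
    value propagates phi(0), hence the Dirac mass; the second one makes the
    first derivative tend to 0. *)

(** * Integrals depending on a parameter *)

(** Integrals are typed in the carrier of a canonical structure on the reals,
    which [ring] and [field] do not recognize as [R]; this retypes the equation. *)
Ltac real_eq := match goal with |- @eq _ ?a ?b => change (@eq R a b) end.

Ltac derive_continuous :=
  apply (@ex_derive_continuous R_AbsRing R_NormedModule); auto_derive; try exact I.

Lemma RInt_chasles_R (f : R -> R) (a b c : R) :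
  ex_RInt f a b -> ex_RInt f b c -> RInt f a b + RInt f b c = RInt f a c.
Proof. intros; now apply (RInt_Chasles f a b c). Qed.

Lemma RInt_scal_R (f : R -> R) (k a b : R) :
  ex_RInt f a b -> RInt (fun x => k * f x) a b = k * RInt f a b.
Proof. intros; now apply (RInt_scal f a b k). Qed.

Lemma RInt_plus_R (f g : R -> R) (a b : R) :
  ex_RInt f a b -> ex_RInt g a b ->
  RInt (fun x => f x + g x) a b = RInt f a b + RInt g a b.
Proof. intros; now apply (RInt_plus f g a b). Qed.

Lemma ex_RInt_cont (f : R -> R) (a b : R) :
  a <= b -> (forall z, a <= z <= b -> continuous f z) -> ex_RInt f a b.
Proof.
  intros Hab H; apply (ex_RInt_continuous f a b).
  rewrite Rmin_left, Rmax_right by lra; exact H.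
Qed.

Lemma RInt_abs_le (f g : R -> R) (a b : R) :
  a <= b -> ex_RInt f a b -> ex_RInt g a b ->
  (forall x, a <= x <= b -> Rabs (f x) <= g x) ->
  Rabs (RInt f a b) <= RInt g a b.
Proof.
  intros Hab Hf Hg H.
  exact (norm_RInt_le f g a b _ _ Hab H (RInt_correct f a b Hf) (RInt_correct g a b Hg)).
Qed.

Lemma RInt_ftc (f df : R -> R) (a b : R) :
  a <= b ->
  (forall x, a <= x <= b -> is_derive f x (df x)) ->
  (forall x, a <= x <= b -> continuous df x) ->
  ex_RInt df a b /\ RInt df a b = f b - f a.
Proof.
  intros Hab H1 H2.
  assert (H : is_RInt df a b (f b - f a)).
  { apply (is_RInt_derive f df a b); rewrite Rmin_left, Rmax_right by lra; assumption. }
  split; [ now exists (f b - f a) | now apply is_RInt_unique ].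
Qed.

Lemma continuous_of_derive (f : R -> R) (x l : R) : is_derive f x l -> continuous f x.
Proof. intros H; apply (@ex_derive_continuous R_AbsRing R_NormedModule f x); now exists l. Qed.

Lemma locally_Rabs (P : R -> Prop) (x d : R) :
  0 < d -> (forall u, Rabs (u - x) < d -> P u) -> locally x P.
Proof. intros Hd H; exists (mkposreal d Hd); intros u Hu; apply H; exact Hu. Qed.

Lemma continuous_eps (f : R -> R) (x : R) :
  (forall eps : posreal, locally x (fun u => Rabs (f u - f x) < eps)) -> continuous f x.
Proof. intros H P [eps HP]; apply (filter_imp _ _ (fun u Hu => HP (f u) Hu) (H eps)). Qed.

Lemma continuous_param (f : R -> R -> R) (a b x d : R) :
  0 < d -> a <= b ->
  (forall s, a <= s <= b -> continuity_2d_pt f x s) ->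
  (forall u, Rabs (u - x) < d -> ex_RInt (f u) a b) ->
  continuous (fun u => RInt (f u) a b) x.
Proof.
  intros Hd Hab Hc Hi.
  apply continuous_eps; intros eps.
  assert (He : 0 < eps / (b - a + 1)) by (apply Rdiv_lt_0_compat; [ apply cond_pos | lra ]).
  destruct (uniform_continuity_2d_1d' f a b x Hc (mkposreal _ He)) as [del Hdel].
  assert (Hm : 0 < Rmin d del) by (apply Rmin_pos; [ lra | apply cond_pos ]).
  apply (locally_Rabs _ x (Rmin d del) Hm); intros u Hu.
  assert (Hu1 := Rmin_l d del); assert (Hu2 := Rmin_r d del).
  assert (Hx : ex_RInt (f x) a b) by (apply Hi; replace (x - x) with 0 by ring; rewrite Rabs_R0; lra).
  assert (Hux : ex_RInt (f u) a b) by (apply Hi; lra).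
  assert (Hd0 := cond_pos del).
  replace (RInt (f u) a b - RInt (f x) a b) with (RInt (fun s => f u s - f x s) a b)
    by (apply (RInt_minus (f u) (f x) a b); assumption).
  apply Rle_lt_trans with ((b - a) * (eps / (b - a + 1))).
  - apply abs_RInt_le_const; [ lra | apply (ex_RInt_minus (f u) (f x)); assumption | ].
    intros s Hs; left.
    apply (Hdel s x s u); try lra.
    + apply Rabs_def2 in Hu; lra.
    + replace (s - s) with 0 by ring; rewrite Rabs_R0; lra.
  - assert (Hc0 := cond_pos eps).
    apply Rlt_le_trans with ((b - a + 1) * (eps / (b - a + 1))); [ | right; field; lra ].
    apply Rmult_lt_compat_r; lra.
Qed.

(** Differentiation under the integral sign with the derivative named
    explicitly, which spares the users a discussion of [Derive]. *)
Lemma is_derive_param (f df : R -> R -> R) (a b x d : R) :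
  0 < d -> a <= b ->
  (forall u v, Rabs (u - x) < d -> is_derive (fun z => f z v) u (df u v)) ->
  (forall v, a <= v <= b -> continuity_2d_pt df x v) ->
  (forall u, Rabs (u - x) < d -> ex_RInt (f u) a b) ->
  is_derive (fun z => RInt (f z) a b) x (RInt (df x) a b).
Proof.
  intros Hd Hab Hf Hc Hi.
  assert (Hx : Rabs (x - x) < d) by (replace (x - x) with 0 by ring; rewrite Rabs_R0; lra).
  rewrite (RInt_ext (df x) (fun v => Derive (fun u => f u v) x)).
  2: { intros v _; symmetry; apply is_derive_unique; now apply Hf. }
  apply is_derive_RInt_param.
  - apply (locally_Rabs _ x d Hd); intros u Hu t _; exists (df u t); now apply Hf.
  - rewrite Rmin_left, Rmax_right by lra; intros v Hv.
    apply continuity_2d_pt_ext_loc with (2 := Hc v Hv).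
    exists (mkposreal d Hd); intros u w Hu _; symmetry; apply is_derive_unique; now apply Hf.
  - apply (locally_Rabs _ x d Hd); assumption.
Qed.

Lemma continuity_2d_fst (f : R -> R) (x y : R) :
  continuous f x -> continuity_2d_pt (fun u _ => f u) x y.
Proof.
  intros H. apply (continuity_1d_2d_pt_comp f (fun u _ => u)).
  - now apply continuity_pt_filterlim.
  - apply continuity_2d_pt_id1.
Qed.

Lemma continuity_2d_snd (f : R -> R) (x y : R) :
  continuous f y -> continuity_2d_pt (fun _ v => f v) x y.
Proof.
  intros H. apply (continuity_1d_2d_pt_comp f (fun _ v => v)).
  - now apply continuity_pt_filterlim.
  - apply continuity_2d_pt_id2.
Qed.

Lemma continuity_2d_slice_snd (f : R -> R -> R) (x y : R) :
  continuity_2d_pt f x y -> continuous (f x) y.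
Proof.
  intros H. apply continuous_eps; intros eps.
  destruct (H eps) as [d Hd]. exists d; intros v Hv.
  apply Hd; [ | exact Hv ].
  replace (x - x) with 0 by ring; rewrite Rabs_R0; apply cond_pos.
Qed.

Lemma continuity_2d_slice_fst (f : R -> R -> R) (x y : R) :
  continuity_2d_pt f x y -> continuous (fun u => f u y) x.
Proof.
  intros H. apply continuous_eps; intros eps.
  destruct (H eps) as [d Hd]. exists d; intros v Hv.
  apply Hd; [ exact Hv | ].
  replace (y - y) with 0 by ring; rewrite Rabs_R0; apply cond_pos.
Qed.

(** As functions of the upper bound b, both sides vanish at b = a and have the
    same derivative. *)
Lemma fubini_rectangle (f : R -> R -> R) (a b c d : R) :
  a <= b -> c <= d -> (forall x y, continuity_2d_pt f x y) ->
  RInt (fun x => RInt (f x) c d) a b = RInt (fun y => RInt (fun x => f x y) a b) c d.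
Proof.
  intros Hab Hcd Hf.
  destruct (Req_dec a b) as [<- | Hne].
  { rewrite RInt_point. rewrite (RInt_ext _ (fun _ => 0)).
    - rewrite RInt_const. unfold zero, scal; simpl; unfold mult; simpl; ring.
    - intros y _. apply (RInt_point a (fun x => f x y)). }
  assert (Hi2 : forall x u v, ex_RInt (f x) u v).
  { intros; apply (ex_RInt_continuous (f x)); intros; now apply continuity_2d_slice_snd. }
  assert (Hi1 : forall y u v, ex_RInt (fun x => f x y) u v).
  { intros; apply (ex_RInt_continuous (fun x => f x y)); intros; now apply continuity_2d_slice_fst. }
  assert (Hc : forall x, continuous (fun x => RInt (f x) c d) x).
  { intros x; apply (continuous_param f c d x 1); auto; lra. }
  set (D := fun z => RInt (fun x => RInt (f x) c d) a z
                     - RInt (fun y => RInt (fun x => f x y) a z) c d).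
  assert (HD : forall z, is_derive D z zero).
  { intros z.
    cut (is_derive D z (minus (RInt (f z) c d) (RInt (f z) c d))).
    { intros H; now rewrite minus_eq_zero in H. }
    apply (is_derive_minus (fun z => RInt (fun x => RInt (f x) c d) a z)
            (fun z => RInt (fun y => RInt (fun x => f x y) a z) c d)).
    - apply (is_derive_RInt (fun x => RInt (f x) c d) _ a z); [ | apply Hc ].
      apply filter_forall; intros b0.
      apply (RInt_correct (fun x => RInt (f x) c d)).
      apply (ex_RInt_continuous (fun x => RInt (f x) c d)); intros; apply Hc.
    - apply (is_derive_param (fun z y => RInt (fun x => f x y) a z) f c d z 1); try lra.
      + intros u v _.
        apply (is_derive_RInt (fun x => f x v) _ a u).
        * apply filter_forall; intros b0; apply (RInt_correct (fun x => f x v)); apply Hi1.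
        * now apply continuity_2d_slice_fst.
      + auto.
      + intros u _. apply ex_RInt_cont; [ lra | ]. intros y _.
        destruct (Rle_dec a u) as [Hau | Hau].
        * apply (continuous_param (fun y x => f x y) a u y 1); auto; try lra.
          intros s _. intros eps. destruct (Hf s y eps) as [del Hdel].
          exists del; intros; now apply Hdel.
        * apply (continuous_ext (fun y => opp (RInt (fun x => f x y) u a))).
          { intros y0; apply opp_RInt_swap; apply Hi1. }
          apply (continuous_opp (fun y => RInt (fun x => f x y) u a)).
          apply (continuous_param (fun y x => f x y) u a y 1); auto; try lra.
          intros s _. intros eps. destruct (Hf s y eps) as [del Hdel].
          exists del; intros; now apply Hdel. }
  assert (HE : D a = D b) by (apply eq_is_derive; [ intros; apply HD | lra ]).
  unfold D in HE. rewrite RInt_point in HE.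
  rewrite (RInt_ext (fun y => RInt (fun x => f x y) a a) (fun _ => 0)) in HE.
  2: { intros y _; apply (RInt_point a (fun x => f x y)). }
  rewrite RInt_const in HE.
  unfold zero, scal in HE; simpl in HE; unfold mult in HE; simpl in HE. lra.
Qed.

(** Every derivative of an improper integral below is obtained from this one:
    truncate, differentiate, and control the error on the derivative uniformly
    near t. *)
Lemma is_derive_lim (F dF : nat -> R -> R) (f df : R -> R) (eta : nat -> R) (t d : R) :
  0 < d ->
  (forall u n, Rabs (u - t) < d -> is_derive (F n) u (dF n u)) ->
  (forall u, Rabs (u - t) < d -> is_lim_seq (fun n => F n u) (f u)) ->
  (forall u n, Rabs (u - t) < d -> Rabs (dF n u - df u) <= eta n) ->
  is_lim_seq eta 0 ->
  is_derive f t (df t).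
Proof.
  intros Hd H1 H2 H3 H4.
  apply is_derive_Reals.
  apply (CVU_derivable F dF f df t (mkposreal d Hd)).
  - intros eps Heps.
    destruct (proj2 (is_lim_seq_spec eta 0) H4 (mkposreal eps Heps)) as [N HN].
    exists N; intros n y Hn Hy.
    specialize (HN n Hn); simpl in HN; rewrite Rminus_0_r in HN.
    rewrite Rabs_minus_sym.
    apply Rle_lt_trans with (eta n); [ now apply H3 | ].
    apply Rle_lt_trans with (2 := HN), Rle_abs.
  - intros x Hx; apply is_lim_seq_Reals; now apply H2.
  - intros n x Hx; apply is_derive_Reals; now apply H1.
  - red; simpl; replace (t - t) with 0 by ring; rewrite Rabs_R0; exact Hd.
Qed.

Lemma is_lim_seq_inv_S : is_lim_seq (fun n => / INR (S n)) 0.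
Proof.
  apply (is_lim_seq_incr_1 (fun n => / INR n)).
  apply (is_lim_seq_inv INR p_infty); [ apply is_lim_seq_INR | easy ].
Qed.

Lemma is_lim_seq_le_bound (u eta : nat -> R) (l : R) :
  (forall n, Rabs (u n - l) <= eta n) -> is_lim_seq eta 0 -> is_lim_seq u l.
Proof.
  intros H He.
  apply (is_lim_seq_ext (fun n => (u n - l) + l)); [ intros; ring | ].
  replace (Finite l) with (Rbar_plus 0 l) by (simpl; f_equal; ring).
  apply (is_lim_seq_plus' (fun n => u n - l) (fun _ => l) 0 l); [ | apply is_lim_seq_const ].
  apply is_lim_seq_abs_0.
  apply (is_lim_seq_le_le (fun _ => 0) _ eta); auto.
  - intros n; split; [ apply Rabs_pos | apply H ].
  - apply is_lim_seq_const.
Qed.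

(** * The oscillating factor K *)

Lemma is_derive_mult_R (f g : R -> R) (x a b : R) :
  is_derive f x a -> is_derive g x b ->
  is_derive (fun x => f x * g x) x (a * g x + f x * b).
Proof. intros Hf Hg; exact (is_derive_mult f g x a b Hf Hg Rmult_comm). Qed.

Lemma is_derive_eq (f : R -> R) (x a b : R) : is_derive f x a -> a = b -> is_derive f x b.
Proof. now intros H <-. Qed.

(** The phase is a parameter because both partial derivatives of K are
    multiples of K with the phase moved by a quarter turn. *)
Definition K (theta s t : R) : R :=
  / sqrt (2 * PI * t) * cos (s ^ 2 / (2 * t) - theta).

Lemma cos_minus_PI2 (y : R) : cos (y - PI / 2) = sin y.
Proof. rewrite cos_minus, cos_PI2, sin_PI2; ring. Qed.

Lemma K_shift (theta s t : R) :
  K (theta + PI / 2) s t = / sqrt (2 * PI * t) * sin (s ^ 2 / (2 * t) - theta).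
Proof. unfold K; f_equal. rewrite <- cos_minus_PI2; f_equal; ring. Qed.

Lemma K_PI (theta s t : R) : K (theta + PI / 2 + PI / 2) s t = - K theta s t.
Proof.
  rewrite K_shift; unfold K.
  replace (s ^ 2 / (2 * t) - (theta + PI / 2)) with (s ^ 2 / (2 * t) - theta - PI / 2) by ring.
  rewrite sin_minus, cos_PI2, sin_PI2; ring.
Qed.

Lemma sqrt_2PIt_pos (t : R) : 0 < t -> 0 < sqrt (2 * PI * t).
Proof. intros Ht; apply sqrt_lt_R0; assert (H := PI_RGT_0); nra. Qed.

Lemma K_bound (theta s t : R) : 0 < t -> Rabs (K theta s t) <= / sqrt t.
Proof.
  intros Ht; unfold K; rewrite Rabs_mult.
  assert (H0 := sqrt_2PIt_pos t Ht).
  rewrite (Rabs_pos_eq (/ _)) by (left; now apply Rinv_0_lt_compat).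
  assert (Hc : Rabs (cos (s ^ 2 / (2 * t) - theta)) <= 1) by (apply Rabs_le, COS_bound).
  apply Rle_trans with (/ sqrt (2 * PI * t) * 1).
  - apply Rmult_le_compat_l; [ left; now apply Rinv_0_lt_compat | exact Hc ].
  - rewrite Rmult_1_r; apply Rinv_le_contravar; [ now apply sqrt_lt_R0 | ].
    apply sqrt_le_1_alt. assert (H := PI2_1). nra.
Qed.

Lemma tK_bound (theta s t : R) : 0 < t -> Rabs (t * K theta s t) <= sqrt t.
Proof.
  intros Ht; rewrite Rabs_mult, (Rabs_pos_eq t) by lra.
  apply Rle_trans with (t * / sqrt t).
  - apply Rmult_le_compat_l; [ lra | now apply K_bound ].
  - right. rewrite <- (sqrt_sqrt t) at 1 by lra.
    field; apply Rgt_not_eq; now apply sqrt_lt_R0.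
Qed.

Lemma K_ds (theta s t : R) : 0 < t ->
  is_derive (fun s => K theta s t) s (- (s / t) * K (theta + PI / 2) s t).
Proof.
  intros Ht; rewrite K_shift; unfold K.
  auto_derive; [ lra | ].
  replace (s * (s * 1) * / (2 * t) + - theta) with (s ^ 2 / (2 * t) - theta) by (unfold Rdiv; ring).
  assert (H := sqrt_2PIt_pos t Ht); field; lra.
Qed.

Lemma K_ds_shift (theta s t : R) : 0 < t ->
  is_derive (fun s => K (theta + PI / 2) s t) s (s / t * K theta s t).
Proof.
  intros Ht. apply (is_derive_eq _ _ _ _ (K_ds (theta + PI / 2) s t Ht)).
  rewrite K_PI; ring.
Qed.

Lemma K_dt (theta s t : R) : 0 < t ->
  is_derive (fun t => K theta s t) t
    (/ t * (- / 2 * K theta s t + s ^ 2 / (2 * t) * K (theta + PI / 2) s t)).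
Proof.
  intros Ht; rewrite K_shift; unfold K.
  assert (H := sqrt_2PIt_pos t Ht).
  assert (HP := PI_RGT_0).
  auto_derive.
  - repeat split; nra.
  - replace (s * (s * 1) * / (2 * t) + - theta) with (s ^ 2 / (2 * t) - theta) by (unfold Rdiv; ring).
    assert (Hs : sqrt (2 * PI * t) ^ 2 = 2 * PI * t) by (simpl; rewrite Rmult_1_r; apply sqrt_sqrt; nra).
    set (r := sqrt (2 * PI * t)) in *.
    set (c := cos _); set (d := sin _).
    replace (2 * PI * 1) with (r ^ 2 / t) by (rewrite Hs; field; lra).
    field; lra.
Qed.

Lemma K_continuous_s (theta s t : R) : 0 < t -> continuous (fun s => K theta s t) s.
Proof. intros Ht; now apply (continuous_of_derive _ _ _ (K_ds theta s t Ht)). Qed.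

Lemma K_continuity_2d (theta t s : R) : 0 < t ->
  continuity_2d_pt (fun t s => K theta s t) t s.
Proof.
  intros Ht; unfold K.
  apply continuity_2d_pt_mult.
  - apply (continuity_2d_fst (fun t => / sqrt (2 * PI * t))).
    assert (H := sqrt_2PIt_pos t Ht); assert (HP := PI_RGT_0).
    derive_continuous; repeat split; nra.
  - apply (continuity_1d_2d_pt_comp cos).
    + apply derivable_continuous_pt, derivable_pt_cos.
    + apply continuity_2d_pt_minus; [ | apply continuity_2d_pt_const ].
      unfold Rdiv; apply continuity_2d_pt_mult.
      * apply (continuity_2d_snd (fun s => s ^ 2)).
        derive_continuous.
      * apply (continuity_2d_fst (fun t => / (2 * t))).
        derive_continuous; lra.
Qed.

Lemma ex_RInt_K (f : R -> R) (theta a b t : R) :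
  0 < t -> a <= b -> (forall s, a <= s <= b -> continuous f s) ->
  ex_RInt (fun s => f s * K theta s t) a b.
Proof.
  intros Ht Hab Hf; apply ex_RInt_cont; [ exact Hab | ].
  intros z Hz; apply (continuous_mult f (fun s => K theta s t)); [ now apply Hf | now apply K_continuous_s ].
Qed.

(** Since K theta = (t/s) d/ds K (theta + pi/2), integrating by parts trades
    the slowly decaying f for (s f' - f) / s^2, which is absolutely integrable. *)
Lemma osc_by_parts (f f1 : R -> R) (theta a b t : R) :
  0 < a <= b -> 0 < t ->
  (forall s, a <= s <= b -> is_derive f s (f1 s)) ->
  (forall s, a <= s <= b -> continuous f1 s) ->
  ex_RInt (fun s => (s * f1 s - f s) / s ^ 2 * K (theta + PI / 2) s t) a b /\
  RInt (fun s => f s * K theta s t) a b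
  = t * (f b / b * K (theta + PI / 2) b t - f a / a * K (theta + PI / 2) a t
     - RInt (fun s => (s * f1 s - f s) / s ^ 2 * K (theta + PI / 2) s t) a b).
Proof.
  intros [Ha Hab] Ht Hf Hf1.
  assert (Hcf : forall s, a <= s <= b -> continuous f s).
  { intros s Hs; now apply (continuous_of_derive _ _ _ (Hf s Hs)). }
  set (g := fun s => (s * f1 s - f s) / s ^ 2).
  assert (Hcg : forall s, a <= s <= b -> continuous g s).
  { intros s Hs. unfold g, Rdiv.
    apply (continuous_mult (fun s => s * f1 s - f s) (fun s => / s ^ 2)).
    - apply (continuous_minus (fun s => s * f1 s) f); [ | now apply Hcf ].
      apply (continuous_mult (fun s => s) f1); [ apply continuous_id | now apply Hf1 ].
    - derive_continuous; nra. }
  assert (Hg : ex_RInt (fun s => g s * K (theta + PI / 2) s t) a b) by now apply ex_RInt_K.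
  assert (HfK : ex_RInt (fun s => f s * K theta s t) a b) by now apply ex_RInt_K.
  split; [ exact Hg | ].
  destruct (RInt_ftc (fun s => f s / s * K (theta + PI / 2) s t)
             (fun s => g s * K (theta + PI / 2) s t + / t * (f s * K theta s t)) a b)
    as [_ HE]; auto.
  - intros s Hs.
    assert (Hs0 : s <> 0) by lra.
    eapply is_derive_eq.
    + apply (is_derive_mult_R (fun s => f s / s) (fun s => K (theta + PI / 2) s t)).
      * unfold Rdiv. apply (is_derive_mult_R f (fun s => / s)); [ now apply Hf | ].
        apply (is_derive_inv (fun s => s) s 1); [ apply (is_derive_id s) | exact Hs0 ].
      * now apply K_ds_shift.
    + unfold g; simpl. field; lra.
  - intros s Hs.
    apply (continuous_plus (fun s => g s * K (theta + PI / 2) s t) (fun s => / t * (f s * K theta s t))).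
    + apply (continuous_mult g (fun s => K (theta + PI / 2) s t)); [ now apply Hcg | now apply K_continuous_s ].
    + apply (continuous_scal_r (/ t) (fun s => f s * K theta s t)).
      apply (continuous_mult f (fun s => K theta s t)); [ now apply Hcf | now apply K_continuous_s ].
  - rewrite RInt_plus_R, RInt_scal_R in HE; auto.
    2: apply (ex_RInt_scal (fun s => f s * K theta s t)); auto.
    change (fun s => (s * f1 s - f s) / s ^ 2 * K (theta + PI / 2) s t)
      with (fun s => g s * K (theta + PI / 2) s t).
    rewrite <- HE. symmetry; real_eq; field; lra.
Qed.

(** Square-root cancellation: the stationary point of the phase is s = 0, so
    beyond b >> sqrt t the integral is small although the integrand is not. *)
Lemma osc_tail (f f1 : R -> R) (theta F a b t : R) :
  0 < a <= b -> 0 < t ->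
  (forall s, a <= s <= b -> is_derive f s (f1 s)) ->
  (forall s, a <= s <= b -> continuous f1 s) ->
  (forall s, a <= s <= b -> Rabs (f s) <= F /\ Rabs (s * f1 s) <= F) ->
  Rabs (RInt (fun s => f s * K theta s t) a b) <= 4 * F * sqrt t / a.
Proof.
  intros [Ha Hab] Ht Hf Hf1 HF.
  destruct (osc_by_parts f f1 theta a b t (conj Ha Hab) Ht Hf Hf1) as [Hi ->].
  assert (Hst : 0 < sqrt t) by now apply sqrt_lt_R0.
  assert (HF0 : 0 <= F) by (destruct (HF a) as [H _]; [ lra | apply Rle_trans with (2 := H), Rabs_pos ]).
  assert (Hend : forall s, a <= s <= b -> Rabs (f s / s * (t * K (theta + PI / 2) s t)) <= F * sqrt t / a).
  { intros s Hs. rewrite Rabs_mult.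
    replace (F * sqrt t / a) with (F / a * sqrt t) by (field; lra).
    apply Rmult_le_compat; try apply Rabs_pos; [ | now apply tK_bound ].
    unfold Rdiv; rewrite Rabs_mult, (Rabs_pos_eq (/ s)) by (left; apply Rinv_0_lt_compat; lra).
    apply Rmult_le_compat; try apply Rabs_pos; try (left; apply Rinv_0_lt_compat; lra).
    - now apply HF.
    - apply Rinv_le_contravar; lra. }
  assert (Hint : Rabs (t * RInt (fun s => (s * f1 s - f s) / s ^ 2 * K (theta + PI / 2) s t) a b)
                 <= 2 * F * sqrt t * (/ a - / b)).
  { destruct (RInt_ftc (fun s => - (2 * F * sqrt t) * / s) (fun s => 2 * F * sqrt t / s ^ 2) a b Hab) as [Hi2 HE].
    - intros s Hs; auto_derive; [ lra | simpl; field; lra ].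
    - intros s Hs; derive_continuous; nra.
    - replace (2 * F * sqrt t * (/ a - / b)) with (RInt (fun s => 2 * F * sqrt t / s ^ 2) a b)
        by (rewrite HE; real_eq; ring).
      rewrite <- RInt_scal_R by exact Hi.
      apply RInt_abs_le; auto.
      + apply (ex_RInt_scal _ a b t Hi).
      + intros s Hs.
        replace (t * ((s * f1 s - f s) / s ^ 2 * K (theta + PI / 2) s t))
          with ((s * f1 s - f s) / s ^ 2 * (t * K (theta + PI / 2) s t)) by (unfold Rdiv; ring).
        replace (2 * F * sqrt t / s ^ 2) with (2 * F / s ^ 2 * sqrt t) by (unfold Rdiv; ring).
        rewrite Rabs_mult; apply Rmult_le_compat; try apply Rabs_pos; [ | now apply tK_bound ].
        unfold Rdiv; rewrite Rabs_mult.
        assert (Hs2 : 0 < / s ^ 2) by (apply Rinv_0_lt_compat; nra).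
        rewrite (Rabs_pos_eq (/ s ^ 2)) by lra.
        apply Rmult_le_compat_r; [ lra | ].
        destruct (HF s Hs) as [H1 H2].
        unfold Rminus; apply Rle_trans with (1 := Rabs_triang _ _); rewrite Rabs_Ropp; lra. }
  assert (Ha' := Hend a (conj (Rle_refl a) Hab)).
  assert (Hb' := Hend b (conj Hab (Rle_refl b))).
  replace (t * _) with (f b / b * (t * K (theta + PI / 2) b t)
    + - (f a / a * (t * K (theta + PI / 2) a t))
    + - (t * RInt (fun s => (s * f1 s - f s) / s ^ 2 * K (theta + PI / 2) s t) a b)) by ring.
  apply Rle_trans with (1 := Rabs_triang _ _); rewrite Rabs_Ropp.
  eapply Rle_trans; [ apply Rplus_le_compat; [ apply Rabs_triang | apply Hint ] | ].
  rewrite Rabs_Ropp.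
  assert (0 <= 2 * F * sqrt t * / b).
  { apply Rmult_le_pos; [ nra | left; apply Rinv_0_lt_compat; lra ]. }
  unfold Rdiv in *. nra.
Qed.

Lemma RInt_K_dt (f : R -> R) (theta a b t : R) :
  a <= b -> 0 < t -> (forall s, a <= s <= b -> continuous f s) ->
  is_derive (fun t => RInt (fun s => f s * K theta s t) a b) t
    (RInt (fun s => f s * (/ t * (- / 2 * K theta s t + s ^ 2 / (2 * t) * K (theta + PI / 2) s t))) a b).
Proof.
  intros Hab Ht Hf.
  assert (Hpos : forall u, Rabs (u - t) < t / 2 -> 0 < u).
  { intros u Hu; apply Rabs_def2 in Hu; lra. }
  apply (is_derive_param (fun t s => f s * K theta s t)
    (fun t s => f s * (/ t * (- / 2 * K theta s t + s ^ 2 / (2 * t) * K (theta + PI / 2) s t))) a b t (t / 2));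
    try lra.
  - intros u v Hu. apply (is_derive_scal (fun u => K theta v u) u (f v)), K_dt; auto.
  - intros v Hv. apply continuity_2d_pt_mult; [ apply continuity_2d_snd; auto | ].
    apply continuity_2d_pt_mult.
    + apply (continuity_2d_fst (fun t => / t)).
      derive_continuous; lra.
    + apply continuity_2d_pt_plus.
      * apply continuity_2d_pt_mult; [ apply continuity_2d_pt_const | now apply K_continuity_2d ].
      * apply continuity_2d_pt_mult; [ | now apply K_continuity_2d ].
        unfold Rdiv; apply continuity_2d_pt_mult.
        -- apply (continuity_2d_snd (fun s => s ^ 2)).
           derive_continuous.
        -- apply (continuity_2d_fst (fun t => / (2 * t))).
           derive_continuous; lra.
  - intros u Hu; apply ex_RInt_K; auto.
Qed.

(** The t-derivative of the truncated integral contains a boundary term of size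
    b f(b), which does not tend to 0: the oscillating tail, although of size
    1/b, has a large derivative.  Subtracting the leading part
    (t/b) f(b) K (theta + pi/2) of that tail removes it, and what is left of the
    boundary at b is O(1/b). *)
Lemma osc_corrected_dt (f f1 : R -> R) (theta a b t : R) :
  0 < a <= b -> 0 < t ->
  (forall s, a <= s <= b -> is_derive f s (f1 s)) ->
  (forall s, a <= s <= b -> continuous f1 s) ->
  is_derive (fun t => RInt (fun s => f s * K theta s t) a b - t / b * f b * K (theta + PI / 2) b t) t
    (/ (2 * t) * (a * f a * K theta a t + RInt (fun s => s * f1 s * K theta s t) a b)
      - f b * K (theta + PI / 2) b t / (2 * b)).
Proof.
  intros [Ha Hab] Ht Hf Hf1.
  assert (Hcf : forall s, a <= s <= b -> continuous f s).
  { intros s Hs; now apply (continuous_of_derive _ _ _ (Hf s Hs)). }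
  assert (Hcg : forall s, a <= s <= b -> continuous (fun s => s * f1 s) s).
  { intros s Hs; apply (continuous_mult (fun s => s) f1); [ apply continuous_id | now apply Hf1 ]. }
  set (D := fun s => f s * (/ t * (- / 2 * K theta s t + s ^ 2 / (2 * t) * K (theta + PI / 2) s t))).
  assert (HcD : forall s, a <= s <= b -> continuous D s).
  { intros s Hs. apply (continuous_mult f); [ now apply Hcf | ].
    apply (continuous_scal_r (/ t)
      (fun s => - / 2 * K theta s t + s ^ 2 / (2 * t) * K (theta + PI / 2) s t)).
    apply (continuous_plus (fun s => - / 2 * K theta s t) (fun s => s ^ 2 / (2 * t) * K (theta + PI / 2) s t)).
    - apply (continuous_scal_r (- / 2) (fun s => K theta s t)); now apply K_continuous_s.
    - apply (continuous_mult (fun s => s ^ 2 / (2 * t)) (fun s => K (theta + PI / 2) s t));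
        [ | now apply K_continuous_s ].
      derive_continuous; lra. }
  assert (HE : RInt D a b = / (2 * t) * (RInt (fun s => s * f1 s * K theta s t) a b
                 - (b * f b * K theta b t - a * f a * K theta a t))).
  { destruct (RInt_ftc (fun s => s * f s * K theta s t)
       (fun s => s * f1 s * K theta s t + - (2 * t) * D s) a b Hab) as [_ HE].
    - intros s Hs. eapply is_derive_eq.
      + apply (is_derive_mult_R (fun s => s * f s) (fun s => K theta s t)); [ | now apply K_ds ].
        apply (is_derive_mult_R (fun s => s) f); [ apply (is_derive_id s) | now apply Hf ].
      + unfold D; simpl. unfold one; simpl. field; lra.
    - intros s Hs.
      apply (continuous_plus (fun s => s * f1 s * K theta s t) (fun s => - (2 * t) * D s)).
      + apply (continuous_mult (fun s => s * f1 s) (fun s => K theta s t)); [ now apply Hcg | now apply K_continuous_s ].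
      + apply (continuous_scal_r (- (2 * t)) D); now apply HcD.
    - assert (HiD : ex_RInt D a b) by (apply ex_RInt_cont; auto).
      rewrite RInt_plus_R, RInt_scal_R in HE; auto.
      + rewrite <- HE; symmetry; real_eq; field; lra.
      + apply (ex_RInt_K (fun s => s * f1 s)); auto.
      + apply (ex_RInt_scal D); auto. }
  eapply is_derive_eq.
  - apply (is_derive_minus (fun t => RInt (fun s => f s * K theta s t) a b)
             (fun t => t / b * f b * K (theta + PI / 2) b t)).
    + apply RInt_K_dt; auto.
    + apply (is_derive_mult_R (fun t => t / b * f b) (fun t => K (theta + PI / 2) b t)).
      * auto_derive; [ lra | reflexivity ].
      * now apply K_dt.
  - fold D. rewrite HE. change minus with (fun x y : R => x - y); simpl.
    rewrite K_PI. symmetry; real_eq; field; lra.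
Qed.

(** * Improper integrals against K *)

(** A Cauchy argument with an explicit rate.  The estimate at every point of D,
    not only along c, is what makes the improper integrals below limits in the
    sense of filters. *)
Lemma lim_of_rate (I rate : R -> R) (c : nat -> R) (D : R -> Prop) :
  (forall n, D (c n)) ->
  (forall a, D a -> exists N, forall n, (N <= n)%nat -> Rabs (I (c n) - I a) <= rate a) ->
  is_lim_seq (fun n => rate (c n)) 0 ->
  let L := real (Lim_seq (fun n => I (c n))) in
  is_lim_seq (fun n => I (c n)) L /\ forall a, D a -> Rabs (I a - L) <= rate a.
Proof.
  intros Hc HI Hr L.
  assert (HL : is_lim_seq (fun n => I (c n)) L).
  { apply Lim_seq_correct'. apply ex_lim_seq_cauchy_corr.
    intros eps.
    assert (He : 0 < eps / 3) by (assert (H := cond_pos eps); lra).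
    destruct (proj2 (is_lim_seq_spec _ 0) Hr (mkposreal _ He)) as [N0 HN0].
    specialize (HN0 N0 (Nat.le_refl _)); simpl in HN0; rewrite Rminus_0_r in HN0.
    destruct (HI (c N0) (Hc N0)) as [N HN].
    exists N; intros n m Hn Hm.
    assert (H1 := HN n Hn); assert (H2 := HN m Hm).
    assert (H3 := Rle_abs (rate (c N0))).
    replace (I (c n) - I (c m)) with ((I (c n) - I (c N0)) + - (I (c m) - I (c N0))) by ring.
    apply Rle_lt_trans with (1 := Rabs_triang _ _); rewrite Rabs_Ropp; lra. }
  split; [ exact HL | ].
  intros a Ha; destruct (HI a Ha) as [N HN].
  assert (H : is_lim_seq (fun n => Rabs (I (c (n + N)%nat) - I a)) (Rabs (L - I a))).
  { apply (is_lim_seq_abs _ (L - I a)).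
    apply (is_lim_seq_minus' _ (fun _ => I a)); [ | apply is_lim_seq_const ].
    now apply is_lim_seq_incr_n with (u := fun n => I (c n)). }
  rewrite Rabs_minus_sym.
  apply (is_lim_seq_le (fun n => Rabs (I (c (n + N)%nat) - I a)) (fun _ => rate a) (Rabs (L - I a)) (rate a)).
  - intros n; apply HN; lia.
  - exact H.
  - apply is_lim_seq_const.
Qed.

(** The part of the transform over (0, 1], where convergence is absolute; a
    limit along 1/(n+1) is enough since [low_spec] controls every lower bound. *)
Definition low (theta : R) (f : R -> R) (t : R) : R :=
  real (Lim_seq (fun n => RInt (fun s => f s * K theta s t) (/ INR (S n)) 1)).

(** The part over [1, oo), which converges only thanks to the oscillation. *)
Definition high (theta : R) (f : R -> R) (t : R) : R :=
  real (Lim_seq (fun n => RInt (fun s => f s * K theta s t) 1 (INR (S n)))).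

(** The singularity s^(-1/2) is the one of the Fresnel density at small times;
    it is integrable and the transform reproduces it. *)
Definition low_bound (F : R) (f : R -> R) : Prop :=
  (forall s, 0 < s -> continuous f s) /\
  (forall s, 0 < s <= 1 -> Rabs (f s) <= F / sqrt s).

(** Here e is the Euler derivative s f'(s). *)
Definition high_bound (F : R) (f e : R -> R) : Prop :=
  (forall s, 0 < s -> is_derive f s (e s / s)) /\
  (forall s, 0 < s -> continuous e s) /\
  (forall s, 1 <= s -> Rabs (f s) <= F /\ Rabs (e s) <= F).

Lemma INR_S_ge1 (n : nat) : 1 <= INR (S n).
Proof. rewrite S_INR; assert (H := pos_INR n); lra. Qed.

Lemma inv_INR_S (n : nat) : 0 < / INR (S n) <= 1.
Proof.
  assert (H := INR_S_ge1 n); split.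
  - apply Rinv_0_lt_compat; lra.
  - rewrite <- Rinv_1; apply Rinv_le_contravar; lra.
Qed.

Lemma low_bound_pos (F : R) (f : R -> R) : low_bound F f -> 0 <= F.
Proof.
  intros [_ H]; specialize (H 1 (conj Rlt_0_1 (Rle_refl 1))); rewrite sqrt_1 in H.
  assert (H0 := Rabs_pos (f 1)); lra.
Qed.

Lemma high_bound_pos (F : R) (f e : R -> R) : high_bound F f e -> 0 <= F.
Proof.
  intros (_ & _ & H); destruct (H 1 (Rle_refl 1)) as [H1 _].
  assert (H0 := Rabs_pos (f 1)); lra.
Qed.

Lemma low_increment (F theta a b t : R) (f : R -> R) :
  low_bound F f -> 0 < t -> 0 < a <= b -> b <= 1 ->
  Rabs (RInt (fun s => f s * K theta s t) a b) <= 2 * F / sqrt t * sqrt b.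
Proof.
  intros Hlb Ht [Ha Hab] Hb.
  assert (HF := low_bound_pos _ _ Hlb); destruct Hlb as [Hc Hf].
  assert (Hst : 0 < sqrt t) by now apply sqrt_lt_R0.
  destruct (RInt_ftc (fun s => 2 * F / sqrt t * sqrt s) (fun s => F / sqrt t * / sqrt s) a b Hab) as [Hi HE].
  - intros s Hs. auto_derive; [ lra | ].
    assert (0 < sqrt s) by (apply sqrt_lt_R0; lra). field; lra.
  - intros s Hs. derive_continuous.
    assert (0 < sqrt s) by (apply sqrt_lt_R0; lra). split; lra.
  - apply Rle_trans with (RInt (fun s => F / sqrt t * / sqrt s) a b).
    + apply RInt_abs_le; auto.
      * apply ex_RInt_K; auto. intros s Hs; apply Hc; lra.
      * intros s Hs. rewrite Rabs_mult.
        assert (0 < sqrt s) by (apply sqrt_lt_R0; lra).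
        replace (F / sqrt t * / sqrt s) with (F / sqrt s * / sqrt t) by (field; lra).
        apply Rmult_le_compat; try apply Rabs_pos; [ apply Hf; lra | now apply K_bound ].
    + rewrite HE.
      assert (H1 : 0 <= F / sqrt t) by (apply Rmult_le_pos; [ lra | left; now apply Rinv_0_lt_compat ]).
      assert (0 <= sqrt a) by apply sqrt_pos.
      assert (0 <= F / sqrt t * sqrt a) by now apply Rmult_le_pos.
      unfold Rdiv in *; lra.
Qed.

Lemma is_lim_seq_sqrt_inv_S (C : R) : is_lim_seq (fun n => C * sqrt (/ INR (S n))) 0.
Proof.
  replace (Finite 0) with (Rbar_mult C 0) by (simpl; f_equal; ring).
  apply is_lim_seq_scal_l.
  rewrite <- sqrt_0.
  apply (is_lim_seq_continuous sqrt (fun n => / INR (S n)) 0).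
  - apply continuity_pt_sqrt; lra.
  - apply is_lim_seq_inv_S.
Qed.

Lemma is_lim_seq_div_S (C : R) : is_lim_seq (fun n => C / INR (S n)) 0.
Proof.
  replace (Finite 0) with (Rbar_mult C 0) by (simpl; f_equal; ring).
  apply (is_lim_seq_scal_l (fun n => / INR (S n))), is_lim_seq_inv_S.
Qed.

Lemma low_spec (F theta t : R) (f : R -> R) :
  low_bound F f -> 0 < t ->
  is_lim_seq (fun n => RInt (fun s => f s * K theta s t) (/ INR (S n)) 1) (low theta f t) /\
  (forall a, 0 < a <= 1 ->
    Rabs (RInt (fun s => f s * K theta s t) a 1 - low theta f t) <= 2 * F / sqrt t * sqrt a).
Proof.
  intros Hlb Ht.
  apply (lim_of_rate (fun a => RInt (fun s => f s * K theta s t) a 1)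
          (fun a => 2 * F / sqrt t * sqrt a) (fun n => / INR (S n)) (fun a => 0 < a <= 1)).
  - apply inv_INR_S.
  - intros a Ha.
    destruct (proj2 (is_lim_seq_spec _ _) is_lim_seq_inv_S (mkposreal a (proj1 Ha))) as [N HN].
    exists N; intros n Hn. specialize (HN n Hn); simpl in HN.
    assert (Hn0 := inv_INR_S n).
    assert (Hna : / INR (S n) < a).
    { rewrite Rminus_0_r in HN. apply Rle_lt_trans with (2 := HN), Rle_abs. }
    assert (Hi : forall u v, 0 < u <= v -> ex_RInt (fun s => f s * K theta s t) u v).
    { intros u v Huv; apply ex_RInt_K; try lra. intros s Hs; apply Hlb; lra. }
    rewrite <- (RInt_chasles_R _ (/ INR (S n)) a 1) by (apply Hi; lra).
    match goal with |- Rabs ?x <= _ =>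
      replace x with (RInt (fun s => f s * K theta s t) (/ INR (S n)) a)
        by (symmetry; real_eq; ring) end.
    apply low_increment; auto; lra.
  - apply is_lim_seq_sqrt_inv_S.
Qed.

Lemma low_le (F theta t : R) (f : R -> R) :
  low_bound F f -> 0 < t -> Rabs (low theta f t) <= 2 * F / sqrt t.
Proof.
  intros Hlb Ht; destruct (low_spec F theta t f Hlb Ht) as [_ H].
  specialize (H 1 (conj Rlt_0_1 (Rle_refl 1))).
  rewrite RInt_point, sqrt_1, Rmult_1_r, Rabs_minus_sym in H.
  change zero with 0 in H; now rewrite Rminus_0_r in H.
Qed.

Lemma high_increment (F theta a b t : R) (f e : R -> R) :
  high_bound F f e -> 0 < t -> 1 <= a <= b ->
  Rabs (RInt (fun s => f s * K theta s t) a b) <= 4 * F * sqrt t / a.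
Proof.
  intros (Hf & He & HF) Ht Hab.
  apply (osc_tail f (fun s => e s / s)); auto; try lra.
  - intros s Hs; apply Hf; lra.
  - intros s Hs. apply (continuous_mult e (fun s => / s)); [ apply He; lra | ].
    derive_continuous; lra.
  - intros s Hs; replace (s * (e s / s)) with (e s) by (field; lra); apply HF; lra.
Qed.

Lemma high_continuous (F : R) (f e : R -> R) (s : R) :
  high_bound F f e -> 0 < s -> continuous f s.
Proof. intros (Hf & _ & _) Hs; now apply (continuous_of_derive _ _ _ (Hf s Hs)). Qed.

Lemma high_spec (F theta t : R) (f e : R -> R) :
  high_bound F f e -> 0 < t ->
  is_lim_seq (fun n => RInt (fun s => f s * K theta s t) 1 (INR (S n))) (high theta f t) /\
  (forall b, 1 <= b ->
    Rabs (RInt (fun s => f s * K theta s t) 1 b - high theta f t) <= 4 * F * sqrt t / b).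
Proof.
  intros Hhb Ht.
  apply (lim_of_rate (fun b => RInt (fun s => f s * K theta s t) 1 b)
          (fun b => 4 * F * sqrt t / b) (fun n => INR (S n)) (fun b => 1 <= b)).
  - apply INR_S_ge1.
  - intros b Hb.
    destruct (INR_unbounded b) as [N HN].
    exists N; intros n Hn.
    assert (Hnb : b < INR (S n)).
    { apply Rlt_le_trans with (1 := HN), le_INR; lia. }
    assert (Hi : forall u v, 1 <= u <= v -> ex_RInt (fun s => f s * K theta s t) u v).
    { intros u v Huv; apply ex_RInt_K; try lra.
      intros s Hs; apply (high_continuous F f e); auto; lra. }
    rewrite <- (RInt_chasles_R _ 1 b (INR (S n))) by (apply Hi; lra).
    match goal with |- Rabs ?x <= _ =>
      replace x with (RInt (fun s => f s * K theta s t) b (INR (S n)))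
        by (symmetry; real_eq; ring) end.
    apply (high_increment F theta b _ t f e); auto; lra.
  - apply is_lim_seq_div_S.
Qed.

Lemma RInt_K_le (F theta a b t : R) (f : R -> R) :
  0 < t -> 0 <= a <= b ->
  (forall s, a <= s <= b -> continuous f s) ->
  (forall s, a <= s <= b -> Rabs (f s) <= F) ->
  Rabs (RInt (fun s => f s * K theta s t) a b) <= F * b / sqrt t.
Proof.
  intros Ht Hab Hc HF.
  assert (Hst : 0 < / sqrt t) by (apply Rinv_0_lt_compat, sqrt_lt_R0; lra).
  assert (HF0 : 0 <= F) by (apply Rle_trans with (2 := HF a (conj (Rle_refl a) (proj2 Hab))), Rabs_pos).
  apply Rle_trans with ((b - a) * (F * / sqrt t)).
  - apply abs_RInt_le_const; try lra; [ apply ex_RInt_K; auto; lra | ].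
    intros s Hs; rewrite Rabs_mult.
    apply Rmult_le_compat; try apply Rabs_pos; [ auto | now apply K_bound ].
  - unfold Rdiv. rewrite (Rmult_comm F b), Rmult_assoc.
    apply Rmult_le_compat_r; [ nra | lra ].
Qed.

(** The bound does not depend on t: below sqrt t there is no oscillation but K
    is O(1 / sqrt t), beyond sqrt t the phase oscillates. *)
Lemma high_le (F theta t : R) (f e : R -> R) :
  high_bound F f e -> 0 < t -> Rabs (high theta f t) <= 5 * F.
Proof.
  intros Hhb Ht.
  destruct (high_spec F theta t f e Hhb Ht) as [_ H].
  assert (HF := high_bound_pos _ _ _ Hhb).
  assert (Hst : 0 < sqrt t) by now apply sqrt_lt_R0.
  destruct (Rle_dec (sqrt t) 1) as [Ht1 | Ht1].
  - specialize (H 1 (Rle_refl 1)).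
    rewrite RInt_point, Rabs_minus_sym in H.
    change zero with 0 in H; rewrite Rminus_0_r in H.
    apply Rle_trans with (1 := H). unfold Rdiv; rewrite Rinv_1. nra.
  - assert (H1 : 1 <= sqrt t) by lra. specialize (H _ H1).
    assert (H2 : Rabs (RInt (fun s => f s * K theta s t) 1 (sqrt t)) <= F * sqrt t / sqrt t).
    { apply RInt_K_le; try lra.
      - intros s Hs; apply (high_continuous F f e); auto; lra.
      - intros s Hs; apply Hhb; lra. }
    replace (F * sqrt t / sqrt t) with F in H2 by (field; lra).
    replace (4 * F * sqrt t / sqrt t) with (4 * F) in H by (field; lra).
    set (I := RInt _ 1 (sqrt t)) in *.
    replace (high theta f t) with (I + - (I - high theta f t)) by ring.
    apply Rle_trans with (1 := Rabs_triang _ _); rewrite Rabs_Ropp; lra.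
Qed.

(** Convergence at both ends together with a rate that is locally uniform in t
    and only depends on f through F and G. *)
Lemma low_plus_high_spec (F G theta t : R) (f e : R -> R) :
  low_bound F f -> high_bound G f e -> 0 < t ->
  is_RInt_gen (fun s => f s * K theta s t) (at_right 0) (Rbar_locally p_infty)
    (low theta f t + high theta f t) /\
  (forall a b, 0 < a <= 1 -> 1 <= b ->
    Rabs (RInt (fun s => f s * K theta s t) a b - (low theta f t + high theta f t))
    <= 2 * F / sqrt t * sqrt a + 4 * G * sqrt t / b).
Proof.
  intros Hlb Hhb Ht.
  destruct (low_spec F theta t f Hlb Ht) as [_ H1].
  destruct (high_spec G theta t f e Hhb Ht) as [_ H2].
  assert (Hi : forall u v, 0 < u <= v -> ex_RInt (fun s => f s * K theta s t) u v).
  { intros u v Huv; apply ex_RInt_K; try lra. intros s Hs; apply Hlb; lra. }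
  assert (H : forall a b, 0 < a <= 1 -> 1 <= b ->
    Rabs (RInt (fun s => f s * K theta s t) a b - (low theta f t + high theta f t))
    <= 2 * F / sqrt t * sqrt a + 4 * G * sqrt t / b).
  { intros a b Ha Hb.
    rewrite <- (RInt_chasles_R _ a 1 b) by (apply Hi; lra).
    match goal with |- Rabs (?x + ?y - (?u + ?v)) <= _ =>
      replace (x + y - (u + v)) with ((x - u) + (y - v)) by ring end.
    apply Rle_trans with (1 := Rabs_triang _ _).
    apply Rplus_le_compat; auto. }
  split; [ | exact H ].
  assert (Hst : 0 < sqrt t) by now apply sqrt_lt_R0.
  assert (HF := low_bound_pos _ _ Hlb). assert (HG := high_bound_pos _ _ _ Hhb).
  apply filterlimi_locally; intros eps.
  assert (He := cond_pos eps).
  set (A := 2 * F / sqrt t) in *. set (B := 4 * G * sqrt t) in *.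
  assert (HA : 0 <= A) by (unfold A; apply Rmult_le_pos; [ lra | left; now apply Rinv_0_lt_compat ]).
  assert (HB : 0 <= B) by (unfold B; nra).
  set (d := (eps / 2 / (A + 1))).
  assert (Hd : 0 < d) by (unfold d; repeat apply Rdiv_lt_0_compat; lra).
  set (M := 2 * (B + 1) / eps + 1).
  assert (Hm : 0 < 2 * (B + 1) / eps) by (apply Rdiv_lt_0_compat; lra).
  apply (Filter_prod _ _ _ (fun a => 0 < a <= 1 /\ sqrt a < d) (fun b => M < b)).
  - assert (Hd2 : 0 < Rmin 1 (d ^ 2)) by (apply Rmin_pos; [ lra | apply pow_lt; exact Hd ]).
    exists (mkposreal _ Hd2); intros a Ha Ha0.
    change (Rabs (a - 0) < Rmin 1 (d ^ 2)) in Ha.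
    rewrite Rminus_0_r, Rabs_pos_eq in Ha by lra.
    assert (H3 := Rmin_l 1 (d ^ 2)); assert (H4 := Rmin_r 1 (d ^ 2)).
    split; [ lra | ].
    rewrite <- (sqrt_pow2 d) by lra. apply sqrt_lt_1_alt; lra.
  - exists M; auto.
  - intros a b [Ha Hda] Hb; simpl.
    exists (RInt (fun s => f s * K theta s t) a b).
    assert (Hb1 : 1 <= b) by (unfold M in Hb; lra).
    split; [ apply (RInt_correct (fun s => f s * K theta s t)), Hi; lra | ].
    change (Rabs (RInt (fun s => f s * K theta s t) a b - (low theta f t + high theta f t)) < eps).
    apply Rle_lt_trans with (1 := H a b Ha Hb1).
    assert (H3 : A * sqrt a <= eps / 2).
    { apply Rle_trans with (A * d).
      - apply Rmult_le_compat_l; lra.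
      - apply Rle_trans with ((A + 1) * d); [ | right; unfold d; field; lra ].
        apply Rmult_le_compat_r; lra. }
    assert (H4 : B / b < eps / 2).
    { apply (Rmult_lt_reg_r b); [ lra | ].
      replace (B / b * b) with B by (field; lra).
      assert (H5 : eps / 2 * (2 * (B + 1) / eps) = B + 1) by (field; lra).
      unfold M in Hb.
      assert (H6 : eps / 2 * (2 * (B + 1) / eps) < eps / 2 * b) by (apply Rmult_lt_compat_l; lra).
      lra. }
    lra.
Qed.

Lemma near_half (t u : R) : 0 < t -> Rabs (u - t) < t / 2 -> t / 2 < u < 2 * t.
Proof. intros Ht Hu; apply Rabs_def2 in Hu; lra. Qed.

Lemma inv_sqrt_near (t u : R) : 0 < t -> t / 2 < u -> / sqrt u <= / sqrt (t / 2).
Proof.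
  intros Ht Hu; apply Rinv_le_contravar; [ apply sqrt_lt_R0; lra | apply sqrt_le_1_alt; lra ].
Qed.

Lemma low_bound_sq (F : R) (f : R -> R) :
  low_bound F f -> low_bound F (fun s => s ^ 2 * f s).
Proof.
  intros [Hc Hf]; split.
  - intros s Hs; apply (continuous_mult (fun s => s ^ 2) f); [ | now apply Hc ].
    derive_continuous.
  - intros s Hs; rewrite Rabs_mult.
    apply Rle_trans with (1 * Rabs (f s)); [ | rewrite Rmult_1_l; now apply Hf ].
    apply Rmult_le_compat_r; [ apply Rabs_pos | ].
    rewrite Rabs_pos_eq by (apply pow_le; lra). nra.
Qed.

(** On (0, 1] the function f may have no useful derivative, so the derivative
    falls on K alone; this costs a factor s^2 / t, harmless for s <= 1 but
    responsible for the powers of 1/t in [poly_bound]. *)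
Lemma is_derive_low (F theta t : R) (f : R -> R) :
  low_bound F f -> 0 < t ->
  is_derive (low theta f) t
    ((- / 2 * low theta f t + / (2 * t) * low (theta + PI / 2) (fun s => s ^ 2 * f s) t) / t).
Proof.
  intros Hlb Ht.
  assert (Hlb2 := low_bound_sq F f Hlb).
  assert (HF := low_bound_pos _ _ Hlb).
  set (r := / sqrt (t / 2)).
  assert (Hr : 0 <= r) by (unfold r; left; apply Rinv_0_lt_compat, sqrt_lt_R0; lra).
  apply (is_derive_lim
    (fun n t => RInt (fun s => f s * K theta s t) (/ INR (S n)) 1)
    (fun n t => (- / 2 * RInt (fun s => f s * K theta s t) (/ INR (S n)) 1
       + / (2 * t) * RInt (fun s => s ^ 2 * f s * K (theta + PI / 2) s t) (/ INR (S n)) 1) / t)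
    (low theta f)
    (fun t => (- / 2 * low theta f t + / (2 * t) * low (theta + PI / 2) (fun s => s ^ 2 * f s) t) / t)
    (fun n => ((1 + / t) * (2 * F * r) * (2 / t)) * sqrt (/ INR (S n))) t (t / 2)); try lra.
  - intros u n Hu. apply near_half in Hu; auto.
    assert (Hn := inv_INR_S n).
    assert (Hi1 : ex_RInt (fun s => f s * K theta s u) (/ INR (S n)) 1).
    { apply ex_RInt_K; try lra. intros; apply Hlb; lra. }
    assert (Hi2 : ex_RInt (fun s => s ^ 2 * f s * K (theta + PI / 2) s u) (/ INR (S n)) 1).
    { apply ex_RInt_K; try lra. intros; apply Hlb2; lra. }
    eapply is_derive_eq.
    + apply RInt_K_dt; try lra. intros s Hs; apply Hlb; lra.
    + rewrite (RInt_ext _ (fun s => (- / 2 / u) * (f s * K theta s u)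
           + (/ (2 * u) / u) * (s ^ 2 * f s * K (theta + PI / 2) s u))).
      2: { intros s _; simpl; field; lra. }
      rewrite RInt_plus_R; [ | apply (ex_RInt_scal (fun s => f s * K theta s u)); exact Hi1
        | apply (ex_RInt_scal (fun s => s ^ 2 * f s * K (theta + PI / 2) s u)); exact Hi2 ].
      rewrite !RInt_scal_R by assumption. field; lra.
  - intros u Hu; apply near_half in Hu; auto. apply (low_spec F); auto; lra.
  - intros u n Hu; apply near_half in Hu; auto.
    assert (Hn := inv_INR_S n).
    destruct (low_spec F theta u f Hlb ltac:(lra)) as [_ H1]; specialize (H1 _ Hn).
    destruct (low_spec F (theta + PI / 2) u _ Hlb2 ltac:(lra)) as [_ H2]; specialize (H2 _ Hn).
    assert (Hru : / sqrt u <= r) by (apply inv_sqrt_near; lra).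
    assert (Hq : 0 <= sqrt (/ INR (S n))) by apply sqrt_pos.
    set (q := sqrt (/ INR (S n))) in *.
    assert (Hb : 2 * F / sqrt u * q <= 2 * F * r * q).
    { apply Rmult_le_compat_r; [ exact Hq | ]. apply Rmult_le_compat_l; lra. }
    set (I1 := RInt _ _ _) in H1 |- *. set (I2 := RInt (fun s => s ^ 2 * f s * _) _ _) in H2 |- *.
    replace (_ - _) with ((- / 2 * (I1 - low theta f u)
      + / (2 * u) * (I2 - low (theta + PI / 2) (fun s => s ^ 2 * f s) u)) * / u) by (field; lra).
    assert (Hu1 : / (2 * u) <= / t) by (apply Rinv_le_contravar; lra).
    assert (Hu2 : / u <= 2 / t).
    { replace (2 / t) with (/ (t / 2)) by (field; lra). apply Rinv_le_contravar; lra. }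
    assert (Hu0 : 0 < / u) by (apply Rinv_0_lt_compat; lra).
    assert (Hu3 : 0 < / (2 * u)) by (apply Rinv_0_lt_compat; lra).
    assert (Hit : 0 < / t) by (apply Rinv_0_lt_compat; lra).
    rewrite Rabs_mult, (Rabs_pos_eq (/ u)) by lra.
    replace ((1 + / t) * (2 * F * r) * (2 / t) * q) with ((1 + / t) * (2 * F * r * q) * (2 / t)) by ring.
    apply Rmult_le_compat; try apply Rabs_pos; try lra.
    apply Rle_trans with (1 := Rabs_triang _ _).
    rewrite !Rabs_mult, Rabs_Ropp, (Rabs_pos_eq (/ 2)), (Rabs_pos_eq (/ (2 * u))) by lra.
    assert (P1 := Rabs_pos (I1 - low theta f u)).
    assert (P2 := Rabs_pos (I2 - low (theta + PI / 2) (fun s => s ^ 2 * f s) u)).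
    rewrite Rmult_plus_distr_r, Rmult_1_l. apply Rplus_le_compat; [ lra | ].
    apply Rmult_le_compat; lra.
  - apply is_lim_seq_sqrt_inv_S.
Qed.

(** The Euler derivative in t is half the transform of the Euler derivative in
    s, plus the boundary term at s = 1. *)
Lemma is_derive_high (F G theta t : R) (f e e1 : R -> R) :
  high_bound F f e -> high_bound G e e1 -> 0 < t ->
  is_derive (high theta f) t ((/ 2 * (f 1 * K theta 1 t) + / 2 * high theta e t) / t).
Proof.
  intros Hf He Ht.
  assert (HF := high_bound_pos _ _ _ Hf). assert (HG := high_bound_pos _ _ _ He).
  set (r := / sqrt (t / 2)).
  assert (Hr : 0 <= r) by (unfold r; left; apply Rinv_0_lt_compat, sqrt_lt_R0; lra).
  apply (is_derive_lim
    (fun n t => RInt (fun s => f s * K theta s t) 1 (INR (S n))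
        - t / INR (S n) * f (INR (S n)) * K (theta + PI / 2) (INR (S n)) t)
    (fun n t => / (2 * t) * (1 * f 1 * K theta 1 t + RInt (fun s => s * (e s / s) * K theta s t) 1 (INR (S n)))
      - f (INR (S n)) * K (theta + PI / 2) (INR (S n)) t / (2 * INR (S n)))
    (high theta f)
    (fun t => (/ 2 * (f 1 * K theta 1 t) + / 2 * high theta e t) / t)
    (fun n => (2 * G * r + F * r) / INR (S n)) t (t / 2)); try lra.
  - intros u n Hu. apply near_half in Hu; auto.
    assert (Hn := INR_S_ge1 n).
    apply osc_corrected_dt; try lra.
    + intros s Hs; apply Hf; lra.
    + intros s Hs. apply (continuous_mult e (fun s => / s)); [ apply Hf; lra | ].
      derive_continuous; lra.
  - intros u Hu; apply near_half in Hu; auto.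
    replace (Finite (high theta f u)) with (Finite (high theta f u - 0)) by (f_equal; ring).
    apply (is_lim_seq_minus' (fun n => RInt (fun s => f s * K theta s u) 1 (INR (S n)))).
    + apply (high_spec F theta u f e); auto; lra.
    + apply (is_lim_seq_le_bound _ (fun n => F * sqrt u / INR (S n))); [ | apply is_lim_seq_div_S ].
      intros n. assert (Hn := INR_S_ge1 n). rewrite Rminus_0_r.
      replace (u / INR (S n) * f (INR (S n)) * K (theta + PI / 2) (INR (S n)) u)
        with (f (INR (S n)) * (u * K (theta + PI / 2) (INR (S n)) u) * / INR (S n)) by (field; lra).
      assert (Hp : 0 < / INR (S n)) by (apply Rinv_0_lt_compat; lra).
      rewrite Rabs_mult, (Rabs_pos_eq (/ _)) by lra.
      apply Rmult_le_compat_r; [ lra | ]. rewrite Rabs_mult.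
      apply Rmult_le_compat; try apply Rabs_pos; [ now apply Hf | apply tK_bound; lra ].
  - intros u n Hu; apply near_half in Hu; auto.
    assert (Hn := INR_S_ge1 n). set (b := INR (S n)) in *.
    rewrite (RInt_ext _ (fun s => e s * K theta s u)).
    2: { rewrite Rmin_left, Rmax_right by lra. intros s Hs; real_eq; field; lra. }
    destruct (high_spec G theta u e e1 He ltac:(lra)) as [_ H1]; specialize (H1 b Hn).
    set (I := RInt _ 1 b) in *.
    assert (Hru : / sqrt u <= r) by (apply inv_sqrt_near; lra).
    assert (Hsu : 0 < sqrt u) by (apply sqrt_lt_R0; lra).
    assert (Hp : 0 < / b) by (apply Rinv_0_lt_compat; lra).
    replace (_ - _) with (/ (2 * u) * (I - high theta e u)
        + - (/ 2 * (f b * K (theta + PI / 2) b u) * / b)) by (field; lra).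
    apply Rle_trans with (1 := Rabs_triang _ _). rewrite Rabs_Ropp.
    unfold Rdiv; rewrite Rmult_plus_distr_r; apply Rplus_le_compat.
    + rewrite Rabs_mult, Rabs_pos_eq by (left; apply Rinv_0_lt_compat; lra).
      apply Rle_trans with (/ (2 * u) * (4 * G * sqrt u / b)).
      * apply Rmult_le_compat_l; [ left; apply Rinv_0_lt_compat; lra | exact H1 ].
      * replace (/ (2 * u) * (4 * G * sqrt u / b)) with (2 * G * / sqrt u * / b).
        2: { rewrite <- (sqrt_sqrt u) at 2 by lra. field; lra. }
        apply Rmult_le_compat_r; [ lra | ]. apply Rmult_le_compat_l; lra.
    + rewrite Rabs_mult, (Rabs_pos_eq (/ b)) by lra.
      apply Rmult_le_compat_r; [ lra | ].
      rewrite Rabs_mult, (Rabs_pos_eq (/ 2)), Rabs_mult by lra.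
      assert (Hk : Rabs (K (theta + PI / 2) b u) <= / sqrt u) by (apply K_bound; lra).
      destruct Hf as (_ & _ & Hf); destruct (Hf b Hn) as [Hfb _].
      assert (P1 := Rabs_pos (f b)). assert (P2 := Rabs_pos (K (theta + PI / 2) b u)).
      assert (Rabs (f b) * Rabs (K (theta + PI / 2) b u) <= F * r) by (apply Rmult_le_compat; lra).
      nra.
  - apply is_lim_seq_div_S.
Qed.

(** * Functions of (x, s) with bounded Euler derivatives *)

Definition weight (x s : R) : R := (1 + x ^ 2) * (1 + / s).

Definition poly_bound (g : R -> R -> R) : Prop :=
  exists (M : R) (N : nat), 0 <= M /\ forall x s, 0 < s -> Rabs (g x s) <= M * weight x s ^ N.

Definition kernel0 (g : R -> R -> R) : Prop :=
  (forall x s, 0 < s -> continuous (fun x => g x s) x) /\ poly_bound g.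

(** n + 1 levels of Euler derivatives are controlled: e stands for s d/ds g.
    Using s d/ds instead of d/ds is essential, since bounds on ordinary
    derivatives do not give a bound on the transform. *)
Fixpoint kernel (n : nat) (g : R -> R -> R) : Prop :=
  match n with
  | O => kernel0 g
  | S n' => kernel0 g /\
      exists e : R -> R -> R,
        (forall x s, 0 < s -> is_derive (g x) s (e x s / s)) /\ kernel n' e
  end.

Definition near_zero (g : R -> R -> R) : Prop :=
  exists (M : R) (N : nat),
    forall x s, 0 < s <= 1 -> Rabs (g x s) <= M * (1 + x ^ 2) ^ N / sqrt s.

Lemma one_plus_sq (x : R) : 1 <= 1 + x ^ 2.
Proof. nra. Qed.

Lemma weight_ge1 (x s : R) : 0 < s -> 1 <= weight x s.
Proof.
  intros Hs; unfold weight; assert (H := one_plus_sq x).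
  assert (0 < / s) by now apply Rinv_0_lt_compat. nra.
Qed.

Lemma kernel_kernel0 (n : nat) (g : R -> R -> R) : kernel n g -> kernel0 g.
Proof. destruct n; simpl; tauto. Qed.

Lemma kernel_S (n : nat) (g : R -> R -> R) : kernel (S n) g -> kernel n g.
Proof.
  revert g; induction n as [ | n IH ]; intros g [H0 (e & He & Hk)]; [ exact H0 | ].
  split; [ exact H0 | exists e; split; [ exact He | now apply IH ] ].
Qed.

Lemma kernel_ext (n : nat) (g h : R -> R -> R) :
  (forall x s, 0 < s -> g x s = h x s) -> kernel n g -> kernel n h.
Proof.
  assert (H0 : forall g h : R -> R -> R,
    (forall x s, 0 < s -> g x s = h x s) -> kernel0 g -> kernel0 h).
  { clear; intros g h H [Hc (M & N & HM & Hb)]; split.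
    - intros x s Hs; apply (continuous_ext (fun x => g x s)); auto.
    - exists M, N; split; [ exact HM | ]; intros x s Hs; rewrite <- H by exact Hs; auto. }
  destruct n; [ apply H0 | ].
  intros H [Hg (e & He & Hk)]; split; [ now apply (H0 g) | ].
  exists e; split; [ | exact Hk ].
  intros x s Hs; apply (is_derive_ext_loc (g x)); [ | now apply He ].
  apply (locally_Rabs _ s s Hs); intros u Hu; apply H; apply Rabs_def2 in Hu; lra.
Qed.

Lemma kernel_plus (n : nat) (g h : R -> R -> R) :
  kernel n g -> kernel n h -> kernel n (fun x s => g x s + h x s).
Proof.
  assert (H0 : forall g h, kernel0 g -> kernel0 h -> kernel0 (fun x s => g x s + h x s)).
  { clear; intros g h [Hg (M & N & HM & Hb)] [Hh (M' & N' & HM' & Hb')]; split.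
    - intros x s Hs; apply (continuous_plus (fun x => g x s) (fun x => h x s)); auto.
    - exists (M + M'), (N + N')%nat; split; [ lra | ]; intros x s Hs.
      apply Rle_trans with (1 := Rabs_triang _ _).
      assert (H1 := weight_ge1 x s Hs).
      assert (weight x s ^ N <= weight x s ^ (N + N')) by (apply Rle_pow; [ lra | lia ]).
      assert (weight x s ^ N' <= weight x s ^ (N + N')) by (apply Rle_pow; [ lra | lia ]).
      assert (H2 := Hb x s Hs); assert (H3 := Hb' x s Hs). nra. }
  revert g h; induction n as [ | n IH ]; [ exact H0 | ].
  intros g h [Hg (e & He & Hk)] [Hh (e' & He' & Hk')]; split; [ now apply H0 | ].
  exists (fun x s => e x s + e' x s); split; [ | now apply IH ].
  intros x s Hs; apply is_derive_eq with (e x s / s + e' x s / s); [ | field; lra ].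
  apply (is_derive_plus (g x) (h x)); auto.
Qed.

Lemma kernel_mult (n : nat) (g h : R -> R -> R) :
  kernel n g -> kernel n h -> kernel n (fun x s => g x s * h x s).
Proof.
  assert (H0 : forall g h, kernel0 g -> kernel0 h -> kernel0 (fun x s => g x s * h x s)).
  { clear; intros g h [Hg (M & N & HM & Hb)] [Hh (M' & N' & HM' & Hb')]; split.
    - intros x s Hs; apply (continuous_mult (fun x => g x s) (fun x => h x s)); auto.
    - exists (M * M'), (N + N')%nat; split; [ nra | ]; intros x s Hs.
      rewrite Rabs_mult, pow_add.
      replace (M * M' * (weight x s ^ N * weight x s ^ N'))
        with ((M * weight x s ^ N) * (M' * weight x s ^ N')) by ring.
      apply Rmult_le_compat; try apply Rabs_pos; auto. }
  revert g h; induction n as [ | n IH ]; [ exact H0 | ].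
  intros g h Hg0 Hh0.
  assert (Hg1 := kernel_S _ _ Hg0); assert (Hh1 := kernel_S _ _ Hh0).
  destruct Hg0 as [Hg (e & He & Hk)]; destruct Hh0 as [Hh (e' & He' & Hk')].
  split; [ now apply H0 | ].
  exists (fun x s => e x s * h x s + g x s * e' x s); split.
  - intros x s Hs; apply is_derive_eq with (e x s / s * h x s + g x s * (e' x s / s)); [ | field; lra ].
    apply is_derive_mult_R; auto.
  - apply kernel_plus; apply IH; auto.
Qed.

Lemma kernel_of_x (n : nat) (u : R -> R) (M : R) (N : nat) :
  0 <= M -> (forall x, continuous u x) -> (forall x, Rabs (u x) <= M * (1 + x ^ 2) ^ N) ->
  kernel n (fun x _ => u x).
Proof.
  intros HM Hc Hb.
  assert (H0 : forall u M N, 0 <= M -> (forall x, continuous u x) ->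
    (forall x, Rabs (u x) <= M * (1 + x ^ 2) ^ N) -> kernel0 (fun x _ => u x)).
  { clear; intros u M N HM Hc Hb; split; [ intros; apply Hc | ].
    exists M, N; split; [ exact HM | ]. intros x s Hs.
    apply Rle_trans with (1 := Hb x), Rmult_le_compat_l; [ exact HM | ].
    apply pow_incr; split; [ assert (H := one_plus_sq x); lra | ].
    unfold weight; assert (H := one_plus_sq x).
    assert (0 < / s) by now apply Rinv_0_lt_compat. nra. }
  revert u M N HM Hc Hb; induction n as [ | n IH ]; intros u M N HM Hc Hb; [ now apply (H0 u M N) | ].
  split; [ now apply (H0 u M N) | ].
  exists (fun _ _ => 0); split.
  - intros x s Hs; apply is_derive_eq with 0; [ apply (is_derive_const (u x)) | field; lra ].
  - apply (IH (fun _ => 0) 0 0%nat); [ lra | intros; apply continuous_const | ].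
    intros; rewrite Rabs_R0; simpl; lra.
Qed.

Lemma kernel_const (n : nat) (c : R) : kernel n (fun _ _ => c).
Proof.
  apply (kernel_of_x n (fun _ => c) (Rabs c) 0); [ apply Rabs_pos | intros; apply continuous_const | ].
  intros; simpl; lra.
Qed.

Lemma kernel_scal (n : nat) (c : R) (g : R -> R -> R) :
  kernel n g -> kernel n (fun x s => c * g x s).
Proof. intros Hg; apply (kernel_mult n (fun _ _ => c)); [ apply kernel_const | exact Hg ]. Qed.

Lemma kernel_inv (n : nat) : kernel n (fun _ s => / s).
Proof.
  assert (H0 : kernel0 (fun _ s => / s)).
  { split; [ intros; apply continuous_const | ].
    exists 1, 1%nat; split; [ lra | ]. intros x s Hs.
    assert (0 < / s) by now apply Rinv_0_lt_compat.
    rewrite Rabs_pos_eq by lra. unfold weight. assert (H1 := one_plus_sq x). simpl (_ ^ 1). nra. }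
  induction n as [ | n IH ]; [ exact H0 | ].
  split; [ exact H0 | ].
  exists (fun _ s => - 1 * / s); split.
  - intros x s Hs; auto_derive; [ lra | field; lra ].
  - now apply kernel_scal.
Qed.

Lemma inv_sqrt_le (s : R) : 0 < s -> / sqrt s <= 1 + / s.
Proof.
  intros Hs. rewrite <- (sqrt_sqrt s) at 2 by lra.
  assert (0 < sqrt s) by now apply sqrt_lt_R0.
  rewrite Rinv_mult. assert (0 < / sqrt s) by now apply Rinv_0_lt_compat. nra.
Qed.

Lemma kernel_K (n : nat) (theta M : R) (v : R -> R) :
  0 <= M -> (forall x, continuous v x) -> (forall x, (v x) ^ 2 <= M * (1 + x ^ 2)) ->
  kernel n (fun x s => K theta (v x) s).
Proof.
  intros HM Hc Hb.
  assert (H0 : forall theta, kernel0 (fun x s => K theta (v x) s)).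
  { intros th; split.
    - intros x s Hs; apply (continuous_comp v (fun y => K th y s)); [ apply Hc | now apply K_continuous_s ].
    - exists 1, 1%nat; split; [ lra | ]. intros x s Hs.
      apply Rle_trans with (1 := K_bound th (v x) s Hs).
      apply Rle_trans with (1 := inv_sqrt_le s Hs).
      unfold weight; assert (H1 := one_plus_sq x).
      assert (0 < / s) by now apply Rinv_0_lt_compat. simpl (_ ^ 1); nra. }
  revert theta; induction n as [ | n IH ]; intros theta; [ apply H0 | ].
  split; [ apply H0 | ].
  exists (fun x s => - / 2 * K theta (v x) s + (/ 2 * (v x) ^ 2) * / s * K (theta + PI / 2) (v x) s); split.
  - intros x s Hs. apply (is_derive_eq _ _ _ _ (K_dt theta (v x) s Hs)). simpl; field; lra.
  - apply kernel_plus; [ now apply kernel_scal | ].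
    apply (kernel_mult n (fun x s => (/ 2 * (v x) ^ 2) * / s)); [ | apply IH ].
    apply (kernel_mult n (fun x s => / 2 * (v x) ^ 2) (fun _ s => / s)); [ | apply kernel_inv ].
    apply (kernel_of_x n (fun x => / 2 * v x ^ 2) M 1); [ exact HM | | ].
    + intros x; apply (continuous_scal_r (/ 2) (fun x => v x ^ 2)).
      apply (continuous_comp v (fun y => y ^ 2)); [ apply Hc | ].
      derive_continuous.
    + intros x; rewrite Rabs_pos_eq by nra. specialize (Hb x). simpl in *; nra.
Qed.

Lemma pow_one_plus_sq_mono (x y : R) (N : nat) :
  Rabs (y - x) < 1 -> (1 + y ^ 2) ^ N <= (1 + (Rabs x + 1) ^ 2) ^ N.
Proof.
  intros H; apply pow_incr; split; [ nra | ].
  apply Rplus_le_compat_l. rewrite <- (pow2_abs y).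
  apply pow_incr; split; [ apply Rabs_pos | ].
  replace y with (x + (y - x)) by ring. apply Rle_trans with (1 := Rabs_triang _ _); lra.
Qed.

(** Joint continuity comes for free from continuity in x and a bound on the
    s-derivative that is locally uniform in x. *)
Lemma kernel_continuity_2d (g : R -> R -> R) (x s : R) :
  kernel 1 g -> 0 < s -> continuity_2d_pt g x s.
Proof.
  intros [[Hc _] (e & He & [_ (M & N & HM & Hb)])] Hs eps.
  set (B := M * ((1 + (Rabs x + 1) ^ 2) * (1 + / (s / 2))) ^ N / (s / 2)).
  assert (Hs2 : 0 < / (s / 2)) by (apply Rinv_0_lt_compat; lra).
  assert (HB : 0 <= B).
  { unfold B. apply Rmult_le_pos; [ | lra ].
    apply Rmult_le_pos; [ exact HM | ].
    apply pow_le, Rmult_le_pos; [ assert (H := pow2_ge_0 (Rabs x + 1)) | ]; lra. }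
  assert (HL : forall y r, Rabs (y - x) < 1 -> Rabs (r - s) < s / 2 ->
                 Rabs (g y r - g y s) <= B * Rabs (r - s)).
  { intros y r Hy Hr. assert (Hr' := near_half s r Hs Hr).
    destruct (MVT_gen (g y) s r (fun z => e y z / z)) as (c & Hcr & ->).
    - intros z Hz. apply He. assert (H := Rmin_glb s r (s / 2)); lra.
    - intros z Hz. apply continuity_pt_filterlim.
      apply (continuous_of_derive (g y) z (e y z / z)), He.
      assert (H := Rmin_glb s r (s / 2)); lra.
    - assert (Hc0 : s / 2 <= c) by (assert (H := Rmin_glb s r (s / 2)); lra).
      rewrite Rabs_mult; apply Rmult_le_compat_r; [ apply Rabs_pos | ].
      unfold Rdiv; rewrite Rabs_mult; fold (s / 2).
      assert (Hic : 0 < / c) by (apply Rinv_0_lt_compat; lra).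
      assert (Hic2 : / c <= / (s / 2)) by (apply Rinv_le_contravar; lra).
      rewrite (Rabs_pos_eq (/ c)) by lra.
      unfold B. apply Rmult_le_compat; [ apply Rabs_pos | lra | | exact Hic2 ].
      apply Rle_trans with (1 := Hb y c ltac:(lra)).
      apply Rmult_le_compat_l; [ exact HM | ].
      apply pow_incr; split; [ assert (H := weight_ge1 y c ltac:(lra)); lra | ].
      unfold weight. apply Rmult_le_compat; try lra; try nra.
      assert (H := pow_one_plus_sq_mono x y 1 Hy). lra. }
  assert (He2 : 0 < eps / 2) by (assert (H := cond_pos eps); lra).
  assert (Hl : locally x (fun y => Rabs (g y s - g x s) < eps / 2)).
  { apply (proj1 (filterlim_locally (fun y => g y s) (g x s)) (Hc x s Hs) (mkposreal _ He2)). }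
  destruct Hl as [d Hd].
  assert (Hd0 := cond_pos d).
  assert (Hm : 0 < Rmin (Rmin d 1) (Rmin (s / 2) (eps / 2 / (B + 1)))).
  { repeat apply Rmin_pos; try lra. apply Rdiv_lt_0_compat; lra. }
  exists (mkposreal _ Hm); simpl; intros y r Hy Hr.
  assert (Hy1 : Rabs (y - x) < d /\ Rabs (y - x) < 1).
  { assert (H1 := Rmin_l (Rmin d 1) (Rmin (s / 2) (eps / 2 / (B + 1)))).
    assert (H2 := Rmin_l d 1); assert (H3 := Rmin_r d 1); lra. }
  assert (Hr1 : Rabs (r - s) < s / 2 /\ Rabs (r - s) < eps / 2 / (B + 1)).
  { assert (H1 := Rmin_r (Rmin d 1) (Rmin (s / 2) (eps / 2 / (B + 1)))).
    assert (H2 := Rmin_l (s / 2) (eps / 2 / (B + 1))).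
    assert (H3 := Rmin_r (s / 2) (eps / 2 / (B + 1))); lra. }
  assert (H1 := HL y r (proj2 Hy1) (proj1 Hr1)).
  assert (H2 := Hd y (proj1 Hy1)).
  assert (H3 : B * Rabs (r - s) <= eps / 2).
  { apply Rle_trans with ((B + 1) * (eps / 2 / (B + 1))); [ | right; field; lra ].
    apply Rmult_le_compat; try lra. apply Rabs_pos. }
  replace (g y r - g x s) with ((g y r - g y s) + (g y s - g x s)) by ring.
  apply Rle_lt_trans with (1 := Rabs_triang _ _). lra.
Qed.

Lemma continuous_lim (u : nat -> R -> R) (f : R -> R) (eta : nat -> R) (x : R) :
  (forall n y, continuous (u n) y) ->
  (forall n y, Rabs (y - x) < 1 -> Rabs (u n y - f y) <= eta n) ->
  is_lim_seq eta 0 -> continuous f x.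
Proof.
  intros Hu Hr He. apply continuity_pt_filterlim.
  apply (CVU_continuity u f x (mkposreal 1 Rlt_0_1)).
  - intros eps Heps.
    destruct (proj2 (is_lim_seq_spec eta 0) He (mkposreal eps Heps)) as [N HN].
    exists N; intros n y Hn Hy.
    specialize (HN n Hn); simpl in HN; rewrite Rminus_0_r in HN.
    rewrite Rabs_minus_sym.
    apply Rle_lt_trans with (eta n); [ now apply Hr | ].
    apply Rle_lt_trans with (2 := HN), Rle_abs.
  - intros n y _; apply continuity_pt_filterlim, Hu.
  - red; simpl; replace (x - x) with 0 by ring; rewrite Rabs_R0; lra.
Qed.

Lemma continuous_RInt_K (g : R -> R -> R) (theta a b t x : R) :
  0 < a <= b -> 0 < t -> (forall x s, 0 < s -> continuity_2d_pt g x s) ->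
  continuous (fun x => RInt (fun s => g x s * K theta s t) a b) x.
Proof.
  intros Hab Ht Hg.
  apply (continuous_param (fun x s => g x s * K theta s t) a b x 1); try lra.
  - intros s Hs; apply continuity_2d_pt_mult; [ apply Hg; lra | ].
    apply (continuity_2d_snd (fun s => K theta s t)); now apply K_continuous_s.
  - intros u _; apply ex_RInt_K; try lra.
    intros s Hs; apply continuity_2d_slice_snd, Hg; lra.
Qed.

Lemma near_zero_low_bound (g : R -> R -> R) :
  (forall x s, 0 < s -> continuity_2d_pt g x s) -> near_zero g ->
  exists (M : R) (N : nat), 0 <= M /\ forall x, low_bound (M * (1 + x ^ 2) ^ N) (g x).
Proof.
  intros Hg (M & N & HM); exists M, N.
  assert (H : forall x, low_bound (M * (1 + x ^ 2) ^ N) (g x)).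
  { intros x; split; [ intros s Hs; now apply continuity_2d_slice_snd, Hg | intros s Hs; now apply HM ]. }
  split; [ | exact H ].
  specialize (H 0). apply low_bound_pos in H.
  replace (1 + 0 ^ 2) with 1 in H by ring. rewrite pow1 in H; lra.
Qed.

(** Differentiating in t reproduces an integral over (0, 1] of the same kind,
    with g replaced by s^2 g; hence all levels follow from [near_zero] alone. *)
Lemma kernel_low (n : nat) (theta : R) (g : R -> R -> R) :
  (forall x s, 0 < s -> continuity_2d_pt g x s) -> near_zero g ->
  kernel n (fun x t => low theta (g x) t).
Proof.
  assert (H0 : forall theta g, (forall x s, 0 < s -> continuity_2d_pt g x s) -> near_zero g ->
    kernel0 (fun x t => low theta (g x) t)).
  { clear; intros theta g Hg Hz; destruct (near_zero_low_bound g Hg Hz) as (M & N & HM & HL).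
    split.
    - intros x t Ht.
      apply (continuous_lim (fun n x => RInt (fun s => g x s * K theta s t) (/ INR (S n)) 1) _
         (fun n => 2 * (M * (1 + (Rabs x + 1) ^ 2) ^ N) / sqrt t * sqrt (/ INR (S n)))).
      + intros n y; apply continuous_RInt_K; auto. apply inv_INR_S.
      + intros n y Hy.
        destruct (low_spec _ theta t (g y) (HL y) Ht) as [_ H].
        apply Rle_trans with (1 := H _ (inv_INR_S n)).
        apply Rmult_le_compat_r; [ apply sqrt_pos | ].
        unfold Rdiv; apply Rmult_le_compat_r; [ left; now apply Rinv_0_lt_compat, sqrt_lt_R0 | ].
        apply Rmult_le_compat_l; [ lra | ]. apply Rmult_le_compat_l; [ exact HM | ].
        now apply pow_one_plus_sq_mono.
      + apply is_lim_seq_sqrt_inv_S.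
    - exists (2 * M), (N + 1)%nat; split; [ lra | ]. intros x t Ht.
      apply Rle_trans with (1 := low_le _ theta t (g x) (HL x) Ht).
      unfold Rdiv; rewrite pow_add, !Rmult_assoc.
      apply Rmult_le_compat_l; [ lra | ]. apply Rmult_le_compat_l; [ exact HM | ].
      assert (Hi := inv_sqrt_le t Ht). assert (H1 := one_plus_sq x).
      assert (Hp : 0 < / t) by now apply Rinv_0_lt_compat.
      apply Rmult_le_compat.
      + apply pow_le; lra.
      + left; now apply Rinv_0_lt_compat, sqrt_lt_R0.
      + apply pow_incr; unfold weight; split; [ lra | nra ].
      + unfold weight; simpl (_ ^ 1). nra. }
  revert theta g; induction n as [ | n IH ]; intros theta g Hg Hz; [ now apply H0 | ].
  split; [ now apply H0 | ].
  exists (fun x t => - / 2 * low theta (g x) t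
    + / 2 * / t * low (theta + PI / 2) (fun s => s ^ 2 * g x s) t).
  destruct (near_zero_low_bound g Hg Hz) as (M & N & HM & HL).
  split.
  - intros x t Ht. apply (is_derive_eq _ _ _ _ (is_derive_low _ theta t (g x) (HL x) Ht)).
    now rewrite Rinv_mult.
  - apply kernel_plus; [ now apply kernel_scal, IH | ].
    apply (kernel_mult n (fun _ t => / 2 * / t)); [ apply kernel_scal, kernel_inv | ].
    apply (IH (theta + PI / 2) (fun x s => s ^ 2 * g x s)).
    + intros x s Hs; apply continuity_2d_pt_mult; [ | now apply Hg ].
      apply (continuity_2d_snd (fun s => s ^ 2)).
      derive_continuous.
    + exists M, N; intros x s Hs. now apply (low_bound_sq _ _ (HL x)).
Qed.

Lemma kernel_high_bound (n : nat) (g : R -> R -> R) :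
  kernel (S (S n)) g ->
  exists (e : R -> R -> R) (M : R) (N : nat), 0 <= M /\
    (forall x, high_bound (M * (1 + x ^ 2) ^ N) (g x) (e x)) /\ kernel (S n) e.
Proof.
  intros [[_ (M1 & N1 & HM1 & Hb1)] (e & He & Hk)].
  destruct (kernel_kernel0 _ _ Hk) as [_ (M2 & N2 & HM2 & Hb2)].
  exists e, (M1 * 2 ^ N1 + M2 * 2 ^ N2), (N1 + N2)%nat.
  assert (Hp1 : 0 <= M1 * 2 ^ N1) by (apply Rmult_le_pos; [ lra | apply pow_le; lra ]).
  assert (Hp2 : 0 <= M2 * 2 ^ N2) by (apply Rmult_le_pos; [ lra | apply pow_le; lra ]).
  split; [ lra | split; [ | exact Hk ] ].
  assert (Hgen : forall M N A x s, 0 <= M -> 1 <= s -> A <= M * weight x s ^ N ->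
             A <= M * 2 ^ N * (1 + x ^ 2) ^ N).
  { intros M N A x s HM Hs HA. apply Rle_trans with (1 := HA).
    rewrite Rmult_assoc; apply Rmult_le_compat_l; [ exact HM | ].
    rewrite <- Rpow_mult_distr. assert (H := one_plus_sq x).
    assert (Hi : / s <= 1) by (rewrite <- Rinv_1; apply Rinv_le_contravar; lra).
    assert (Hi0 : 0 < / s) by (apply Rinv_0_lt_compat; lra).
    apply pow_incr; unfold weight; split; nra. }
  intros x. split; [ intros s Hs; now apply He | split ].
  - intros s Hs. destruct Hk as [_ (e1 & He1 & _)]. now apply (continuous_of_derive _ _ _ (He1 x s Hs)).
  - intros s Hs. assert (H1 := one_plus_sq x).
    assert (P1 : (1 + x ^ 2) ^ N1 <= (1 + x ^ 2) ^ (N1 + N2)) by (apply Rle_pow; [ lra | lia ]).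
    assert (P2 : (1 + x ^ 2) ^ N2 <= (1 + x ^ 2) ^ (N1 + N2)) by (apply Rle_pow; [ lra | lia ]).
    assert (Q1 : 0 <= (1 + x ^ 2) ^ N1) by (apply pow_le; lra).
    assert (Q2 : 0 <= (1 + x ^ 2) ^ N2) by (apply pow_le; lra).
    assert (A1 := Hgen M1 N1 _ x s HM1 Hs (Hb1 x s ltac:(lra))).
    assert (A2 := Hgen M2 N2 _ x s HM2 Hs (Hb2 x s ltac:(lra))).
    split; nra.
Qed.

(** Two levels are lost: the bound on the transform uses the Euler derivative of
    g, and the integration by parts behind it uses its continuity. *)
Lemma kernel_high (n : nat) (theta : R) (g : R -> R -> R) :
  kernel (S (S n)) g -> kernel n (fun x t => high theta (g x) t).
Proof.
  assert (H0 : forall theta n g, kernel (S (S n)) g -> kernel0 (fun x t => high theta (g x) t)).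
  { clear; intros theta n g Hg.
    destruct (kernel_high_bound n g Hg) as (e & M & N & HM & HH & _).
    split.
    - intros x t Ht.
      apply (continuous_lim (fun n x => RInt (fun s => g x s * K theta s t) 1 (INR (S n))) _
         (fun n => 4 * (M * (1 + (Rabs x + 1) ^ 2) ^ N) * sqrt t / INR (S n))).
      + intros m y; apply continuous_RInt_K; auto.
        * split; [ lra | apply INR_S_ge1 ].
        * intros z s Hs; apply kernel_continuity_2d; auto.
          clear -Hg. induction n; [ now apply kernel_S | apply IHn; now apply kernel_S ].
      + intros m y Hy.
        destruct (high_spec _ theta t (g y) (e y) (HH y) Ht) as [_ H].
        assert (Hm := INR_S_ge1 m).
        apply Rle_trans with (1 := H _ Hm).
        unfold Rdiv; apply Rmult_le_compat_r; [ left; apply Rinv_0_lt_compat; lra | ].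
        apply Rmult_le_compat_r; [ apply sqrt_pos | ].
        apply Rmult_le_compat_l; [ lra | ]. apply Rmult_le_compat_l; [ exact HM | ].
        now apply pow_one_plus_sq_mono.
      + apply is_lim_seq_div_S.
    - exists (5 * M), N; split; [ lra | ]. intros x t Ht.
      apply Rle_trans with (1 := high_le _ theta t (g x) (e x) (HH x) Ht).
      rewrite Rmult_assoc; apply Rmult_le_compat_l; [ lra | ].
      apply Rmult_le_compat_l; [ exact HM | ].
      assert (H1 := one_plus_sq x). assert (Hp : 0 < / t) by now apply Rinv_0_lt_compat.
      apply pow_incr; unfold weight; split; [ lra | nra ]. }
  revert theta g; induction n as [ | n IH ]; intros theta g Hg; [ now apply (H0 theta 0%nat) | ].
  split; [ now apply (H0 theta (S n)) | ].
  destruct (kernel_high_bound (S n) g Hg) as (e & M & N & HM & HH & Hk).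
  exists (fun x t => / 2 * (g x 1 * K theta 1 t) + / 2 * high theta (e x) t).
  destruct (kernel_high_bound n e Hk) as (e1 & M1 & N1 & HM1 & HH1 & _).
  split.
  - intros x t Ht. now apply (is_derive_high _ _ theta t (g x) (e x) (e1 x) (HH x) (HH1 x)).
  - apply kernel_plus; [ | now apply kernel_scal, IH ].
    apply kernel_scal.
    apply (kernel_mult n (fun x _ => g x 1) (fun _ t => K theta 1 t)).
    + apply (kernel_of_x n _ M N HM).
      * intros x; apply (proj1 (kernel_kernel0 _ _ Hg)); lra.
      * intros x; apply (HH x); lra.
    + apply (kernel_K n theta 1 (fun _ => 1)); [ lra | intros; apply continuous_const | ].
      intros; nra.
Qed.

(** * The iterated density *)

Definition fresnel_int (theta : R) (f : R -> R) (t : R) : R :=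
  RInt_gen (fun s => f s * K theta s t) (at_right 0) (Rbar_locally p_infty).

Lemma fresnel_int_eq (F G theta t : R) (f e : R -> R) :
  low_bound F f -> high_bound G f e -> 0 < t ->
  fresnel_int theta f t = low theta f t + high theta f t.
Proof.
  intros Hl Hh Ht; apply is_RInt_gen_unique; now apply (low_plus_high_spec F G theta t f e).
Qed.

Definition smooth_kernel (g : R -> R -> R) : Prop :=
  (forall n, kernel n g) /\ near_zero g.

Lemma smooth_kernel_continuity_2d (g : R -> R -> R) (x s : R) :
  smooth_kernel g -> 0 < s -> continuity_2d_pt g x s.
Proof. intros [Hg _]; apply kernel_continuity_2d, Hg. Qed.

(** One polynomial majorant in x for both ends of the integral. *)
Lemma smooth_kernel_bounds (g : R -> R -> R) :
  smooth_kernel g ->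
  exists (e : R -> R -> R) (M : R) (N : nat), 0 <= M /\
    forall x, low_bound (M * (1 + x ^ 2) ^ N) (g x) /\ high_bound (M * (1 + x ^ 2) ^ N) (g x) (e x).
Proof.
  intros Hg.
  destruct (near_zero_low_bound g (fun x s => smooth_kernel_continuity_2d g x s Hg) (proj2 Hg))
    as (M & N & HM & HL).
  destruct (kernel_high_bound 0 g (proj1 Hg _)) as (e & M' & N' & HM' & HH & _).
  exists e, (M + M'), (N + N')%nat; split; [ lra | ]; intros x.
  assert (H1 := one_plus_sq x).
  assert (P1 : (1 + x ^ 2) ^ N <= (1 + x ^ 2) ^ (N + N')) by (apply Rle_pow; [ lra | lia ]).
  assert (P2 : (1 + x ^ 2) ^ N' <= (1 + x ^ 2) ^ (N + N')) by (apply Rle_pow; [ lra | lia ]).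
  assert (Q1 : 0 <= (1 + x ^ 2) ^ N) by (apply pow_le; lra).
  assert (Q2 : 0 <= (1 + x ^ 2) ^ N') by (apply pow_le; lra).
  destruct (HL x) as [HLc HLb]; destruct (HH x) as (HHd & HHc & HHb).
  split; [ split | split; [ | split ] ]; auto.
  - intros s Hs; apply Rle_trans with (1 := HLb s Hs).
    apply Rmult_le_compat_r; [ left; apply Rinv_0_lt_compat, sqrt_lt_R0; lra | nra ].
  - intros s Hs; destruct (HHb s Hs); split; nra.
Qed.

Lemma smooth_kernel_K (theta : R) : smooth_kernel (fun x s => K theta x s).
Proof.
  split.
  - intros n; apply (kernel_K n theta 1 (fun x => x)); [ lra | intros; apply continuous_id | intros; nra ].
  - exists 1, 0%nat; intros x s Hs; simpl; unfold Rdiv; rewrite !Rmult_1_l.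
    apply K_bound; lra.
Qed.

Lemma smooth_kernel_step (c theta : R) (g : R -> R -> R) :
  smooth_kernel g -> smooth_kernel (fun x t => c * fresnel_int theta (g x) t).
Proof.
  intros Hg.
  destruct (smooth_kernel_bounds g Hg) as (e & M & N & HM & HB).
  assert (HE : forall x t, 0 < t ->
     c * (low theta (g x) t + high theta (g x) t) = c * fresnel_int theta (g x) t).
  { intros x t Ht; f_equal; symmetry.
    now apply (fresnel_int_eq _ _ theta t (g x) (e x) (proj1 (HB x)) (proj2 (HB x))). }
  split.
  - intros n; apply (kernel_ext n _ _ HE).
    apply kernel_scal, kernel_plus; [ | now apply kernel_high, Hg ].
    apply kernel_low; [ | apply Hg ].
    intros x s; now apply smooth_kernel_continuity_2d.
  - exists (Rabs c * (7 * M)), N; intros x t Ht.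
    rewrite <- HE by lra. rewrite Rabs_mult.
    unfold Rdiv; rewrite !Rmult_assoc; apply Rmult_le_compat_l; [ apply Rabs_pos | ].
    apply Rle_trans with (1 := Rabs_triang _ _).
    assert (H1 := low_le _ theta t _ (proj1 (HB x)) ltac:(lra)).
    assert (H2 := high_le _ theta t _ _ (proj2 (HB x)) ltac:(lra)).
    assert (H3 : 1 <= / sqrt t).
    { rewrite <- Rinv_1; apply Rinv_le_contravar; [ apply sqrt_lt_R0; lra | ].
      rewrite <- sqrt_1; apply sqrt_le_1_alt; lra. }
    assert (H4 : 0 <= M * (1 + x ^ 2) ^ N).
    { apply Rmult_le_pos; [ exact HM | apply pow_le; assert (H := one_plus_sq x); lra ]. }
    unfold Rdiv in H1. nra.
Qed.

(** The factor 2 at each step collects to the 2^k in front of the iterated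
    integral. *)
Fixpoint iter_kernel (k : nat) : R -> R -> R :=
  match k with
  | O => fun x t => K (PI / 4) x t
  | S k' => fun x t => 2 * fresnel_int (PI / 4) (iter_kernel k' x) t
  end.

Lemma smooth_iter_kernel (k : nat) : smooth_kernel (iter_kernel k).
Proof.
  induction k as [ | k IH ]; [ apply smooth_kernel_K | now apply smooth_kernel_step ].
Qed.

Lemma is_RInt_gen_kernel (g : R -> R -> R) (theta x t : R) :
  smooth_kernel g -> 0 < t ->
  is_RInt_gen (fun s => g x s * K theta s t) (at_right 0) (Rbar_locally p_infty)
    (fresnel_int theta (g x) t).
Proof.
  intros Hg Ht. destruct (smooth_kernel_bounds g Hg) as (e & M & N & HM & HB).
  destruct (HB x) as [HL HH].
  rewrite (fresnel_int_eq _ _ theta t (g x) (e x) HL HH Ht).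
  now apply (low_plus_high_spec _ _ theta t (g x) (e x) HL HH Ht).
Qed.

(** The factors of [fresnel_chain] that do not involve the k innermost variables
    and come out of the k innermost integrals. *)
Fixpoint later_factors (i m : nat) (s : nat -> R) : R :=
  match m with
  | O => 1
  | S m' => fresnel_density (s i) (s (S i)) * later_factors (S i) m' s
  end.

Lemma later_factors_ext (i m : nat) (s s' : nat -> R) :
  (forall j, (i <= j)%nat -> s j = s' j) -> later_factors i m s = later_factors i m s'.
Proof.
  revert i; induction m as [ | m IH ]; intros i H; [ reflexivity | simpl ].
  rewrite (IH (S i)), !H; auto; intros; apply H; lia.
Qed.

Lemma later_factors_snoc (i m : nat) (s : nat -> R) :
  later_factors i (S m) s = later_factors i m s * fresnel_density (s (i + m)%nat) (s (S (i + m))).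
Proof.
  revert i; induction m as [ | m IH ]; intros i.
  - simpl; rewrite Nat.add_0_r; ring.
  - change (fresnel_density (s i) (s (S i)) * later_factors (S i) (S m) s
      = fresnel_density (s i) (s (S i)) * later_factors (S i) m s
        * fresnel_density (s (i + S m)%nat) (s (S (i + S m)))).
    rewrite IH. replace (S i + m)%nat with (i + S m)%nat by lia. ring.
Qed.

Lemma fresnel_chain_factors (n : nat) (s : nat -> R) :
  fresnel_chain n s = later_factors 0 (S n) s.
Proof.
  induction n as [ | n IH ].
  - unfold fresnel_chain; simpl; ring.
  - rewrite later_factors_snoc, <- IH. reflexivity.
Qed.

Lemma update_same (s : nat -> R) (k : nat) (y : R) : update s k y k = y.
Proof. unfold update; now rewrite Nat.eqb_refl. Qed.

Lemma update_other (s : nat -> R) (k : nat) (y : R) (i : nat) : i <> k -> update s k y i = s i.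
Proof. intros H; unfold update; now rewrite (proj2 (Nat.eqb_neq i k) H). Qed.

(** The positivity hypothesis covers the variables that are not integrated yet:
    each of them is an integration variable on (0, oo) or the final time. *)
Lemma iterated_fresnel (k m : nat) (s : nat -> R) :
  (forall j, (k < j)%nat -> (j <= S (k + m))%nat -> 0 < s j) ->
  ex_iterated_RInt k (fresnel_chain (k + m)) s /\
  iterated_RInt k (fresnel_chain (k + m)) s
  = / 2 ^ k * iter_kernel k (s 0%nat) (s (S k)) * later_factors (S k) m s.
Proof.
  revert m s; induction k as [ | k IH ]; intros m s Hs.
  { split; [ exact I | ]. simpl iterated_RInt. rewrite fresnel_chain_factors; simpl.
    unfold fresnel_density, K; simpl. rewrite Rinv_1. ring. }
  replace (S k + m)%nat with (k + S m)%nat by lia.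
  assert (Hu : forall y, 0 < y ->
    forall j, (k < j)%nat -> (j <= S (k + S m))%nat -> 0 < update s (S k) y j).
  { intros y Hy j Hj1 Hj2. destruct (Nat.eq_dec j (S k)) as [-> | Hne].
    - now rewrite update_same.
    - rewrite update_other by exact Hne. apply Hs; lia. }
  assert (Ht : 0 < s (S (S k))) by (apply Hs; lia).
  assert (HE : forall y, 0 < y ->
    iterated_RInt k (fresnel_chain (k + S m)) (update s (S k) y)
    = (/ 2 ^ k * later_factors (S (S k)) m s)
      * (iter_kernel k (s 0%nat) y * K (PI / 4) y (s (S (S k))))).
  { intros y Hy. rewrite (proj2 (IH (S m) _ (Hu y Hy))).
    rewrite update_same, (update_other s (S k) y 0) by lia.
    simpl later_factors. rewrite update_same, update_other by lia.
    rewrite (later_factors_ext (S (S k)) m (update s (S k) y) s).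
    2: { intros j Hj; apply update_other; lia. }
    unfold fresnel_density, K. ring. }
  assert (HI : is_RInt_gen (fun y => iterated_RInt k (fresnel_chain (k + S m)) (update s (S k) y))
     (at_right 0) (Rbar_locally p_infty)
     ((/ 2 ^ k * later_factors (S (S k)) m s)
        * fresnel_int (PI / 4) (iter_kernel k (s 0%nat)) (s (S (S k))))).
  { apply (is_RInt_gen_ext (fun y => scal (/ 2 ^ k * later_factors (S (S k)) m s)
             (iter_kernel k (s 0%nat) y * K (PI / 4) y (s (S (S k)))))).
    - apply (Filter_prod _ _ _ (fun a => 0 < a) (fun b => 0 < b)).
      + exists (mkposreal 1 Rlt_0_1); auto.
      + exists 0; auto.
      + intros a b Ha Hb y Hy; simpl in Hy; symmetry; apply HE.
        assert (H := Rmin_glb_lt a b 0 Ha Hb); lra.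
    - apply (is_RInt_gen_scal (fun y => iter_kernel k (s 0%nat) y * K (PI / 4) y (s (S (S k))))).
      apply is_RInt_gen_kernel; [ apply smooth_iter_kernel | exact Ht ]. }
  split.
  - split; [ intros y Hy; apply IH, Hu, Hy | ].
    eexists; exact HI.
  - transitivity ((/ 2 ^ k * later_factors (S (S k)) m s)
        * fresnel_int (PI / 4) (iter_kernel k (s 0%nat)) (s (S (S k)))).
    + now apply is_RInt_gen_unique.
    + simpl. rewrite Rinv_mult. field. apply pow_nonzero; lra.
Qed.

Lemma iterated_fresnel_ends (n : nat) (x t : R) :
  0 < t ->
  ex_iterated_RInt n (fresnel_chain n) (fresnel_ends n x t) /\
  iterated_fresnel_density n x t = iter_kernel n x t.
Proof.
  intros Ht.
  destruct (iterated_fresnel n 0 (fresnel_ends n x t)) as [H1 H2].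
  - intros j Hj1 Hj2. replace j with (S n) by lia. unfold fresnel_ends; now rewrite update_same.
  - rewrite Nat.add_0_r in H1, H2. split; [ exact H1 | ].
    unfold iterated_fresnel_density; rewrite H2. unfold fresnel_ends.
    rewrite update_same, update_other, update_same by lia.
    simpl later_factors. field. apply pow_nonzero; lra.
Qed.

(** * Absolutely convergent integrals over the line *)

Definition line_int (F : R -> R) : R :=
  RInt_gen F (Rbar_locally m_infty) (Rbar_locally p_infty).

Definition decay (C : R) (F : R -> R) : Prop :=
  (forall x, continuous F x) /\ forall x, Rabs (F x) <= C / (1 + x ^ 2).

Lemma decay_pos (C : R) (F : R -> R) : decay C F -> 0 <= C.
Proof.
  intros [_ H]; specialize (H 0). assert (H0 := Rabs_pos (F 0)).
  replace (C / (1 + 0 ^ 2)) with C in H by field. lra.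
Qed.

Lemma ex_RInt_decay (C : R) (F : R -> R) (a b : R) : decay C F -> ex_RInt F a b.
Proof. intros [H _]; apply (ex_RInt_continuous F); auto. Qed.

Lemma decay_tail (C : R) (F : R -> R) (a b : R) :
  decay C F -> 0 < a <= b -> Rabs (RInt F a b) <= C / a.
Proof.
  intros HF [Ha Hab]. assert (HC := decay_pos _ _ HF).
  destruct (RInt_ftc (fun x => - C * / x) (fun x => C / x ^ 2) a b Hab) as [Hi HE].
  - intros x Hx; auto_derive; [ lra | field; lra ].
  - intros x Hx; derive_continuous; nra.
  - apply Rle_trans with (RInt (fun x => C / x ^ 2) a b).
    + apply RInt_abs_le; auto; [ now apply (ex_RInt_decay C) | ].
      intros x Hx; apply Rle_trans with (1 := proj2 HF x).
      apply Rmult_le_compat_l; [ exact HC | ]. apply Rinv_le_contravar; nra.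
    + rewrite HE. assert (0 < / b) by (apply Rinv_0_lt_compat; lra).
      assert (0 <= C * / b) by (apply Rmult_le_pos; lra). unfold Rdiv; lra.
Qed.

Lemma decay_opp_arg (C : R) (F : R -> R) : decay C F -> decay C (fun x => F (- x)).
Proof.
  intros [Hc Hb]; split.
  - intros x; apply (continuous_comp Ropp F); [ | apply Hc ].
    derive_continuous.
  - intros x; replace (x ^ 2) with ((- x) ^ 2) by ring; apply Hb.
Qed.

Lemma RInt_opp_arg (F : R -> R) (a b : R) :
  (forall x, continuous F x) -> RInt F (- b) (- a) = RInt (fun x => F (- x)) a b.
Proof.
  intros HF.
  assert (Hi : forall u v, ex_RInt F u v) by (intros; apply (ex_RInt_continuous F); auto).
  assert (H := is_RInt_comp_opp F a b _ (RInt_correct F _ _ (Hi (- a) (- b)))).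
  apply (is_RInt_opp (fun y => opp (F (- y)))) in H.
  apply (@is_RInt_unique R_CompleteNormedModule _ a b) in H.
  transitivity (RInt (fun y => opp (opp (F (- y)))) a b).
  - refine (eq_trans _ (eq_sym H)); symmetry; apply (opp_RInt_swap F (- a) (- b)), Hi.
  - apply RInt_ext; intros x _; apply (opp_opp (F (- x))).
Qed.

Lemma decay_symmetric_tail (C : R) (F : R -> R) (a b : R) :
  decay C F -> 0 < a <= b -> Rabs (RInt F (- b) (- a)) <= C / a.
Proof.
  intros HF Hab; rewrite RInt_opp_arg by apply HF.
  apply decay_tail; [ now apply decay_opp_arg | exact Hab ].
Qed.

Lemma line_int_spec (C : R) (F : R -> R) :
  decay C F ->
  is_RInt_gen F (Rbar_locally m_infty) (Rbar_locally p_infty) (line_int F) /\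
  (forall X, 1 <= X -> Rabs (RInt F (- X) X - line_int F) <= 2 * C / X).
Proof.
  intros HF. assert (HC := decay_pos _ _ HF).
  assert (Hi : forall u v, ex_RInt F u v) by (intros; now apply (ex_RInt_decay C)).
  destruct (lim_of_rate (fun X => RInt F (- X) X) (fun X => 2 * C / X) (fun n => INR (S n))
      (fun X => 1 <= X)) as [HL HR].
  - apply INR_S_ge1.
  - intros X HX. destruct (INR_unbounded X) as [N HN].
    exists N; intros n Hn.
    assert (Hb : X < INR (S n)) by (apply Rlt_le_trans with (1 := HN), le_INR; lia).
    rewrite <- (RInt_chasles_R F (- INR (S n)) (- X)), <- (RInt_chasles_R F (- X) X) by auto.
    match goal with |- Rabs ?x <= _ =>
      replace x with (RInt F (- INR (S n)) (- X) + RInt F X (INR (S n))) by ring end.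
    apply Rle_trans with (1 := Rabs_triang _ _).
    assert (H1 := decay_symmetric_tail C F X (INR (S n)) HF ltac:(lra)).
    assert (H2 := decay_tail C F X (INR (S n)) HF ltac:(lra)).
    unfold Rdiv in *; lra.
  - apply is_lim_seq_div_S.
  - set (L := real (Lim_seq (fun n => RInt F (- INR (S n)) (INR (S n))))) in *.
    assert (HG : is_RInt_gen F (Rbar_locally m_infty) (Rbar_locally p_infty) L).
    { apply filterlimi_locally; intros eps. assert (He := cond_pos eps).
      set (X := 4 * (C + 1) / eps + 1).
      assert (HX : 0 < 4 * (C + 1) / eps) by (apply Rdiv_lt_0_compat; lra).
      assert (HX1 : 1 <= X) by (unfold X; lra).
      apply (Filter_prod _ _ _ (fun a => a < - X) (fun b => X < b)).
      - exists (- X); auto.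
      - exists X; auto.
      - intros a b Ha Hb; simpl. exists (RInt F a b).
        split; [ apply (RInt_correct F), Hi | ].
        change (Rabs (RInt F a b - L) < eps).
        rewrite <- (RInt_chasles_R F a (- X) b), <- (RInt_chasles_R F (- X) X b) by auto.
        match goal with |- Rabs (?u + (?v + ?w) - L) < _ =>
          replace (u + (v + w) - L) with (u + ((v - L) + w)) by ring end.
        assert (H1 := decay_symmetric_tail C F X (- a) HF ltac:(lra)).
        rewrite Ropp_involutive in H1.
        assert (H2 := decay_tail C F X b HF ltac:(lra)).
        assert (H3 := HR X HX1).
        assert (H4 : 4 * C / X < eps).
        { apply (Rmult_lt_reg_r X); [ lra | ].
          replace (4 * C / X * X) with (4 * C) by (field; lra).
          assert (H5 : eps * (4 * (C + 1) / eps) = 4 * (C + 1)) by (field; lra).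
          unfold X; lra. }
        apply Rle_lt_trans with (1 := Rabs_triang _ _).
        assert (H6 := Rabs_triang (RInt F (- X) X - L) (RInt F X b)).
        unfold Rdiv in *; lra. }
    assert (HE : line_int F = L) by now apply is_RInt_gen_unique.
    rewrite HE; split; [ exact HG | exact HR ].
Qed.

(** On [-1, 1] the integrand is at most C, and the two tails together contribute at
    most 2 C. *)
Lemma line_int_le (C : R) (F : R -> R) : decay C F -> Rabs (line_int F) <= 4 * C.
Proof.
  intros HF. assert (HC := decay_pos _ _ HF).
  destruct (line_int_spec C F HF) as [_ H]; specialize (H 1 (Rle_refl 1)).
  assert (H1 : Rabs (RInt F (- (1)) 1) <= (1 - - (1)) * C).
  { apply abs_RInt_le_const; [ lra | now apply (ex_RInt_decay C) | ].
    intros x _; apply Rle_trans with (1 := proj2 HF x).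
    apply Rle_trans with (C / 1); [ | right; field ].
    apply Rmult_le_compat_l; [ exact HC | ]. apply Rinv_le_contravar; nra. }
  replace (line_int F) with (RInt F (- (1)) 1 + - (RInt F (- (1)) 1 - line_int F)) by ring.
  apply Rle_trans with (1 := Rabs_triang _ _); rewrite Rabs_Ropp.
  replace (2 * C / 1) with (2 * C) in H by field. lra.
Qed.

Lemma line_int_seq (C : R) (F : R -> R) :
  decay C F -> is_lim_seq (fun n => RInt F (- INR (S n)) (INR (S n))) (line_int F).
Proof.
  intros HF; destruct (line_int_spec C F HF) as [_ H].
  apply (is_lim_seq_le_bound _ (fun n => 2 * C / INR (S n))); [ | apply is_lim_seq_div_S ].
  intros n; apply H, INR_S_ge1.
Qed.

Lemma line_int_linear (C D a b : R) (F G : R -> R) :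
  decay C F -> decay D G ->
  line_int (fun x => a * F x + b * G x) = a * line_int F + b * line_int G.
Proof.
  intros HF HG; apply is_RInt_gen_unique.
  apply (is_RInt_gen_plus (fun x => scal a (F x)) (fun x => scal b (G x))).
  - apply (is_RInt_gen_scal F); now apply (line_int_spec C).
  - apply (is_RInt_gen_scal G); now apply (line_int_spec D).
Qed.

Lemma line_int_ext (F G : R -> R) : (forall x, F x = G x) -> line_int F = line_int G.
Proof. intros H; f_equal; now apply functional_extensionality. Qed.

Lemma decay_linear (C D a b : R) (F G : R -> R) :
  decay C F -> decay D G -> decay (Rabs a * C + Rabs b * D) (fun x => a * F x + b * G x).
Proof.
  intros [HFc HF] [HGc HG]; split.
  - intros x; apply (continuous_plus (fun x => a * F x) (fun x => b * G x)).
    + apply (continuous_scal_r a F), HFc.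
    + apply (continuous_scal_r b G), HGc.
  - intros x; apply Rle_trans with (1 := Rabs_triang _ _).
    rewrite !Rabs_mult. unfold Rdiv; rewrite Rmult_plus_distr_r, !Rmult_assoc.
    apply Rplus_le_compat; apply Rmult_le_compat_l; try apply Rabs_pos; [ apply HF | apply HG ].
Qed.

Lemma continuity_2d_clamp (g : R -> R -> R) (a x s : R) :
  (forall x s, a <= s -> continuity_2d_pt g x s) -> continuity_2d_pt (fun x s => g x (Rmax a s)) x s.
Proof.
  intros Hg eps. destruct (Hg x (Rmax a s) (Rmax_l a s) eps) as [d Hd].
  exists d; intros u v Hu Hv; apply Hd; [ exact Hu | ].
  apply Rle_lt_trans with (2 := Hv).
  unfold Rmax; destruct (Rle_dec a v), (Rle_dec a s);
    unfold Rabs; repeat destruct Rcase_abs; lra.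
Qed.

(** Exchange on [-X, X] x [a, b], then let X tend to infinity; g is only known for
    s > 0, so it is continued by its value at s = a to apply the compact case. *)
Lemma line_int_fubini (g : R -> R -> R) (C a b : R) :
  0 < a <= b ->
  (forall x s, 0 < s -> continuity_2d_pt g x s) ->
  (forall x s, a <= s <= b -> Rabs (g x s) <= C / (1 + x ^ 2)) ->
  (forall s, a <= s <= b -> continuous (fun s => line_int (fun x => g x s)) s) ->
  decay ((b - a) * C) (fun x => RInt (g x) a b) /\
  line_int (fun x => RInt (g x) a b) = RInt (fun s => line_int (fun x => g x s)) a b.
Proof.
  intros [Ha Hab] Hg Hb Hc.
  assert (Hi : forall x u v, a <= u <= v -> ex_RInt (g x) u v).
  { intros x u v Huv; apply ex_RInt_cont; [ lra | ].
    intros z Hz; apply continuity_2d_slice_snd, Hg; lra. }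
  assert (HD : forall s, a <= s <= b -> decay C (fun x => g x s)).
  { intros s Hs; split; [ | intros x; now apply Hb ].
    intros x; apply continuity_2d_slice_fst, Hg; lra. }
  assert (HDI : decay ((b - a) * C) (fun x => RInt (g x) a b)).
  { split.
    - intros x; apply (continuous_param g a b x 1); try lra; auto.
      + intros s Hs; apply Hg; lra.
      + intros u _; apply Hi; lra.
    - intros x. unfold Rdiv; rewrite Rmult_assoc.
      apply abs_RInt_le_const; [ exact Hab | apply Hi; lra | ].
      intros s Hs; now apply Hb. }
  split; [ exact HDI | ].
  assert (L1 := line_int_seq _ _ HDI).
  assert (L2 : is_lim_seq (fun n => RInt (fun x => RInt (g x) a b) (- INR (S n)) (INR (S n)))
                 (RInt (fun s => line_int (fun x => g x s)) a b)).
  { apply (is_lim_seq_le_bound _ (fun n => (b - a) * (2 * C) / INR (S n))); [ | apply is_lim_seq_div_S ].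
    intros n. assert (Hn := INR_S_ge1 n). set (X := INR (S n)) in *.
    assert (HE : RInt (fun x => RInt (g x) a b) (- X) X
       = RInt (fun s => RInt (fun x => g x s) (- X) X) a b).
    { assert (HF := fubini_rectangle (fun x s => g x (Rmax a s)) (- X) X a b ltac:(lra) Hab
        (fun x s => continuity_2d_clamp g a x s (fun x s Hs => Hg x s (Rlt_le_trans _ _ _ Ha Hs)))).
      rewrite (RInt_ext _ (fun x => RInt (g x) a b)) in HF.
      2: { intros x _; apply RInt_ext; rewrite Rmin_left, Rmax_right by lra.
           intros s Hs; rewrite Rmax_right; [ reflexivity | lra ]. }
      rewrite HF. apply RInt_ext; rewrite Rmin_left, Rmax_right by lra.
      intros s Hs; rewrite Rmax_right; [ reflexivity | lra ]. }
    rewrite HE.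
    assert (Hi1 : ex_RInt (fun s => RInt (fun x => g x s) (- X) X) a b).
    { apply ex_RInt_cont; [ exact Hab | ]. intros s Hs.
      apply (continuous_param (fun s x => g x s) (- X) X s s); try lra.
      - intros x _ eps. destruct (Hg x s ltac:(lra) eps) as [d Hd].
        exists d; intros; now apply Hd.
      - intros u Hu; apply ex_RInt_cont; [ lra | ]. intros x _.
        apply continuity_2d_slice_fst, Hg. apply Rabs_def2 in Hu; lra. }
    assert (Hi2 : ex_RInt (fun s => line_int (fun x => g x s)) a b) by now apply ex_RInt_cont.
    match goal with |- Rabs ?d <= _ =>
      replace d with (RInt (fun s => RInt (fun x => g x s) (- X) X - line_int (fun x => g x s)) a b)
        by (apply (RInt_minus (fun s => RInt (fun x => g x s) (- X) X) (fun s => line_int (fun x => g x s))); assumption)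
    end.
    unfold Rdiv; rewrite Rmult_assoc.
    apply abs_RInt_le_const; [ exact Hab | | ].
    - now apply (ex_RInt_minus (fun s => RInt (fun x => g x s) (- X) X) (fun s => line_int (fun x => g x s))).
    - intros s Hs. now apply (line_int_spec C (fun x => g x s)); [ apply HD | ]. }
  assert (HU := is_lim_seq_unique _ _ L1). rewrite (is_lim_seq_unique _ _ L2) in HU.
  now injection HU.
Qed.

(** * Pairings with Schwartz functions *)

Lemma schwartz_continuous (phi : R -> R) (x : R) : schwartz phi -> continuous phi x.
Proof.
  intros [H _]. apply (@ex_derive_continuous R_AbsRing R_NormedModule phi x), (H 1%nat x).
Qed.

Lemma Derive_n_Derive_n (phi : R -> R) (k j : nat) :
  Derive_n (Derive_n phi k) j = Derive_n phi (k + j).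
Proof.
  apply functional_extensionality; intros x. rewrite Derive_n_comp. f_equal; lia.
Qed.

Lemma schwartz_Derive_n (phi : R -> R) (k : nat) : schwartz phi -> schwartz (Derive_n phi k).
Proof.
  intros [Hd Hb]; split.
  - intros [ | j] x; [ exact I | ]. simpl. rewrite Derive_n_Derive_n.
    apply (Hd (S (k + j)) x).
  - intros i j. rewrite Derive_n_Derive_n. apply Hb.
Qed.

Lemma one_plus_sq_pow_le (N : nat) (x : R) :
  (1 + x ^ 2) ^ N <= 2 ^ N * (1 + Rabs (x ^ (2 * N))).
Proof.
  rewrite pow_mult, Rabs_pos_eq by (apply pow_le, pow2_ge_0).
  assert (Hp : 0 < 2 ^ N) by (apply pow_lt; lra).
  assert (Hx : 0 <= (x ^ 2) ^ N) by (apply pow_le, pow2_ge_0).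
  assert (H2 := pow2_ge_0 x).
  destruct (Rle_dec (x ^ 2) 1) as [H | H].
  - apply Rle_trans with (2 ^ N); [ apply pow_incr; lra | nra ].
  - apply Rle_trans with ((2 * x ^ 2) ^ N); [ apply pow_incr; lra | ].
    rewrite Rpow_mult_distr; nra.
Qed.

(** (1 + x^2)^N <= 2^N (1 + x^(2N)), so two seminorms suffice; keeping the
    constant explicit in M is what temperedness asks for. *)
Lemma schwartz_decay (phi : R -> R) (N : nat) (M : R) :
  (forall i j x, (i <= 2 * N)%nat -> (j <= 2 * N)%nat -> Rabs (x ^ i * Derive_n phi j x) <= M) ->
  forall x, Rabs (phi x) <= 2 ^ N * (2 * M) / (1 + x ^ 2) ^ N.
Proof.
  intros HM x.
  assert (H1 := HM 0%nat 0%nat x ltac:(lia) ltac:(lia)).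
  assert (H2 := HM (2 * N)%nat 0%nat x ltac:(lia) ltac:(lia)).
  change (Derive_n phi 0 x) with (phi x) in H1, H2.
  rewrite Rabs_mult in H1, H2. rewrite pow_O, Rabs_R1 in H1.
  assert (Hw : 0 < (1 + x ^ 2) ^ N) by (apply pow_lt; assert (H := one_plus_sq x); lra).
  apply (Rmult_le_reg_r ((1 + x ^ 2) ^ N)); [ exact Hw | ].
  replace (2 ^ N * (2 * M) / (1 + x ^ 2) ^ N * (1 + x ^ 2) ^ N) with (2 ^ N * (2 * M)) by (field; lra).
  assert (H3 := one_plus_sq_pow_le N x).
  assert (Hp : 0 < 2 ^ N) by (apply pow_lt; lra).
  apply Rle_trans with (Rabs (phi x) * (2 ^ N * (1 + Rabs (x ^ (2 * N))))).
  - apply Rmult_le_compat_l; [ apply Rabs_pos | exact H3 ].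
  - assert (0 <= 2 ^ N) by lra. nra.
Qed.

Lemma finite_bound (P : nat -> R -> Prop) (n : nat) :
  (forall i M M', P i M -> M <= M' -> P i M') ->
  (forall i, exists M, P i M) ->
  exists M, forall i, (i <= n)%nat -> P i M.
Proof.
  intros Hm HP; induction n as [ | n [M HM] ].
  - destruct (HP 0%nat) as [M HM]; exists M; intros i Hi; now replace i with 0%nat by lia.
  - destruct (HP (S n)) as [M' HM']. exists (Rmax M M'); intros i Hi.
    destruct (Nat.eq_dec i (S n)) as [-> | Hne].
    + apply (Hm _ M'); [ exact HM' | apply Rmax_r ].
    + apply (Hm _ M); [ apply HM; lia | apply Rmax_l ].
Qed.

Lemma schwartz_seminorms (phi : R -> R) (N : nat) :
  schwartz phi -> exists M, forall i j x, (i <= N)%nat -> (j <= N)%nat ->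
    Rabs (x ^ i * Derive_n phi j x) <= M.
Proof.
  intros [_ Hb].
  destruct (finite_bound (fun i M => forall j, (j <= N)%nat -> forall x, Rabs (x ^ i * Derive_n phi j x) <= M) N)
    as [M HM].
  - intros i M M' HM HMM' j Hj x; apply Rle_trans with M; auto.
  - intros i. apply finite_bound with (P := fun j M => forall x, Rabs (x ^ i * Derive_n phi j x) <= M).
    + intros j M M' HM HMM' x; apply Rle_trans with M; auto.
    + intros j; apply Hb.
  - exists M; intros i j x Hi Hj; now apply HM.
Qed.

Lemma schwartz_decay_ex (phi : R -> R) (N : nat) :
  schwartz phi -> exists C, 0 <= C /\ forall x, Rabs (phi x) <= C / (1 + x ^ 2) ^ N.
Proof.
  intros Hphi. destruct (schwartz_seminorms phi (2 * N) Hphi) as [M HM].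
  exists (2 ^ N * (2 * M)); split.
  - assert (H := HM 0%nat 0%nat 0 ltac:(lia) ltac:(lia)).
    assert (H0 := Rabs_pos (0 ^ 0 * Derive_n phi 0 0)).
    apply Rmult_le_pos; [ apply pow_le; lra | lra ].
  - now apply schwartz_decay.
Qed.

Lemma decay_pairing (u phi : R -> R) (A C : R) (N : nat) :
  0 <= A ->
  (forall x, continuous u x) -> (forall x, Rabs (u x) <= A * (1 + x ^ 2) ^ N) ->
  (forall x, continuous phi x) -> (forall x, Rabs (phi x) <= C / (1 + x ^ 2) ^ (S N)) ->
  decay (A * C) (fun x => u x * phi x).
Proof.
  intros HA Huc Hu Hpc Hp; split.
  - intros x; now apply (continuous_mult u phi).
  - intros x; rewrite Rabs_mult.
    assert (H1 := one_plus_sq x).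
    assert (Hw : 0 < (1 + x ^ 2) ^ N) by (apply pow_lt; lra).
    replace (A * C / (1 + x ^ 2)) with ((A * (1 + x ^ 2) ^ N) * (C / (1 + x ^ 2) ^ (S N)))
      by (simpl; field; simpl in *; lra).
    apply Rmult_le_compat; try apply Rabs_pos; auto.
Qed.

Lemma tempered_function_poly (u : R -> R) (A : R) (N : nat) :
  0 <= A ->
  (forall x, continuous u x) -> (forall x, Rabs (u x) <= A * (1 + x ^ 2) ^ N) ->
  tempered_function u.
Proof.
  intros HA Huc Hu.
  assert (HD : forall phi, schwartz phi -> exists C, decay C (fun x => u x * phi x)).
  { intros phi Hphi. destruct (schwartz_decay_ex phi (S N) Hphi) as (C & HC & Hb).
    exists (A * C); apply (decay_pairing u phi A C N); auto.
    intros x; now apply schwartz_continuous. }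
  split; [ | split ].
  - intros a b; apply (ex_RInt_continuous u); auto.
  - intros phi Hphi. destruct (HD phi Hphi) as [C [Hc Hb]].
    exists (line_int (fun x => Rabs (u x * phi x))). apply (line_int_spec C). split.
    + intros x; apply (continuous_comp (fun x => u x * phi x) Rabs); [ apply Hc | apply continuous_Rabs ].
    + intros x; rewrite Rabs_Rabsolu; apply Hb.
  - split.
    + intros a b phi psi Hphi Hpsi.
      destruct (HD phi Hphi) as [C HC]; destruct (HD psi Hpsi) as [D HDD].
      unfold regular_distr. fold (line_int (fun x => u x * phi x)) (line_int (fun x => u x * psi x)).
      rewrite <- (line_int_linear C D a b _ _ HC HDD).
      apply line_int_ext; intros x; ring.
    (* One power more than the growth of u makes the product O(1 / (1 + x^2)). *)
    + exists (2 * S N)%nat, (4 * (A * (2 ^ S N * 2))). intros phi Hphi M HM.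
      replace (4 * (A * (2 ^ S N * 2)) * M) with (4 * (A * (2 ^ S N * (2 * M)))) by ring.
      apply (line_int_le (A * (2 ^ S N * (2 * M)))).
      apply (decay_pairing u phi A _ N); auto.
      * intros x; now apply schwartz_continuous.
      * apply schwartz_decay. exact (fun i j x Hi Hj => HM i j x Hi Hj).
Qed.

Lemma poly_bound_slice (g : R -> R -> R) :
  poly_bound g -> exists N : nat, forall t0, 0 < t0 -> exists A, 0 <= A /\
    forall x t, t0 <= t -> Rabs (g x t) <= A * (1 + x ^ 2) ^ N.
Proof.
  intros (M & N & HM & Hb). exists N; intros t0 Ht0.
  assert (Hi0 : 0 < / t0) by now apply Rinv_0_lt_compat.
  exists (M * (1 + / t0) ^ N); split.
  - apply Rmult_le_pos; [ exact HM | apply pow_le; lra ].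
  - intros x t Ht. apply Rle_trans with (1 := Hb x t ltac:(lra)).
    rewrite Rmult_assoc, <- Rpow_mult_distr. apply Rmult_le_compat_l; [ exact HM | ].
    assert (H1 := one_plus_sq x).
    assert (Hi : / t <= / t0) by (apply Rinv_le_contravar; lra).
    assert (Hi1 : 0 < / t) by (apply Rinv_0_lt_compat; lra).
    apply pow_incr; unfold weight; split; nra.
Qed.

Definition pairing (g : R -> R -> R) (phi : R -> R) (t : R) : R :=
  line_int (fun x => g x t * phi x).

Lemma decay_kernel_pairing (g : R -> R -> R) (phi : R -> R) (t0 : R) :
  kernel0 g -> schwartz phi -> 0 < t0 ->
  exists C, 0 <= C /\ forall t, t0 <= t -> decay C (fun x => g x t * phi x).
Proof.
  intros [Hc Hb] Hphi Ht0.
  destruct (poly_bound_slice g Hb) as [N HN]; destruct (HN t0 Ht0) as (A & HA & HgA).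
  destruct (schwartz_decay_ex phi (S N) Hphi) as (C & HC & HpC).
  exists (A * C); split; [ nra | ]. intros t Ht.
  apply (decay_pairing (fun x => g x t) phi A C N); auto.
  - intros x; apply Hc; lra.
  - intros x; now apply schwartz_continuous.
Qed.

Lemma kernel_time_derivative (n : nat) (e : R -> R -> R) :
  kernel n e -> kernel n (fun x t => e x t / t).
Proof. intros He; apply (kernel_mult n e (fun _ t => / t)); [ exact He | apply kernel_inv ]. Qed.

(** A smooth kernel has a t-derivative with polynomial growth in x, which the
    decay of phi absorbs uniformly for t in a compact subset of (0, oo). *)
Lemma is_derive_pairing (g e : R -> R -> R) (phi : R -> R) (t : R) :
  kernel 1 g -> kernel 1 e ->
  (forall x s, 0 < s -> is_derive (g x) s (e x s / s)) ->
  schwartz phi -> 0 < t ->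
  is_derive (pairing g phi) t (pairing (fun x t => e x t / t) phi t).
Proof.
  intros Hg He Hge Hphi Ht.
  set (e' := fun x t => e x t / t) in *.
  assert (He' : kernel 1 e') by now apply kernel_time_derivative.
  destruct (decay_kernel_pairing e' phi (t / 2) (kernel_kernel0 _ _ He') Hphi ltac:(lra)) as (C & HC & HD).
  destruct (decay_kernel_pairing g phi (t / 2) (kernel_kernel0 _ _ Hg) Hphi ltac:(lra)) as (B & HB & HDg).
  apply (is_derive_lim
    (fun n t => RInt (fun x => g x t * phi x) (- INR (S n)) (INR (S n)))
    (fun n t => RInt (fun x => e' x t * phi x) (- INR (S n)) (INR (S n)))
    (pairing g phi) (pairing e' phi) (fun n => 2 * C / INR (S n)) t (t / 2)); try lra.
  - intros u n Hu. assert (Hu' := near_half t u Ht Hu). assert (Hn := INR_S_ge1 n).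
    apply (is_derive_param (fun t x => g x t * phi x) (fun t x => e' x t * phi x) _ _ u (u / 2)); try lra.
    + intros v x Hv. assert (Hv' := near_half u v ltac:(lra) Hv).
      apply is_derive_eq with (e' x v * phi x + g x v * 0); [ | ring ].
      apply (is_derive_mult_R (g x) (fun _ => phi x)); [ apply Hge; lra | apply (is_derive_const (phi x)) ].
    + intros x _. apply continuity_2d_pt_mult.
      * intros eps. destruct (kernel_continuity_2d e' x u He' ltac:(lra) eps) as [d Hd].
        exists d; intros; now apply Hd.
      * apply continuity_2d_snd; now apply schwartz_continuous.
    + intros v Hv. assert (Hv' := near_half u v ltac:(lra) Hv).
      apply ex_RInt_cont; [ lra | ]. intros x _.
      apply (continuous_mult (fun x => g x v) phi); [ | now apply schwartz_continuous ].
      apply (proj1 (kernel_kernel0 _ _ Hg)); lra.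
  - intros u Hu. assert (Hu' := near_half t u Ht Hu).
    apply (line_int_seq B), HDg; lra.
  - intros u n Hu. assert (Hu' := near_half t u Ht Hu).
    apply (line_int_spec C); [ apply HD; lra | apply INR_S_ge1 ].
  - apply is_lim_seq_div_S.
Qed.

Lemma pairing_le (g : R -> R -> R) (phi : R -> R) (t0 : R) :
  kernel0 g -> schwartz phi -> 0 < t0 ->
  exists C, forall t, t0 <= t -> Rabs (pairing g phi t) <= C.
Proof.
  intros Hg Hphi Ht0; destruct (decay_kernel_pairing g phi t0 Hg Hphi Ht0) as (C & _ & HD).
  exists (4 * C); intros t Ht; now apply line_int_le, HD.
Qed.

(** Pairing with phi commutes with the transform.  The s-integral converges only
    conditionally, so the exchange is made for s in [1/(n+1), n+1]; the error of
    this truncation is polynomial in x times a null sequence, hence still a null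
    sequence once paired with phi. *)
Lemma pairing_fresnel (g : R -> R -> R) (theta t : R) (phi f1 : R -> R) (F : R) :
  smooth_kernel g -> schwartz phi -> 0 < t ->
  low_bound F (pairing g phi) -> high_bound F (pairing g phi) f1 ->
  pairing (fun x t => fresnel_int theta (g x) t) phi t = fresnel_int theta (pairing g phi) t.
Proof.
  intros Hg Hphi Ht HL HH.
  assert (Hg0 : kernel0 g) by apply (proj1 Hg 0%nat).
  destruct (smooth_kernel_bounds g Hg) as (e & M & N & HM & HB).
  set (I := fun n x => RInt (fun s => g x s * K theta s t) (/ INR (S n)) (INR (S n))).
  assert (HI : forall n, exists C, decay C (fun x => I n x * phi x) /\
     line_int (fun x => I n x * phi x)
     = RInt (fun s => pairing g phi s * K theta s t) (/ INR (S n)) (INR (S n))).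
  { intros n. assert (H1 := inv_INR_S n); assert (H2 := INR_S_ge1 n).
    set (a := / INR (S n)) in *; set (b := INR (S n)) in *.
    destruct (decay_kernel_pairing g phi a Hg0 Hphi ltac:(lra)) as (C & HC & HD).
    assert (Hi : forall x, ex_RInt (fun s => g x s * K theta s t) a b).
    { intros x; apply ex_RInt_K; try lra. intros s Hs.
      apply continuity_2d_slice_snd, smooth_kernel_continuity_2d; auto; lra. }
    destruct (line_int_fubini (fun x s => phi x * (g x s * K theta s t)) (C * / sqrt t) a b) as [HF1 HF2].
    - lra.
    - intros x s Hs. apply continuity_2d_pt_mult.
      + apply continuity_2d_fst; now apply schwartz_continuous.
      + apply continuity_2d_pt_mult; [ now apply smooth_kernel_continuity_2d | ].
        apply (continuity_2d_snd (fun s => K theta s t)); now apply K_continuous_s.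
    - intros x s Hs.
      replace (phi x * (g x s * K theta s t)) with (g x s * phi x * K theta s t) by ring.
      rewrite Rabs_mult.
      replace (C * / sqrt t / (1 + x ^ 2)) with (C / (1 + x ^ 2) * / sqrt t) by (unfold Rdiv; ring).
      apply Rmult_le_compat; try apply Rabs_pos; [ apply HD; lra | now apply K_bound ].
    - intros s Hs.
      apply (continuous_ext_loc (fun s => line_int (fun x => phi x * (g x s * K theta s t)))
        (fun s => pairing g phi s * K theta s t) s).
      + apply (locally_Rabs _ s s); [ lra | ]. intros u Hu.
        assert (Hu0 : 0 < u) by (apply Rabs_def2 in Hu; lra).
        destruct (decay_kernel_pairing g phi u Hg0 Hphi Hu0) as (B & _ & HDB).
        assert (HE := line_int_linear B B (K theta u t) 0 _ _ (HDB u (Rle_refl u)) (HDB u (Rle_refl u))).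
        rewrite Rmult_0_l, Rplus_0_r in HE. unfold pairing; rewrite Rmult_comm.
        refine (eq_trans (eq_sym HE) _). apply line_int_ext; intros x; ring.
      + apply (continuous_mult (pairing g phi) (fun s => K theta s t)); [ apply HL; lra | now apply K_continuous_s ].
    - exists ((b - a) * (C * / sqrt t)).
      assert (HEI : forall x, RInt (fun s => phi x * (g x s * K theta s t)) a b = I n x * phi x).
      { intros x. rewrite RInt_scal_R by apply Hi. unfold I; apply Rmult_comm. }
      split.
      + destruct HF1 as [Hc Hb]; split.
        * intros x; apply (continuous_ext _ _ x HEI), Hc.
        * intros x; rewrite <- HEI; apply Hb.
      + rewrite <- (line_int_ext _ _ HEI), HF2. apply RInt_ext.
        rewrite Rmin_left, Rmax_right by lra. intros s Hs.
        destruct (decay_kernel_pairing g phi s Hg0 Hphi ltac:(lra)) as (B & _ & HDB).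
        assert (HE := line_int_linear B B (K theta s t) 0 _ _ (HDB s (Rle_refl s)) (HDB s (Rle_refl s))).
        rewrite Rmult_0_l, Rplus_0_r in HE. unfold pairing; rewrite Rmult_comm, <- HE.
        apply line_int_ext; intros x; ring. }
  assert (L1 : is_lim_seq (fun n => line_int (fun x => I n x * phi x))
                 (fresnel_int theta (pairing g phi) t)).
  { rewrite (fresnel_int_eq F F theta t _ f1 HL HH Ht).
    destruct (low_plus_high_spec F F theta t _ f1 HL HH Ht) as [_ HR].
    apply (is_lim_seq_le_bound _ (fun n => 2 * F / sqrt t * sqrt (/ INR (S n)) + 4 * F * sqrt t / INR (S n))).
    - intros n. destruct (HI n) as (C & _ & ->). apply HR; [ apply inv_INR_S | apply INR_S_ge1 ].
    - replace (Finite 0) with (Finite (0 + 0)) by (f_equal; ring).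
      apply is_lim_seq_plus'; [ apply is_lim_seq_sqrt_inv_S | apply is_lim_seq_div_S ]. }
  destruct (schwartz_decay_ex phi (S N) Hphi) as (C & HC & HpC).
  assert (L2 : is_lim_seq (fun n => line_int (fun x => I n x * phi x))
                 (pairing (fun x t => fresnel_int theta (g x) t) phi t)).
  { set (rate := fun n => 2 / sqrt t * sqrt (/ INR (S n)) + 4 * sqrt t / INR (S n)).
    apply (is_lim_seq_le_bound _ (fun n => 4 * M * C * rate n)).
    - intros n. destruct (HI n) as (CI & HDI & _).
      assert (Hk : kernel0 (fun x t => fresnel_int theta (g x) t)).
      { destruct (smooth_kernel_step 1 theta g Hg) as [Hk _].
        apply (kernel_ext 0 (fun x t => 1 * fresnel_int theta (g x) t)); [ intros; ring | apply Hk ]. }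
      destruct (decay_kernel_pairing _ phi t Hk Hphi Ht) as (B & _ & HDB).
      specialize (HDB t (Rle_refl t)).
      assert (HE := line_int_linear CI B 1 (-1) _ _ HDI HDB).
      replace (_ - _) with (1 * line_int (fun x => I n x * phi x)
        + -1 * line_int (fun x => fresnel_int theta (g x) t * phi x)) by (unfold pairing; ring).
      rewrite <- HE. replace (4 * M * C * rate n) with (4 * ((M * rate n) * C)) by ring.
      assert (Hn1 := inv_INR_S n). assert (Hn2 := INR_S_ge1 n).
      assert (Hst : 0 < sqrt t) by now apply sqrt_lt_R0.
      assert (Hr : 0 <= rate n).
      { unfold rate. apply Rplus_le_le_0_compat.
        - apply Rmult_le_pos; [ left; apply Rdiv_lt_0_compat; lra | apply sqrt_pos ].
        - left; apply Rdiv_lt_0_compat; lra. }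
      apply line_int_le.
      set (d := fun x => I n x - fresnel_int theta (g x) t).
      assert (Hext : forall x, 1 * (I n x * phi x) + -1 * (fresnel_int theta (g x) t * phi x) = d x * phi x).
      { intros x; unfold d; ring. }
      assert (HDD := decay_linear CI B 1 (-1) _ _ HDI HDB).
      split; [ apply HDD | ].
      intros x; rewrite Hext, Rabs_mult.
      assert (H1 := one_plus_sq x).
      assert (Hw : 0 < (1 + x ^ 2) ^ N) by (apply pow_lt; lra).
      replace (M * rate n * C / (1 + x ^ 2)) with ((M * rate n * (1 + x ^ 2) ^ N) * (C / (1 + x ^ 2) ^ (S N)))
        by (simpl; field; simpl in *; lra).
      apply Rmult_le_compat; try apply Rabs_pos; [ | apply HpC ].
      unfold d, I. destruct (HB x) as [HLx HHx].
      rewrite (fresnel_int_eq _ _ theta t _ (e x) HLx HHx Ht).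
      destruct (low_plus_high_spec _ _ theta t _ (e x) HLx HHx Ht) as [_ HR].
      apply Rle_trans with (1 := HR _ _ Hn1 Hn2). right; unfold rate; field; lra.
    - replace (Finite 0) with (Rbar_mult (4 * M * C) (0 + 0)) by (simpl; f_equal; ring).
      apply is_lim_seq_scal_l.
      apply is_lim_seq_plus'; [ apply is_lim_seq_sqrt_inv_S | apply is_lim_seq_div_S ]. }
  assert (HU := is_lim_seq_unique _ _ L1). rewrite (is_lim_seq_unique _ _ L2) in HU.
  now injection HU.
Qed.

(** * The transform of a bounded curve *)

(** Bounded together with its Euler derivative on the whole half-line; f1 is
    the ordinary derivative. *)
Definition curve_bound (F : R) (f f1 : R -> R) : Prop :=
  (forall s, 0 < s -> is_derive f s (f1 s)) /\
  (forall s, 0 < s -> continuous f1 s) /\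
  (forall s, 0 < s -> Rabs (f s) <= F /\ Rabs (s * f1 s) <= F).

Lemma curve_bound_pos (F : R) (f f1 : R -> R) : curve_bound F f f1 -> 0 <= F.
Proof.
  intros (_ & _ & H); destruct (H 1 Rlt_0_1) as [H1 _].
  assert (H0 := Rabs_pos (f 1)); lra.
Qed.

Lemma curve_low_bound (F : R) (f f1 : R -> R) : curve_bound F f f1 -> low_bound F f.
Proof.
  intros Hf; assert (HF := curve_bound_pos _ _ _ Hf); destruct Hf as (H1 & _ & H3); split.
  - intros s Hs; now apply (continuous_of_derive _ _ _ (H1 s Hs)).
  - intros s Hs; apply Rle_trans with F; [ apply H3; lra | ].
    assert (1 <= / sqrt s).
    { rewrite <- Rinv_1; apply Rinv_le_contravar; [ apply sqrt_lt_R0; lra | ].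
      rewrite <- sqrt_1; apply sqrt_le_1_alt; lra. }
    unfold Rdiv; nra.
Qed.

Lemma curve_high_bound (F : R) (f f1 : R -> R) :
  curve_bound F f f1 -> high_bound F f (fun s => s * f1 s).
Proof.
  intros (H1 & H2 & H3); split; [ | split ].
  - intros s Hs; apply is_derive_eq with (f1 s); [ now apply H1 | field; lra ].
  - intros s Hs; apply (continuous_mult (fun s => s) f1); [ apply continuous_id | now apply H2 ].
  - intros s Hs; apply H3; lra.
Qed.

Lemma curve_spec (F theta t : R) (f f1 : R -> R) :
  curve_bound F f f1 -> 0 < t ->
  is_RInt_gen (fun s => f s * K theta s t) (at_right 0) (Rbar_locally p_infty) (fresnel_int theta f t) /\
  (forall a b, 0 < a <= 1 -> 1 <= b ->
    Rabs (RInt (fun s => f s * K theta s t) a b - fresnel_int theta f t)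
    <= 2 * F / sqrt t * sqrt a + 4 * F * sqrt t / b).
Proof.
  intros Hf Ht.
  assert (HL := curve_low_bound _ _ _ Hf). assert (HH := curve_high_bound _ _ _ Hf).
  rewrite (fresnel_int_eq F F theta t f _ HL HH Ht).
  now apply (low_plus_high_spec F F theta t f _ HL HH Ht).
Qed.

Lemma fresnel_int_seq (F theta t : R) (f f1 : R -> R) :
  curve_bound F f f1 -> 0 < t ->
  is_lim_seq (fun n => RInt (fun s => f s * K theta s t) (/ INR (S n)) (INR (S n)))
    (fresnel_int theta f t).
Proof.
  intros Hf Ht. destruct (curve_spec F theta t f f1 Hf Ht) as [_ H].
  apply (is_lim_seq_le_bound _ (fun n => 2 * F / sqrt t * sqrt (/ INR (S n)) + 4 * F * sqrt t / INR (S n))).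
  - intros n; apply H; [ apply inv_INR_S | apply INR_S_ge1 ].
  - replace (Finite 0) with (Finite (0 + 0)) by (f_equal; ring).
    apply is_lim_seq_plus'; [ apply is_lim_seq_sqrt_inv_S | apply is_lim_seq_div_S ].
Qed.

Lemma eventually_inv_lt (a : R) : 0 < a -> eventually (fun n => / INR (S n) < a).
Proof.
  intros Ha. destruct (proj2 (is_lim_seq_spec _ _) is_lim_seq_inv_S (mkposreal a Ha)) as [N HN].
  exists N; intros n Hn. specialize (HN n Hn); simpl in HN.
  rewrite Rminus_0_r in HN. apply Rle_lt_trans with (2 := HN), Rle_abs.
Qed.

Lemma eventually_gt (b : R) : eventually (fun n => b < INR (S n)).
Proof.
  destruct (INR_unbounded b) as [N HN]; exists N; intros n Hn.
  apply Rlt_le_trans with (1 := HN), le_INR; lia.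
Qed.

(** The cut c is free: c = sqrt t gives a bound uniform in t, and a large multiple
    of sqrt t gives the limit at t = 0. *)
Lemma fresnel_int_split (F d c theta t : R) (f f1 : R -> R) :
  curve_bound F f f1 -> 0 < t -> 0 < c -> (forall s, 0 < s <= c -> Rabs (f s) <= d) ->
  Rabs (fresnel_int theta f t) <= d * c / sqrt t + 4 * F * sqrt t / c.
Proof.
  intros Hf Ht Hc Hd.
  assert (HS := fresnel_int_seq F theta t f f1 Hf Ht).
  apply is_lim_seq_abs in HS.
  apply (is_lim_seq_le_loc _ (fun _ => d * c / sqrt t + 4 * F * sqrt t / c) _ _) with (2 := HS)
    (3 := is_lim_seq_const _).
  apply filter_imp with (2 := filter_and _ _ (eventually_inv_lt c Hc) (eventually_gt c)).
  intros n [H1 H2]. assert (H0 := inv_INR_S n).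
  assert (Hcf : forall s, 0 < s -> continuous f s).
  { intros s Hs; now apply (continuous_of_derive _ _ _ (proj1 Hf s Hs)). }
  assert (Hi : forall u v, 0 < u <= v -> ex_RInt (fun s => f s * K theta s t) u v).
  { intros u v Huv; apply ex_RInt_K; try lra. intros s Hs; apply Hcf; lra. }
  rewrite <- (RInt_chasles_R _ (/ INR (S n)) c (INR (S n))) by (apply Hi; lra).
  apply Rle_trans with (1 := Rabs_triang _ _).
  apply Rplus_le_compat.
  - apply RInt_K_le; try lra.
    + intros s Hs; apply Hcf; lra.
    + intros s Hs; apply Hd; lra.
  - apply (osc_tail f f1); try lra.
    + intros s Hs; apply Hf; lra.
    + intros s Hs; apply Hf; lra.
    + intros s Hs; apply Hf; lra.
Qed.

Lemma fresnel_int_le (F theta t : R) (f f1 : R -> R) :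
  curve_bound F f f1 -> 0 < t -> Rabs (fresnel_int theta f t) <= 5 * F.
Proof.
  intros Hf Ht. assert (Hst : 0 < sqrt t) by now apply sqrt_lt_R0.
  replace (5 * F) with (F * sqrt t / sqrt t + 4 * F * sqrt t / sqrt t) by (field; lra).
  apply (fresnel_int_split F F (sqrt t) theta t f f1); auto.
  intros s Hs; apply Hf; lra.
Qed.

Lemma is_lim_seq_at_right (f : R -> R) (l : R) :
  filterlim f (at_right 0) (locally l) -> is_lim_seq (fun n => f (/ INR (S n))) l.
Proof.
  intros H. apply filterlim_comp with (2 := H).
  intros P [eps HP]. destruct (eventually_inv_lt eps (cond_pos eps)) as [N HN].
  exists N; intros n Hn. apply HP; [ | apply inv_INR_S ].
  change (Rabs (/ INR (S n) - 0) < eps). rewrite Rminus_0_r, Rabs_pos_eq.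
  - now apply HN.
  - left; apply inv_INR_S.
Qed.

(** Formally, t d/dt P_theta f = (1/2) P_theta (s f'), and s K_theta is
    t d/ds K_{theta + pi/2}: a second integration by parts moves the derivative
    to f'', without boundary term because f' vanishes at 0 and at infinity.
    The argument is run on [1/(n+1), n+1] with the corrected truncation of
    [osc_corrected_dt]. *)
Lemma is_derive_fresnel_int (F G theta t : R) (f f1 f2 f3 : R -> R) :
  curve_bound F f f1 -> curve_bound G f2 f3 ->
  (forall s, 0 < s -> is_derive f1 s (f2 s)) ->
  filterlim f1 (at_right 0) (locally 0) -> 0 < t ->
  is_derive (fresnel_int theta f) t (- / 2 * fresnel_int (theta + PI / 2) f2 t).
Proof.
  intros Hf Hf2 Hf1 H0 Ht.
  assert (HF := curve_bound_pos _ _ _ Hf). assert (HG := curve_bound_pos _ _ _ Hf2).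
  assert (Hc2 : forall s, 0 < s -> continuous f2 s).
  { intros s Hs; now apply (continuous_of_derive _ _ _ (proj1 Hf2 s Hs)). }
  set (r := / sqrt (t / 2)).
  assert (Hr : 0 <= r) by (unfold r; left; apply Rinv_0_lt_compat, sqrt_lt_R0; lra).
  set (th' := theta + PI / 2).
  apply (is_derive_lim
    (fun n t => RInt (fun s => f s * K theta s t) (/ INR (S n)) (INR (S n))
        - t / INR (S n) * f (INR (S n)) * K th' (INR (S n)) t)
    (fun n t => / (2 * t) * (/ INR (S n) * f (/ INR (S n)) * K theta (/ INR (S n)) t
           + RInt (fun s => s * f1 s * K theta s t) (/ INR (S n)) (INR (S n)))
        - f (INR (S n)) * K th' (INR (S n)) t / (2 * INR (S n)))
    (fresnel_int theta f) (fun t => - / 2 * fresnel_int th' f2 t)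
    (fun n => (F * r / t + F * r + F * r + 4 * G * sqrt (2 * t)) / INR (S n)
              + r * Rabs (f1 (/ INR (S n))) + 2 * G * r * sqrt (/ INR (S n))) t (t / 2)); try lra.
  - intros u n Hu. apply near_half in Hu; auto.
    assert (H1 := inv_INR_S n); assert (H2 := INR_S_ge1 n).
    apply (osc_corrected_dt f f1 theta); try lra; intros s Hs; apply Hf; lra.
  - intros u Hu; apply near_half in Hu; auto.
    replace (Finite (fresnel_int theta f u)) with (Finite (fresnel_int theta f u - 0)) by (f_equal; ring).
    apply (is_lim_seq_minus' (fun n => RInt (fun s => f s * K theta s u) (/ INR (S n)) (INR (S n)))).
    + apply (fresnel_int_seq F theta u f f1 Hf); lra.
    + apply (is_lim_seq_le_bound _ (fun n => F * sqrt u / INR (S n))); [ | apply is_lim_seq_div_S ].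
      intros n. assert (Hn := INR_S_ge1 n). rewrite Rminus_0_r.
      replace (u / INR (S n) * f (INR (S n)) * K th' (INR (S n)) u)
        with (f (INR (S n)) * (u * K th' (INR (S n)) u) * / INR (S n)) by (field; lra).
      assert (Hp : 0 < / INR (S n)) by (apply Rinv_0_lt_compat; lra).
      rewrite Rabs_mult, (Rabs_pos_eq (/ _)) by lra.
      apply Rmult_le_compat_r; [ lra | ]. rewrite Rabs_mult.
      apply Rmult_le_compat; try apply Rabs_pos; [ apply Hf; lra | apply tK_bound; lra ].
  - intros u n Hu; apply near_half in Hu; auto.
    assert (H1 := inv_INR_S n); assert (H2 := INR_S_ge1 n).
    destruct (curve_spec G th' u f2 f3 Hf2 ltac:(lra)) as [_ HR]. specialize (HR _ _ H1 H2).
    assert (HKb : forall th s, Rabs (K th s u) <= r).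
    { intros th s; apply Rle_trans with (/ sqrt u); [ apply K_bound; lra | apply inv_sqrt_near; lra ]. }
    assert (Hru : / sqrt u <= r) by (apply inv_sqrt_near; lra).
    assert (Hsu : sqrt u <= sqrt (2 * t)) by (apply sqrt_le_1_alt; lra).
    assert (Hq := sqrt_pos (/ INR (S n))). set (q := sqrt (/ INR (S n))) in *.
    set (b := INR (S n)) in *; set (a := / b) in *.
    assert (HE : RInt (fun s => s * f1 s * K theta s u) a b
      = u * (f1 b * K th' b u - f1 a * K th' a u - RInt (fun s => f2 s * K th' s u) a b)).
    { assert (Hi1 : ex_RInt (fun s => s * f1 s * K theta s u) a b).
      { apply (ex_RInt_K (fun s => s * f1 s)); try lra. intros s Hs.
        apply (continuous_mult (fun s => s) f1); [ apply continuous_id | apply Hf; lra ]. }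
      assert (Hi2 : ex_RInt (fun s => f2 s * K th' s u) a b).
      { apply ex_RInt_K; try lra. intros s Hs; apply Hc2; lra. }
      destruct (RInt_ftc (fun s => f1 s * K th' s u)
         (fun s => f2 s * K th' s u + / u * (s * f1 s * K theta s u)) a b ltac:(lra)) as [_ HE].
      - intros s Hs. eapply is_derive_eq.
        + apply (is_derive_mult_R f1 (fun s => K th' s u)); [ apply Hf1; lra | apply K_ds_shift; lra ].
        + simpl; field; lra.
      - intros s Hs.
        apply (continuous_plus (fun s => f2 s * K th' s u) (fun s => / u * (s * f1 s * K theta s u))).
        + apply (continuous_mult f2 (fun s => K th' s u)); [ apply Hc2; lra | apply K_continuous_s; lra ].
        + apply (continuous_scal_r (/ u) (fun s => s * f1 s * K theta s u)).
          apply (continuous_mult (fun s => s * f1 s) (fun s => K theta s u)); [ | apply K_continuous_s; lra ].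
          apply (continuous_mult (fun s => s) f1); [ apply continuous_id | apply Hf; lra ].
      - rewrite RInt_plus_R, RInt_scal_R in HE; auto.
        + rewrite <- HE. symmetry; real_eq; field; lra.
        + apply (ex_RInt_scal (fun s => s * f1 s * K theta s u)); auto. }
    rewrite HE. set (I := RInt _ a b) in *.
    assert (Hfb : Rabs (f b) <= F) by (apply Hf; lra).
    assert (Hfa : Rabs (f a) <= F) by (apply Hf; lra).
    assert (Hf1b : Rabs (f1 b) <= F * a).
    { destruct Hf as (_ & _ & Hf). destruct (Hf b ltac:(lra)) as [_ H3].
      rewrite Rabs_mult, Rabs_pos_eq in H3 by lra.
      apply (Rmult_le_reg_l b); [ lra | ].
      replace (b * (F * a)) with F by (unfold a; field; lra). exact H3. }
    assert (B1 : Rabs (/ (2 * u) * (a * f a * K theta a u)) <= F * r / t * a).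
    { rewrite !Rabs_mult, (Rabs_pos_eq (/ _)), (Rabs_pos_eq a)
        by (try lra; left; apply Rinv_0_lt_compat; lra).
      replace (F * r / t * a) with (/ t * (a * F * r)) by (unfold Rdiv; ring).
      apply Rmult_le_compat.
      - left; apply Rinv_0_lt_compat; lra.
      - repeat apply Rmult_le_pos; try apply Rabs_pos; lra.
      - apply Rinv_le_contravar; lra.
      - apply Rmult_le_compat; try apply Rabs_pos; [ | | apply HKb ].
        + apply Rmult_le_pos; [ lra | apply Rabs_pos ].
        + apply Rmult_le_compat_l; lra. }
    assert (B2 : Rabs (f1 b * K th' b u) <= F * r * a).
    { rewrite Rabs_mult. replace (F * r * a) with (F * a * r) by ring.
      apply Rmult_le_compat; try apply Rabs_pos; auto. }
    assert (B3 : Rabs (f1 a * K th' a u) <= r * Rabs (f1 a)).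
    { rewrite Rabs_mult, Rmult_comm. apply Rmult_le_compat_r; [ apply Rabs_pos | apply HKb ]. }
    assert (B4 : Rabs (f b * K th' b u * a) <= F * r * a).
    { rewrite Rabs_mult, (Rabs_pos_eq a) by lra. apply Rmult_le_compat_r; [ lra | ].
      rewrite Rabs_mult. apply Rmult_le_compat; try apply Rabs_pos; auto. }
    assert (B5 : Rabs (I - fresnel_int th' f2 u) <= 2 * G * r * q + 4 * G * sqrt (2 * t) * a).
    { apply Rle_trans with (1 := HR). apply Rplus_le_compat.
      - apply Rmult_le_compat_r; [ exact Hq | ]. apply Rmult_le_compat_l; lra.
      - apply Rmult_le_compat_r; [ lra | ]. apply Rmult_le_compat_l; lra. }
    replace (_ - _) with (/ (2 * u) * (a * f a * K theta a u)
      + (/ 2 * (f1 b * K th' b u) + (- / 2 * (f1 a * K th' a u)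
      + (- / 2 * (I - fresnel_int th' f2 u) + - / 2 * (f b * K th' b u * a)))))
      by (unfold a; field; lra).
    replace ((F * r / t + F * r + F * r + 4 * G * sqrt (2 * t)) / b + r * Rabs (f1 a) + 2 * G * r * q)
      with (F * r / t * a + (F * r * a + (r * Rabs (f1 a)
        + ((2 * G * r * q + 4 * G * sqrt (2 * t) * a) + F * r * a)))) by (unfold a; field; lra).
    assert (Hh : forall y B, Rabs y <= B -> Rabs (/ 2 * y) <= B /\ Rabs (- / 2 * y) <= B).
    { intros y B Hy. rewrite !Rabs_mult, Rabs_Ropp, (Rabs_pos_eq (/ 2)) by lra.
      assert (H3 := Rabs_pos y). lra. }
    apply Rle_trans with (1 := Rabs_triang _ _); apply Rplus_le_compat; [ exact B1 | ].
    apply Rle_trans with (1 := Rabs_triang _ _); apply Rplus_le_compat; [ now apply Hh | ].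
    apply Rle_trans with (1 := Rabs_triang _ _); apply Rplus_le_compat; [ now apply Hh | ].
    apply Rle_trans with (1 := Rabs_triang _ _); apply Rplus_le_compat; now apply Hh.
  - replace (Finite 0) with (Finite (0 + r * Rabs 0 + 0)) by (f_equal; rewrite Rabs_R0; ring).
    apply is_lim_seq_plus'; [ | apply is_lim_seq_sqrt_inv_S ].
    apply is_lim_seq_plus'; [ apply is_lim_seq_div_S | ].
    apply (is_lim_seq_scal_l _ r (Finite (Rabs 0))).
    apply (is_lim_seq_abs _ (Finite 0)). now apply is_lim_seq_at_right.
Qed.

Lemma curve_bound_const (c : R) : curve_bound (Rabs c) (fun _ => c) (fun _ => 0).
Proof.
  split; [ | split ].
  - intros s _; apply (is_derive_const c).
  - intros s _; apply continuous_const.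
  - intros s _; rewrite Rmult_0_r, Rabs_R0; split; [ lra | apply Rabs_pos ].
Qed.

Lemma fresnel_int_0 (theta t : R) : 0 < t -> fresnel_int theta (fun _ => 0) t = 0.
Proof.
  intros Ht. assert (H := fresnel_int_le _ theta t _ _ (curve_bound_const 0) Ht).
  rewrite Rabs_R0 in H. assert (H1 := Rabs_pos (fresnel_int theta (fun _ => 0) t)).
  apply Rabs_eq_0; lra.
Qed.

(** Scaling invariance, read off from the vanishing derivative. *)
Lemma fresnel_int_1_constant (theta t u : R) :
  0 < t -> 0 < u -> fresnel_int theta (fun _ => 1) t = fresnel_int theta (fun _ => 1) u.
Proof.
  assert (HD : forall t, 0 < t -> is_derive (fresnel_int theta (fun _ => 1)) t zero).
  { intros v Hv. change zero with 0. eapply is_derive_eq.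
    - apply (is_derive_fresnel_int _ _ theta v _ _ _ _ (curve_bound_const 1) (curve_bound_const 0)); auto.
      + intros s _; apply (is_derive_const 0).
      + apply filterlim_const.
    - rewrite fresnel_int_0 by exact Hv; ring. }
  intros Ht Hu. destruct (Rtotal_order t u) as [H | [-> | H]]; [ | reflexivity | symmetry ];
    (apply eq_is_derive; [ intros v Hv; apply HD; lra | exact H ]).
Qed.

Lemma fresnel_int_linear (F G a b theta t : R) (f f1 g g1 : R -> R) :
  curve_bound F f f1 -> curve_bound G g g1 -> 0 < t ->
  fresnel_int theta (fun s => a * f s + b * g s) t
  = a * fresnel_int theta f t + b * fresnel_int theta g t.
Proof.
  intros Hf Hg Ht. apply is_RInt_gen_unique.
  apply (is_RInt_gen_ext (fun s => plus (scal a (f s * K theta s t)) (scal b (g s * K theta s t)))).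
  - apply (Filter_prod _ _ _ (fun _ => True) (fun _ => True)); try apply filter_true.
    intros x y _ _ s _. unfold plus, scal; simpl; unfold mult; simpl; ring.
  - apply (is_RInt_gen_plus (fun s => scal a (f s * K theta s t)) (fun s => scal b (g s * K theta s t))).
    + apply (is_RInt_gen_scal (fun s => f s * K theta s t)); now apply (curve_spec F theta t f f1).
    + apply (is_RInt_gen_scal (fun s => g s * K theta s t)); now apply (curve_spec G theta t g g1).
Qed.

Lemma curve_bound_linear (F G a b : R) (f f1 g g1 : R -> R) :
  curve_bound F f f1 -> curve_bound G g g1 ->
  curve_bound (Rabs a * F + Rabs b * G) (fun s => a * f s + b * g s) (fun s => a * f1 s + b * g1 s).
Proof.
  intros (Hf1 & Hf2 & Hf3) (Hg1 & Hg2 & Hg3); split; [ | split ].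
  - intros s Hs. apply (is_derive_plus (fun s => a * f s) (fun s => b * g s));
      [ apply (is_derive_scal f s a) | apply (is_derive_scal g s b) ]; auto.
  - intros s Hs. apply (continuous_plus (fun s => a * f1 s) (fun s => b * g1 s));
      [ apply (continuous_scal_r a f1) | apply (continuous_scal_r b g1) ]; auto.
  - intros s Hs. destruct (Hf3 s Hs) as [A1 A2]; destruct (Hg3 s Hs) as [B1 B2].
    assert (Pa := Rabs_pos a). assert (Pb := Rabs_pos b).
    split.
    + apply Rle_trans with (1 := Rabs_triang _ _). rewrite !Rabs_mult.
      apply Rplus_le_compat; now apply Rmult_le_compat_l.
    + replace (s * (a * f1 s + b * g1 s)) with (a * (s * f1 s) + b * (s * g1 s)) by ring.
      apply Rle_trans with (1 := Rabs_triang _ _). rewrite (Rabs_mult a), (Rabs_mult b).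
      apply Rplus_le_compat; now apply Rmult_le_compat_l.
Qed.

(** K theta . t concentrates at scale sqrt t: on [0, Y sqrt t] the function f is
    close to c, and beyond it oscillation leaves O(1/Y). *)
Lemma fresnel_int_at_0 (F c theta : R) (f f1 : R -> R) :
  curve_bound F f f1 -> filterlim f (at_right 0) (locally c) ->
  filterlim (fresnel_int theta f) (at_right 0) (locally (c * fresnel_int theta (fun _ => 1) 1)).
Proof.
  intros Hf Hc.
  set (f0 := fun s => 1 * f s + (- c) * 1).
  assert (Hf0 := curve_bound_linear _ _ 1 (- c) _ _ _ _ Hf (curve_bound_const 1)).
  fold f0 in Hf0. set (G := Rabs 1 * F + Rabs (- c) * Rabs 1) in Hf0.
  assert (HG := curve_bound_pos _ _ _ Hf0).
  apply (proj2 (filterlim_locally (fresnel_int theta f) (c * fresnel_int theta (fun _ => 1) 1))).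
  intros eps. assert (He := cond_pos eps).
  (* Beyond s = Y sqrt t the contribution is at most 4 G / Y < eps / 2. *)
  set (Y := 8 * (G + 1) / eps).
  assert (HY : 0 < Y) by (unfold Y; apply Rdiv_lt_0_compat; lra).
  set (d := eps / 2 / Y).
  assert (Hd : 0 < d) by (unfold d; repeat apply Rdiv_lt_0_compat; lra).
  destruct (proj1 (filterlim_locally f c) Hc (mkposreal d Hd)) as [del Hdel].
  assert (Hdel0 := cond_pos del).
  assert (Hm : 0 < (del / (2 * Y)) ^ 2) by (apply pow_lt, Rdiv_lt_0_compat; lra).
  exists (mkposreal _ Hm); intros t Htb Ht.
  change (Rabs (t - 0) < (del / (2 * Y)) ^ 2) in Htb.
  rewrite Rminus_0_r, Rabs_pos_eq in Htb by lra.
  assert (Hst : 0 < sqrt t) by now apply sqrt_lt_R0.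
  assert (Hs1 : sqrt t < del / (2 * Y)).
  { rewrite <- (sqrt_pow2 (del / (2 * Y))) by (left; apply Rdiv_lt_0_compat; lra).
    apply sqrt_lt_1_alt; lra. }
  assert (HYt : 0 < Y * sqrt t < del).
  { split; [ nra | ]. apply Rlt_trans with (Y * (del / (2 * Y))).
    - now apply Rmult_lt_compat_l.
    - replace (Y * (del / (2 * Y))) with (del / 2) by (field; lra). lra. }
  assert (HL := fresnel_int_linear _ _ 1 (- c) theta t _ _ _ _ Hf (curve_bound_const 1) Ht).
  change (Rabs (fresnel_int theta f t - c * fresnel_int theta (fun _ => 1) 1) < eps).
  rewrite (fresnel_int_1_constant theta 1 t Rlt_0_1 Ht).
  replace (fresnel_int theta f t - c * fresnel_int theta (fun _ => 1) t)
    with (fresnel_int theta f0 t) by (unfold f0; rewrite HL; ring).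
  apply Rle_lt_trans with (d * (Y * sqrt t) / sqrt t + 4 * G * sqrt t / (Y * sqrt t)).
  - apply (fresnel_int_split G d (Y * sqrt t) theta t f0 _ Hf0 Ht); [ lra | ].
    intros s Hs. unfold f0. replace (1 * f s + - c * 1) with (f s - c) by ring.
    left; apply (Hdel s); [ | lra ].
    change (Rabs (s - 0) < del). rewrite Rminus_0_r, Rabs_pos_eq; lra.
  - replace (d * (Y * sqrt t) / sqrt t) with (eps / 2) by (unfold d; field; lra).
    replace (4 * G * sqrt t / (Y * sqrt t)) with (eps / 2 * (G / (G + 1)))
      by (unfold Y; field; lra).
    assert (G / (G + 1) < 1).
    { apply (Rmult_lt_reg_r (G + 1)); [ lra | ]. unfold Rdiv; rewrite Rmult_assoc, Rinv_l; lra. }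
    nra.
Qed.

(** * The Fresnel integrals *)

Definition fresnel_C (x : R) : R := RInt (fun s => cos (s ^ 2)) 0 x.
Definition fresnel_S (x : R) : R := RInt (fun s => sin (s ^ 2)) 0 x.

Lemma ex_RInt_cos_sq (a b : R) : ex_RInt (fun s => cos (s ^ 2)) a b.
Proof. apply (ex_RInt_continuous (fun s => cos (s ^ 2))); intros z _; derive_continuous. Qed.

Lemma ex_RInt_sin_sq (a b : R) : ex_RInt (fun s => sin (s ^ 2)) a b.
Proof. apply (ex_RInt_continuous (fun s => sin (s ^ 2))); intros z _; derive_continuous. Qed.

Lemma RInt_rescale (f : R -> R) (x : R) :
  (forall s, continuous f s) -> RInt f 0 x = x * RInt (fun v => f (x * v)) 0 1.
Proof.
  intros Hf. rewrite <- RInt_scal_R.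
  - assert (H := RInt_comp_lin f x 0 0 1).
    rewrite Rmult_0_r, Rmult_1_r, !Rplus_0_r in H. rewrite <- H.
    + apply RInt_ext; intros v _. now rewrite Rplus_0_r.
    + apply (ex_RInt_continuous f); auto.
  - apply (ex_RInt_continuous (fun v => f (x * v))); intros v _.
    apply (continuous_comp (fun v => x * v) f); [ derive_continuous | apply Hf ].
Qed.

Lemma is_derive_RInt_upper (f : R -> R) (x : R) :
  (forall s, continuous f s) -> is_derive (fun x => RInt f 0 x) x (f x).
Proof.
  intros Hf. apply (is_derive_RInt f _ 0 x); [ | apply Hf ].
  apply filter_forall; intros b. apply (RInt_correct f), (ex_RInt_continuous f); auto.
Qed.

(** With I(x) the integral of exp(i s^2) over [0, x], this is the imaginary part of
    exp(-i alpha) times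
      i I(x)^2 = integral over [0, 1] of (exp(i x^2 (1+v^2)) - 1) / (1+v^2) dv.
    Both sides have derivative
    2 i x times the integral of exp(i x^2 (1 + v^2)), after s = x v. *)
Lemma fresnel_square (alpha x : R) :
  cos alpha * (fresnel_C x ^ 2 - fresnel_S x ^ 2) + sin alpha * (2 * fresnel_C x * fresnel_S x)
  = RInt (fun v => (sin (x ^ 2 * (1 + v ^ 2) - alpha) + sin alpha) * / (1 + v ^ 2)) 0 1.
Proof.
  set (D := fun x =>
    cos alpha * (fresnel_C x * fresnel_C x - fresnel_S x * fresnel_S x)
      + sin alpha * (2 * (fresnel_C x * fresnel_S x))
      - RInt (fun v => (sin (x ^ 2 * (1 + v ^ 2) - alpha) + sin alpha) * / (1 + v ^ 2)) 0 1).
  assert (Hw : forall v, 0 < 1 + v ^ 2) by (intros v; assert (H := one_plus_sq v); lra).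
  assert (HC : forall y, is_derive fresnel_C y (cos (y ^ 2))).
  { intros y; apply (is_derive_RInt_upper (fun s => cos (s ^ 2))); intros s; derive_continuous. }
  assert (HS : forall y, is_derive fresnel_S y (sin (y ^ 2))).
  { intros y; apply (is_derive_RInt_upper (fun s => sin (s ^ 2))); intros s; derive_continuous. }
  assert (HA : forall y, is_derive
    (fun x => RInt (fun v => (sin (x ^ 2 * (1 + v ^ 2) - alpha) + sin alpha) * / (1 + v ^ 2)) 0 1) y
    (RInt (fun v => 2 * y * cos (y ^ 2 * (1 + v ^ 2) - alpha)) 0 1)).
  { intros y.
    apply (is_derive_param
      (fun x v => (sin (x ^ 2 * (1 + v ^ 2) - alpha) + sin alpha) * / (1 + v ^ 2))
      (fun y v => 2 * y * cos (y ^ 2 * (1 + v ^ 2) - alpha)) 0 1 y 1); try lra.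
    - intros u v _. specialize (Hw v).
      auto_derive; [ exact I | ]. simpl in *; unfold Rminus; field; lra.
    - intros v _. apply continuity_2d_pt_mult.
      + apply (continuity_2d_fst (fun y => 2 * y)); derive_continuous.
      + apply (continuity_1d_2d_pt_comp cos); [ apply derivable_continuous_pt, derivable_pt_cos | ].
        apply continuity_2d_pt_minus; [ | apply continuity_2d_pt_const ].
        apply continuity_2d_pt_mult.
        * apply (continuity_2d_fst (fun y => y ^ 2)); derive_continuous.
        * apply (continuity_2d_snd (fun v => 1 + v ^ 2)); derive_continuous.
    - intros u _; apply ex_RInt_cont; [ lra | ]. intros v _. specialize (Hw v).
      derive_continuous; simpl in *; lra. }
  assert (HD : forall y, is_derive D y zero).
  { intros y. change zero with 0. unfold D. eapply is_derive_eq.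
    - apply (is_derive_minus
        (fun x => cos alpha * (fresnel_C x * fresnel_C x - fresnel_S x * fresnel_S x)
           + sin alpha * (2 * (fresnel_C x * fresnel_S x)))
        (fun x => RInt (fun v => (sin (x ^ 2 * (1 + v ^ 2) - alpha) + sin alpha) * / (1 + v ^ 2)) 0 1));
        [ | apply HA ].
      apply (is_derive_plus
        (fun x => cos alpha * (fresnel_C x * fresnel_C x - fresnel_S x * fresnel_S x))
        (fun x => sin alpha * (2 * (fresnel_C x * fresnel_S x)))).
      + apply (is_derive_scal (fun x => fresnel_C x * fresnel_C x - fresnel_S x * fresnel_S x)).
        apply (is_derive_minus (fun x => fresnel_C x * fresnel_C x) (fun x => fresnel_S x * fresnel_S x));
          apply is_derive_mult_R; auto.
      + apply (is_derive_scal (fun x => 2 * (fresnel_C x * fresnel_S x))).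
        apply (is_derive_scal (fun x => fresnel_C x * fresnel_S x)).
        apply is_derive_mult_R; auto.
    - change minus with (fun x y : R => x - y); change plus with (fun x y : R => x + y); simpl.
      assert (EC : fresnel_C y = y * RInt (fun v => cos ((y * v) ^ 2)) 0 1).
      { apply (RInt_rescale (fun s => cos (s ^ 2))); intros s; derive_continuous. }
      assert (ES : fresnel_S y = y * RInt (fun v => sin ((y * v) ^ 2)) 0 1).
      { apply (RInt_rescale (fun s => sin (s ^ 2))); intros s; derive_continuous. }
      assert (I1 : ex_RInt (fun v => cos ((y * v) ^ 2)) 0 1).
      { apply (ex_RInt_continuous (fun v => cos ((y * v) ^ 2))); intros z _; derive_continuous. }
      assert (I2 : ex_RInt (fun v => sin ((y * v) ^ 2)) 0 1).
      { apply (ex_RInt_continuous (fun v => sin ((y * v) ^ 2))); intros z _; derive_continuous. }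
      rewrite (RInt_ext (fun v => 2 * y * cos (y * (y * 1) * (1 + v * (v * 1)) - alpha))
        (fun v => (2 * y * cos (y ^ 2 - alpha)) * cos ((y * v) ^ 2)
                  + (- (2 * y * sin (y ^ 2 - alpha))) * sin ((y * v) ^ 2))).
      2: { intros v _.
           replace (y * (y * 1) * (1 + v * (v * 1)) - alpha) with ((y ^ 2 - alpha) + (y * v) ^ 2) by ring.
           rewrite cos_plus; real_eq; ring. }
      rewrite RInt_plus_R, !RInt_scal_R; auto.
      2: apply (ex_RInt_scal (fun v => cos ((y * v) ^ 2))); auto.
      2: apply (ex_RInt_scal (fun v => sin ((y * v) ^ 2))); auto.
      rewrite EC, ES. rewrite cos_minus, sin_minus.
      replace (y * (y * 1)) with (y ^ 2) by ring.
      set (a := RInt _ _ _). set (b := RInt _ _ _). ring. }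
  assert (H0 : D 0 = 0).
  { unfold D, fresnel_C, fresnel_S. rewrite !RInt_point.
    rewrite (RInt_ext _ (fun _ => 0)).
    - rewrite RInt_const. unfold zero, scal; simpl; unfold mult; simpl; ring.
    - intros v _. replace (0 ^ 2 * (1 + v ^ 2) - alpha) with (- alpha) by ring.
      rewrite sin_neg; real_eq; ring. }
  assert (HE : D x = 0).
  { rewrite <- H0. destruct (Rtotal_order x 0) as [H | [-> | H]]; [ | reflexivity | symmetry ];
      (apply eq_is_derive; [ intros; apply HD | exact H ]). }
  unfold D in HE. simpl in *. lra.
Qed.

Lemma RInt_inv_one_plus_sq : RInt (fun v => / (1 + v ^ 2)) 0 1 = PI / 4.
Proof.
  destruct (RInt_ftc atan (fun v => / (1 + v ^ 2)) 0 1) as [_ H].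
  - lra.
  - intros v _. apply (is_derive_eq _ _ _ _ (is_derive_atan v)).
    unfold Rsqr; simpl; f_equal; ring.
  - intros v _. assert (H := one_plus_sq v).
    derive_continuous; simpl in *; lra.
  - rewrite H, atan_1, atan_0; real_eq; ring.
Qed.

(** The oscillating integral is again one against K, at time 1/(2 x^2), so
    [osc_tail] bounds it; the phase x^2 is absorbed in theta. *)
Lemma fresnel_square_oscillation (alpha x : R) :
  1 <= x ->
  Rabs (RInt (fun v => sin (x ^ 2 * (1 + v ^ 2) - alpha) * / (1 + v ^ 2)) 0 1) <= 5 * sqrt PI / x.
Proof.
  intros Hx.
  set (t := / (2 * x ^ 2)).
  assert (Ht : 0 < t) by (unfold t; apply Rinv_0_lt_compat; nra).
  set (th := alpha - x ^ 2 + PI / 2).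
  assert (HP := PI_RGT_0). assert (HsP : 0 < sqrt PI) by now apply sqrt_lt_R0.
  assert (HK : forall v, sin (x ^ 2 * (1 + v ^ 2) - alpha) = sqrt PI / x * K th v t).
  { intros v. unfold K.
    replace (2 * PI * t) with (PI * (/ x) ^ 2) by (unfold t; field; lra).
    rewrite sqrt_mult_alt, sqrt_pow2 by (try lra; left; apply Rinv_0_lt_compat; lra).
    replace (v ^ 2 / (2 * t) - th) with (x ^ 2 * (1 + v ^ 2) - alpha - PI / 2)
      by (unfold t, th; field; lra).
    rewrite cos_minus_PI2. field; lra. }
  set (f := fun v : R => / (1 + v ^ 2)).
  set (f1 := fun v : R => - (2 * v) / (1 + v ^ 2) ^ 2).
  assert (Hf : forall v, is_derive f v (f1 v)).
  { intros v; assert (H := one_plus_sq v). unfold f, f1. auto_derive; [ simpl in *; lra | ].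
    simpl in *. field; lra. }
  assert (Hcf : forall v, continuous f v) by (intros v; now apply (continuous_of_derive _ _ _ (Hf v))).
  assert (Hcf1 : forall v, continuous f1 v).
  { intros v; assert (H := one_plus_sq v). unfold f1.
    derive_continuous. simpl in *; nra. }
  assert (Hb : forall v, Rabs (f v) <= 1 /\ Rabs (v * f1 v) <= 1).
  { intros v; assert (H := one_plus_sq v). unfold f, f1. split.
    - rewrite Rabs_pos_eq by (left; apply Rinv_0_lt_compat; lra).
      rewrite <- Rinv_1; apply Rinv_le_contravar; lra.
    - replace (v * (- (2 * v) / (1 + v ^ 2) ^ 2)) with (- (2 * v ^ 2 / (1 + v ^ 2) ^ 2)) by (field; lra).
      assert (Hp : 0 < (1 + v ^ 2) ^ 2) by (apply pow_lt; lra).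
      rewrite Rabs_Ropp, Rabs_pos_eq.
      + apply (Rmult_le_reg_r ((1 + v ^ 2) ^ 2)); [ exact Hp | ].
        unfold Rdiv; rewrite Rmult_assoc, Rinv_l by lra. nra.
      + apply Rmult_le_pos; [ nra | left; now apply Rinv_0_lt_compat ]. }
  assert (Hst : 0 < sqrt t) by now apply sqrt_lt_R0.
  assert (Hst1 : sqrt t <= 1).
  { rewrite <- sqrt_1; apply sqrt_le_1_alt. unfold t; rewrite <- Rinv_1; apply Rinv_le_contravar; nra. }
  assert (HI : Rabs (RInt (fun v => f v * K th v t) 0 1) <= 5).
  { assert (Hi : forall u v, u <= v -> ex_RInt (fun s => f s * K th s t) u v).
    { intros u v Huv; apply ex_RInt_K; auto. }
    rewrite <- (RInt_chasles_R _ 0 (sqrt t) 1) by (apply Hi; lra).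
    apply Rle_trans with (1 := Rabs_triang _ _).
    assert (A1 : Rabs (RInt (fun v => f v * K th v t) 0 (sqrt t)) <= 1 * sqrt t / sqrt t).
    { apply RInt_K_le; auto; try lra. intros s _; apply Hb. }
    assert (A2 : Rabs (RInt (fun v => f v * K th v t) (sqrt t) 1) <= 4 * 1 * sqrt t / sqrt t).
    { apply (osc_tail f f1); auto; lra. }
    replace (1 * sqrt t / sqrt t) with 1 in A1 by (field; lra).
    replace (4 * 1 * sqrt t / sqrt t) with 4 in A2 by (field; lra). lra. }
  rewrite (RInt_ext _ (fun v => sqrt PI / x * (f v * K th v t))).
  2: { intros v _; rewrite HK; unfold f; real_eq; ring. }
  rewrite RInt_scal_R by (apply ex_RInt_K; auto; lra).
  assert (Hc : 0 < sqrt PI / x) by (apply Rdiv_lt_0_compat; lra).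
  rewrite Rabs_mult, (Rabs_pos_eq (sqrt PI / x)) by lra.
  replace (5 * sqrt PI / x) with (sqrt PI / x * 5) by (field; lra).
  apply Rmult_le_compat_l; lra.
Qed.

Lemma fresnel_square_lim (alpha : R) :
  is_lim_seq (fun n => cos alpha * (fresnel_C (INR (S n)) ^ 2 - fresnel_S (INR (S n)) ^ 2)
      + sin alpha * (2 * fresnel_C (INR (S n)) * fresnel_S (INR (S n)))) (sin alpha * (PI / 4)).
Proof.
  apply (is_lim_seq_le_bound _ (fun n => 5 * sqrt PI / INR (S n))); [ | apply is_lim_seq_div_S ].
  intros n. assert (Hn := INR_S_ge1 n). rewrite fresnel_square.
  set (x := INR (S n)) in *.
  assert (Hw : forall v, 0 < 1 + v ^ 2) by (intros v; assert (H := one_plus_sq v); lra).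
  assert (I1 : ex_RInt (fun v => sin (x ^ 2 * (1 + v ^ 2) - alpha) * / (1 + v ^ 2)) 0 1).
  { apply ex_RInt_cont; [ lra | ]; intros v _; specialize (Hw v).
    derive_continuous; simpl in *; lra. }
  assert (I2 : ex_RInt (fun v => / (1 + v ^ 2)) 0 1).
  { apply ex_RInt_cont; [ lra | ]; intros v _; specialize (Hw v).
    derive_continuous; simpl in *; lra. }
  rewrite (RInt_ext _ (fun v => sin (x ^ 2 * (1 + v ^ 2) - alpha) * / (1 + v ^ 2)
     + sin alpha * / (1 + v ^ 2))) by (intros v _; real_eq; ring).
  rewrite RInt_plus_R, RInt_scal_R, RInt_inv_one_plus_sq; auto.
  2: apply (ex_RInt_scal (fun v => / (1 + v ^ 2))); auto.
  match goal with |- Rabs (?a + ?b - ?b) <= _ => replace (a + b - b) with a by (symmetry; real_eq; ring) end.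
  now apply fresnel_square_oscillation.
Qed.

Lemma K_half (theta s : R) :
  K theta s (/ 2) = / sqrt PI * (cos theta * cos (s ^ 2) + sin theta * sin (s ^ 2)).
Proof.
  unfold K. replace (2 * PI * / 2) with PI by field.
  replace (s ^ 2 / (2 * / 2)) with (s ^ 2) by field.
  rewrite cos_minus; ring.
Qed.

Lemma fresnel_constant_seq (theta : R) :
  is_lim_seq (fun n => / sqrt PI * (cos theta * fresnel_C (INR (S n)) + sin theta * fresnel_S (INR (S n))))
    (fresnel_int theta (fun _ => 1) 1).
Proof.
  rewrite (fresnel_int_1_constant theta 1 (/ 2)) by lra.
  set (I := fun a b => RInt (fun s => 1 * K theta s (/ 2)) a b).
  assert (HC : forall a b, ex_RInt (fun s => 1 * K theta s (/ 2)) a b).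
  { intros a b; apply (ex_RInt_continuous (fun s => 1 * K theta s (/ 2))); intros z _.
    apply (continuous_scal_r 1 (fun s => K theta s (/ 2))), K_continuous_s; lra. }
  assert (HE : forall b, / sqrt PI * (cos theta * fresnel_C b + sin theta * fresnel_S b) = I 0 b).
  { intros b. unfold I, fresnel_C, fresnel_S.
    rewrite (RInt_ext (fun s => 1 * K theta s (/ 2))
      (fun s => (/ sqrt PI * cos theta) * cos (s ^ 2) + (/ sqrt PI * sin theta) * sin (s ^ 2))).
    2: { intros s _; rewrite K_half; real_eq; ring. }
    rewrite RInt_plus_R, !RInt_scal_R; try apply ex_RInt_cos_sq; try apply ex_RInt_sin_sq.
    - ring.
    - apply (ex_RInt_scal (fun s => cos (s ^ 2))), ex_RInt_cos_sq.
    - apply (ex_RInt_scal (fun s => sin (s ^ 2))), ex_RInt_sin_sq. }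
  apply (is_lim_seq_ext (fun n => I 0 (/ INR (S n)) + I (/ INR (S n)) (INR (S n)))).
  { intros n; rewrite HE. now apply RInt_chasles_R. }
  replace (Finite (fresnel_int theta (fun _ => 1) (/ 2)))
    with (Finite (0 + fresnel_int theta (fun _ => 1) (/ 2))) by (f_equal; ring).
  apply is_lim_seq_plus'.
  - apply (is_lim_seq_le_bound _ (fun n => / sqrt (/ 2) / INR (S n))); [ | apply is_lim_seq_div_S ].
    intros n. assert (Hn := inv_INR_S n). rewrite Rminus_0_r.
    replace (/ sqrt (/ 2) / INR (S n)) with ((/ INR (S n) - 0) * / sqrt (/ 2)) by (unfold Rdiv; ring).
    apply abs_RInt_le_const; [ lra | apply HC | ].
    intros s _. rewrite Rmult_1_l. apply K_bound; lra.
  - apply (fresnel_int_seq _ theta (/ 2) _ _ (curve_bound_const 1)); lra.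
Qed.

Lemma one_minus_cos_le (u : R) : 0 <= u -> 0 <= 1 - cos u <= u.
Proof.
  intros Hu. assert (HB := COS_bound u). split; [ lra | ].
  destruct (RInt_ftc (fun v => v + cos v) (fun v => 1 + - sin v) 0 u Hu) as [Hi HE].
  - intros v _; auto_derive; [ exact I | ring ].
  - intros v _; derive_continuous.
  - rewrite cos_0 in HE.
    assert (H : RInt (fun _ => 0) 0 u <= RInt (fun v => 1 + - sin v) 0 u).
    { apply RInt_le; auto; [ apply ex_RInt_const | ]. intros v _; assert (Hs := SIN_bound v); lra. }
    rewrite RInt_const in H. unfold scal in H; simpl in H; unfold mult in H; simpl in H. lra.
Qed.

(** Needed only to fix a sign: sin (s^2) is the derivative of
    (1 - cos (s^2)) / (2 s) plus a nonnegative function. *)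
Lemma fresnel_S_lower_bound (a b : R) : 0 < a <= 1 -> 1 <= b -> - (2 * a) <= fresnel_S b.
Proof.
  intros Ha Hb. unfold fresnel_S.
  rewrite <- (RInt_chasles_R _ 0 a b) by apply ex_RInt_sin_sq.
  assert (H1 : Rabs (RInt (fun s => sin (s ^ 2)) 0 a) <= (a - 0) * 1).
  { apply abs_RInt_le_const; [ lra | apply ex_RInt_sin_sq | ].
    intros s _; apply Rabs_le, SIN_bound. }
  assert (H2 : - (a / 2) <= RInt (fun s => sin (s ^ 2)) a b).
  { destruct (RInt_ftc (fun s => (1 - cos (s ^ 2)) / (2 * s))
      (fun s => sin (s ^ 2) + - ((1 - cos (s ^ 2)) / (2 * s ^ 2))) a b ltac:(lra)) as [Hi HE].
    - intros s Hs; auto_derive; [ lra | simpl; field; lra ].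
    - intros s Hs; derive_continuous. simpl; nra.
    - apply Rle_trans with (RInt (fun s => sin (s ^ 2) + - ((1 - cos (s ^ 2)) / (2 * s ^ 2))) a b).
      + rewrite HE.
        assert (Hcb := proj1 (one_minus_cos_le (b ^ 2) (pow2_ge_0 b))).
        assert (Hca := proj2 (one_minus_cos_le (a ^ 2) (pow2_ge_0 a))).
        assert (A1 : 0 <= (1 - cos (b ^ 2)) / (2 * b)).
        { apply Rmult_le_pos; [ exact Hcb | left; apply Rinv_0_lt_compat; lra ]. }
        assert (A2 : (1 - cos (a ^ 2)) / (2 * a) <= a / 2).
        { replace (a / 2) with (a ^ 2 / (2 * a)) by (field; lra).
          apply Rmult_le_compat_r; [ left; apply Rinv_0_lt_compat; lra | exact Hca ]. }
        lra.
      + apply RInt_le; [ lra | exact Hi | apply ex_RInt_sin_sq | ].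
        intros s Hs.
        assert (0 <= (1 - cos (s ^ 2)) / (2 * s ^ 2)).
        { apply Rmult_le_pos; [ apply one_minus_cos_le, pow2_ge_0 | left; apply Rinv_0_lt_compat; nra ]. }
        lra. }
  apply Rabs_le_between in H1. lra.
Qed.

(** The limits C and S satisfy C^2 = S^2 and 2 C S = pi/4 by [fresnel_square_lim],
    which determines them up to a common sign; S >= 0 decides. *)
Lemma fresnel_limits :
  is_lim_seq (fun n => fresnel_C (INR (S n))) (sqrt (PI / 8)) /\
  is_lim_seq (fun n => fresnel_S (INR (S n))) (sqrt (PI / 8)).
Proof.
  assert (HP := PI_RGT_0). assert (HsP : 0 < sqrt PI) by now apply sqrt_lt_R0.
  set (c := sqrt PI * fresnel_int 0 (fun _ => 1) 1).
  set (s := sqrt PI * fresnel_int (PI / 2) (fun _ => 1) 1).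
  assert (HC : is_lim_seq (fun n => fresnel_C (INR (S n))) c).
  { assert (H := is_lim_seq_scal_l _ (sqrt PI) _ (fresnel_constant_seq 0)).
    apply (is_lim_seq_ext _ (fun n => fresnel_C (INR (S n)))) in H; [ exact H | ].
    intros n; rewrite cos_0, sin_0; field; lra. }
  assert (HS : is_lim_seq (fun n => fresnel_S (INR (S n))) s).
  { assert (H := is_lim_seq_scal_l _ (sqrt PI) _ (fresnel_constant_seq (PI / 2))).
    apply (is_lim_seq_ext _ (fun n => fresnel_S (INR (S n)))) in H; [ exact H | ].
    intros n; rewrite cos_PI2, sin_PI2; field; lra. }
  assert (HU : forall u l1 l2, is_lim_seq u (Finite l1) -> is_lim_seq u (Finite l2) -> l1 = l2).
  { intros u l1 l2 H1 H2. apply is_lim_seq_unique in H1, H2. rewrite H1 in H2. now injection H2. }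
  assert (HCC := is_lim_seq_mult' _ _ _ _ HC HC).
  assert (HSS := is_lim_seq_mult' _ _ _ _ HS HS).
  assert (HCS := is_lim_seq_mult' _ _ _ _ HC HS).
  assert (E1 : c * c - s * s = 0).
  { apply (HU _ _ _ (is_lim_seq_minus' _ _ _ _ HCC HSS)).
    assert (H := fresnel_square_lim 0). rewrite cos_0, sin_0, Rmult_0_l in H.
    eapply is_lim_seq_ext; [ | exact H ]; intros n; cbv beta; ring. }
  assert (E2 : 2 * (c * s) = PI / 4).
  { apply (HU (fun n => 2 * (fresnel_C (INR (S n)) * fresnel_S (INR (S n))))).
    - apply (is_lim_seq_scal_l _ 2 (Finite (c * s)) HCS).
    - assert (H := fresnel_square_lim (PI / 2)). rewrite cos_PI2, sin_PI2, Rmult_1_l in H.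
      eapply is_lim_seq_ext; [ | exact H ]; intros n; cbv beta; ring. }
  assert (E3 : 0 <= s).
  { apply (is_lim_seq_le_loc (fun n => -2 / INR (S n)) (fun n => fresnel_S (INR (S n))) 0 s).
    - apply filter_forall; intros n.
      assert (H := fresnel_S_lower_bound _ _ (inv_INR_S n) (INR_S_ge1 n)). unfold Rdiv; lra.
    - apply is_lim_seq_div_S.
    - exact HS. }
  assert (Ecs : c = s) by nra.
  assert (Es : s = sqrt (PI / 8)).
  { rewrite <- (sqrt_square s E3). f_equal. rewrite Ecs in E2. lra. }
  rewrite Ecs, Es in *. split; assumption.
Qed.

Lemma fresnel_constant (theta : R) :
  fresnel_int theta (fun _ => 1) 1 = / sqrt 8 * (cos theta + sin theta).
Proof.
  assert (HP := PI_RGT_0). assert (HsP : 0 < sqrt PI) by now apply sqrt_lt_R0.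
  destruct fresnel_limits as [HC HS].
  assert (H := is_lim_seq_scal_l _ (/ sqrt PI) _
    (is_lim_seq_plus' _ _ _ _ (is_lim_seq_scal_l _ (cos theta) _ HC) (is_lim_seq_scal_l _ (sin theta) _ HS))).
  apply is_lim_seq_unique in H. rewrite (is_lim_seq_unique _ _ (fresnel_constant_seq theta)) in H.
  injection H as ->.
  unfold Rdiv; rewrite sqrt_mult_alt, sqrt_inv by lra.
  assert (0 < sqrt 8) by (apply sqrt_lt_R0; lra). field; lra.
Qed.

Lemma fresnel_constant_PI4 : fresnel_int (PI / 4) (fun _ => 1) 1 = / 2.
Proof.
  rewrite fresnel_constant, cos_PI4, sin_PI4.
  replace 8 with (2 ^ 2 * 2) by ring. rewrite sqrt_mult_alt, sqrt_pow2 by lra.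
  assert (H := sqrt_sqrt 2 ltac:(lra)). assert (0 < sqrt 2) by (apply sqrt_lt_R0; lra).
  replace (/ (2 * sqrt 2) * (1 / sqrt 2 + 1 / sqrt 2)) with (/ (sqrt 2 * sqrt 2)) by (field; lra).
  now rewrite H.
Qed.

Lemma fresnel_constant_3PI4 : fresnel_int (PI / 4 + PI / 2) (fun _ => 1) 1 = 0.
Proof.
  rewrite fresnel_constant, cos_plus, sin_plus, cos_PI2, sin_PI2, cos_PI4, sin_PI4. ring.
Qed.

(** * Propagation of the wave equation *)

(** B phi is a curve issued from phi(0) with zero initial velocity, B1 phi is its
    velocity, and the acceleration of B phi is e times B applied to the d-th
    derivative of phi. *)
Definition wave (e : R) (d : nat) (B B1 : (R -> R) -> R -> R) : Prop :=
  forall phi, schwartz phi ->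
    (exists F, curve_bound F (B phi) (B1 phi)) /\
    (forall s, 0 < s -> is_derive (B1 phi) s (e * B (Derive_n phi d) s)) /\
    filterlim (B phi) (at_right 0) (locally (phi 0)) /\
    filterlim (B1 phi) (at_right 0) (locally 0).

Lemma curve_bound_scal (F c : R) (f f1 : R -> R) :
  curve_bound F f f1 -> curve_bound (Rabs c * F) (fun s => c * f s) (fun s => c * f1 s).
Proof.
  intros (H1 & H2 & H3); split; [ | split ].
  - intros s Hs; apply (is_derive_scal f s c); auto.
  - intros s Hs; apply (continuous_scal_r c f1); auto.
  - intros s Hs; destruct (H3 s Hs) as [A1 A2].
    replace (s * (c * f1 s)) with (c * (s * f1 s)) by ring.
    rewrite (Rabs_mult c), (Rabs_mult c).
    split; apply Rmult_le_compat_l; auto; apply Rabs_pos.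
Qed.

Lemma filterlim_scal_R (f : R -> R) (P : (R -> Prop) -> Prop) (c l : R) :
  Filter P -> filterlim f P (locally l) -> filterlim (fun s => c * f s) P (locally (c * l)).
Proof.
  intros HP H.
  apply (filterlim_comp _ _ _ f (fun y => c * y) P (locally l)); [ exact H | ].
  apply (@ex_derive_continuous R_AbsRing R_NormedModule (fun y => c * y) l); auto_derive; auto.
Qed.

Lemma fresnel_int_scal (F c theta t : R) (f f1 : R -> R) :
  curve_bound F f f1 -> 0 < t ->
  fresnel_int theta (fun s => c * f s) t = c * fresnel_int theta f t.
Proof.
  intros Hf Ht.
  assert (H := fresnel_int_linear F F c 0 theta t f f1 f f1 Hf Hf Ht).
  rewrite Rmult_0_l, Rplus_0_r in H. rewrite <- H.
  f_equal; apply functional_extensionality; intros s; ring.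
Qed.

Lemma fresnel_int_PI (F theta t : R) (f f1 : R -> R) :
  curve_bound F f f1 -> 0 < t ->
  fresnel_int (theta + PI / 2 + PI / 2) f t = - fresnel_int theta f t.
Proof.
  intros Hf Ht.
  replace (- fresnel_int theta f t) with (-1 * fresnel_int theta f t) by ring.
  rewrite <- (fresnel_int_scal F (-1) theta t f f1 Hf Ht).
  unfold fresnel_int; f_equal; apply functional_extensionality; intros s.
  rewrite K_PI; ring.
Qed.

(** f'' and f'''' are again curves of the family B, attached to derivatives of
    phi; this closes the computation of two time derivatives. *)
Lemma wave_step (e : R) (d : nat) (B B1 : (R -> R) -> R -> R) :
  wave e d B B1 ->
  let H := fun phi t => 2 * fresnel_int (PI / 4) (B phi) t in
  let H1 := fun phi t => - fresnel_int (PI / 4 + PI / 2) (fun s => e * B (Derive_n phi d) s) t in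
  forall phi, schwartz phi ->
    (forall t, 0 < t -> is_derive (H phi) t (H1 phi t)) /\
    (forall t, 0 < t -> is_derive (H1 phi) t (- (e ^ 2 / 4) * H (Derive_n phi (d + d)) t)) /\
    filterlim (H phi) (at_right 0) (locally (phi 0)) /\
    filterlim (H1 phi) (at_right 0) (locally 0) /\
    exists F, forall t, 0 < t -> Rabs (H phi t) <= F /\ Rabs (H1 phi t) <= F.
Proof.
  intros HW H H1 phi Hphi.
  assert (Hphi2 := schwartz_Derive_n phi d Hphi).
  assert (Hphi4 := schwartz_Derive_n _ d Hphi2).
  destruct (HW _ Hphi) as ([F0 C0] & D0 & L0 & M0).
  destruct (HW _ Hphi2) as ([F2 C2] & D2 & L2 & M2).
  destruct (HW _ Hphi4) as ([F4 C4] & D4 & L4 & M4).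
  rewrite Derive_n_Derive_n in C4, D4, L4, M4.
  rewrite Derive_n_Derive_n in D2.
  assert (C2' := curve_bound_scal _ e _ _ C2).
  assert (C4' := curve_bound_scal _ e _ _ (curve_bound_scal _ e _ _ C4)).
  split; [ | split; [ | split; [ | split ] ] ].
  - intros t Ht. unfold H, H1.
    apply is_derive_eq with (2 * (- / 2 * fresnel_int (PI / 4 + PI / 2) (fun s => e * B (Derive_n phi d) s) t));
      [ | field ].
    apply (is_derive_scal (fresnel_int (PI / 4) (B phi)) t 2).
    now apply (is_derive_fresnel_int _ _ _ t _ _ _ _ C0 C2').
  - intros t Ht. unfold H, H1.
    apply is_derive_eq with (- (- / 2 * fresnel_int (PI / 4 + PI / 2 + PI / 2)
       (fun s => e * (e * B (Derive_n phi (d + d)) s)) t)).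
    + apply (is_derive_opp (fresnel_int (PI / 4 + PI / 2) (fun s => e * B (Derive_n phi d) s))).
      apply (is_derive_fresnel_int _ _ _ t _ _ _ _ C2' C4'); [ | | exact Ht ].
      * intros s Hs; apply (is_derive_scal (B1 (Derive_n phi d)) s e); auto.
      * assert (M2' := filterlim_scal_R _ _ e 0 _ M2). now rewrite Rmult_0_r in M2'.
    + rewrite (fresnel_int_PI _ _ _ _ _ C4' Ht).
      rewrite (fresnel_int_scal _ e _ _ _ _ (curve_bound_scal _ e _ _ C4) Ht).
      rewrite (fresnel_int_scal _ e _ _ _ _ C4 Ht). field.
  - replace (phi 0) with (2 * (phi 0 * / 2)) by field.
    apply filterlim_scal_R; [ apply _ | ].
    rewrite <- fresnel_constant_PI4. now apply (fresnel_int_at_0 _ _ _ _ _ C0).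
  - assert (L := filterlim_scal_R _ _ (-1) _ _
      (fresnel_int_at_0 _ _ (PI / 4 + PI / 2) _ _ C2' (filterlim_scal_R _ _ e _ _ L2))).
    rewrite fresnel_constant_3PI4, !Rmult_0_r in L.
    apply (filterlim_ext (fun t => -1 * fresnel_int (PI / 4 + PI / 2) (fun s => e * B (Derive_n phi d) s) t));
      [ intros t; unfold H1; ring | exact L ].
  - exists (2 * (5 * F0) + 5 * (Rabs e * F2)); intros t Ht.
    assert (A1 := fresnel_int_le _ (PI / 4) t _ _ C0 Ht).
    assert (A2 := fresnel_int_le _ (PI / 4 + PI / 2) t _ _ C2' Ht).
    assert (P1 := curve_bound_pos _ _ _ C0). assert (P2 := curve_bound_pos _ _ _ C2').
    unfold H, H1. rewrite Rabs_mult, Rabs_Ropp, (Rabs_pos_eq 2) by lra. split; lra.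
Qed.

Lemma at_right_ext (f g : R -> R) (l : R) :
  (forall t, 0 < t -> f t = g t) ->
  filterlim f (at_right 0) (locally l) -> filterlim g (at_right 0) (locally l).
Proof.
  intros H. apply filterlim_ext_loc.
  exists (mkposreal 1 Rlt_0_1); intros t _ Ht; now apply H.
Qed.

Lemma is_derive_ext_pos (f g : R -> R) (t l : R) :
  (forall t, 0 < t -> f t = g t) -> 0 < t -> is_derive f t l -> is_derive g t l.
Proof.
  intros H Ht. apply is_derive_ext_loc.
  apply (locally_Rabs _ t t Ht); intros u Hu; apply H; apply Rabs_def2 in Hu; lra.
Qed.

(** The bound on t times the velocity for large t is the one point that
    [wave_step] does not give; it is read off from the Euler derivative h of the
    kernel instead. *)
Lemma wave_kernel (e : R) (d : nat) (B B1 : (R -> R) -> R -> R) (g h : R -> R -> R) :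
  wave e d B B1 -> kernel 1 g -> kernel 1 h ->
  (forall x s, 0 < s -> is_derive (g x) s (h x s / s)) ->
  (forall phi t, schwartz phi -> 0 < t -> pairing g phi t = 2 * fresnel_int (PI / 4) (B phi) t) ->
  wave (- (e ^ 2 / 4)) (d + d) (pairing g) (pairing (fun x t => h x t / t)).
Proof.
  intros HW Hg Hh Hgh HE phi Hphi.
  destruct (wave_step e d B B1 HW phi Hphi) as (D0 & D1 & L0 & L1 & F & HF).
  set (H := fun t => 2 * fresnel_int (PI / 4) (B phi) t) in *.
  set (H1 := fun t => - fresnel_int (PI / 4 + PI / 2) (fun s => e * B (Derive_n phi d) s) t) in *.
  assert (HP0 : forall t, 0 < t -> H t = pairing g phi t) by (intros t Ht; symmetry; now apply HE).
  assert (Hd := fun t Ht => is_derive_pairing g h phi t Hg Hh Hgh Hphi Ht).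
  assert (HP1 : forall t, 0 < t -> H1 t = pairing (fun x t => h x t / t) phi t).
  { intros t Ht. rewrite <- (is_derive_unique _ _ _ (Hd t Ht)).
    symmetry; apply is_derive_unique, (is_derive_ext_pos H); auto. }
  assert (HD1 : forall t, 0 < t -> is_derive (pairing (fun x t => h x t / t) phi) t
     (- (e ^ 2 / 4) * pairing g (Derive_n phi (d + d)) t)).
  { intros t Ht. rewrite HE by (auto; now apply schwartz_Derive_n).
    apply (is_derive_ext_pos H1); auto. }
  split; [ | split; [ exact HD1 | split ] ].
  - destruct (pairing_le h phi 1 (kernel_kernel0 _ _ Hh) Hphi Rlt_0_1) as [C HC].
    exists (Rabs F + Rabs C). split; [ exact Hd | split ].
    + intros t Ht; now apply (continuous_of_derive _ _ _ (HD1 t Ht)).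
    + intros t Ht. destruct (HF t Ht) as [A0 A1].
      assert (PF := Rle_abs F). assert (PC := Rle_abs C).
      assert (QF := Rabs_pos F). assert (QC := Rabs_pos C).
      change (Rabs (H t) <= F) in A0. change (Rabs (H1 t) <= F) in A1.
      split; [ rewrite <- HP0 by exact Ht; lra | ].
      destruct (Rle_dec t 1) as [Ht1 | Ht1].
      * rewrite <- HP1, Rabs_mult, Rabs_pos_eq by lra.
        assert (P := Rabs_pos (H1 t)). nra.
      * replace (t * pairing (fun x t => h x t / t) phi t) with (pairing h phi t).
        { specialize (HC t ltac:(lra)). lra. }
        assert (Hk := kernel_time_derivative 1 h Hh).
        destruct (decay_kernel_pairing _ phi t (kernel_kernel0 _ _ Hk) Hphi Ht) as (A & _ & HD).
        assert (HL := line_int_linear A A t 0 _ _ (HD t (Rle_refl t)) (HD t (Rle_refl t))).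
        rewrite Rmult_0_l, Rplus_0_r in HL. unfold pairing. rewrite <- HL.
        apply line_int_ext; intros x; field; lra.
  - now apply (at_right_ext H).
  - now apply (at_right_ext H1).
Qed.

Lemma continuous_at_right (f : R -> R) (x : R) :
  continuous f x -> filterlim f (at_right x) (locally (f x)).
Proof. intros H P HP; apply filter_le_within; now apply H. Qed.

Definition even_part (phi : R -> R) (s : R) : R := / 2 * (phi s + phi (- s)).
Definition even_part_derivative (phi : R -> R) (s : R) : R :=
  / 2 * (Derive_n phi 1 s - Derive_n phi 1 (- s)).

Lemma is_derive_schwartz (phi : R -> R) (s : R) :
  schwartz phi -> is_derive phi s (Derive_n phi 1 s).
Proof. intros [H _]; apply Derive_correct, (H 1%nat s). Qed.

Lemma is_derive_opp_arg (f : R -> R) (s l : R) :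
  is_derive f (- s) l -> is_derive (fun s => f (- s)) s (- l).
Proof.
  intros H. apply is_derive_eq with (-1 * l); [ | ring ].
  apply (is_derive_comp f Ropp s l (-1) H). auto_derive; [ exact I | ring ].
Qed.

(** The start of the recursion. *)
Lemma wave_even_part : wave 1 2 even_part even_part_derivative.
Proof.
  intros phi Hphi.
  assert (Hphi1 := schwartz_Derive_n phi 1 Hphi).
  assert (HD : forall s, is_derive (even_part phi) s (even_part_derivative phi s)).
  { intros s. apply (is_derive_scal (fun s => phi s + phi (- s)) s (/ 2)).
    apply (is_derive_plus phi (fun s => phi (- s))); [ now apply is_derive_schwartz | ].
    apply is_derive_opp_arg; now apply is_derive_schwartz. }
  assert (HD1 : forall s, is_derive (even_part_derivative phi) s (1 * even_part (Derive_n phi 2) s)).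
  { intros s. rewrite Rmult_1_l.
    apply (is_derive_scal (fun s => Derive_n phi 1 s - Derive_n phi 1 (- s)) s (/ 2)).
    apply is_derive_eq with (Derive_n phi 2 s - - Derive_n phi 2 (- s)); [ | ring ].
    apply (is_derive_minus (Derive_n phi 1) (fun s => Derive_n phi 1 (- s)));
      [ | apply is_derive_opp_arg ];
      (apply (is_derive_eq _ _ _ _ (is_derive_schwartz _ _ Hphi1)); now rewrite Derive_n_Derive_n). }
  split; [ | split; [ | split ] ].
  - destruct (schwartz_seminorms phi 1 Hphi) as [M HM].
    exists M; split; [ | split ].
    + intros s _; apply HD.
    + intros s _; now apply (continuous_of_derive _ _ _ (HD1 s)).
    + intros s _. unfold even_part, even_part_derivative.
      assert (A1 := HM 0%nat 0%nat s ltac:(lia) ltac:(lia)).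
      assert (A2 := HM 0%nat 0%nat (- s) ltac:(lia) ltac:(lia)).
      assert (A3 := HM 1%nat 1%nat s ltac:(lia) ltac:(lia)).
      assert (A4 := HM 1%nat 1%nat (- s) ltac:(lia) ltac:(lia)).
      change (Derive_n phi 0) with phi in A1, A2.
      rewrite pow_O, Rmult_1_l in A1, A2. rewrite pow_1 in A3, A4.
      apply Rabs_le_between in A1, A2, A3, A4.
      split; apply Rabs_le_between; lra.
  - intros s _; apply HD1.
  - replace (phi 0) with (even_part phi 0) by (unfold even_part; rewrite Ropp_0; field).
    apply continuous_at_right, (continuous_of_derive _ _ _ (HD 0)).
  - assert (H0 : even_part_derivative phi 0 = 0) by (unfold even_part_derivative; rewrite Ropp_0; ring).
    rewrite <- H0 at 2. apply continuous_at_right, (continuous_of_derive _ _ _ (HD1 0)).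
Qed.

(** K is even in x, so the half-line transform of the even part sees all of phi. *)
Lemma pairing_fresnel_density (phi : R -> R) (t : R) :
  schwartz phi -> 0 < t ->
  pairing (fun x t => K (PI / 4) x t) phi t = 2 * fresnel_int (PI / 4) (even_part phi) t.
Proof.
  intros Hphi Ht.
  destruct (wave_even_part phi Hphi) as ([F HC] & _).
  assert (HS := fresnel_int_seq F (PI / 4) t _ _ HC Ht).
  set (k := fun x => K (PI / 4) x t * phi x).
  destruct (decay_kernel_pairing (fun x t => K (PI / 4) x t) phi t
     (proj1 (smooth_kernel_K (PI / 4)) 0%nat) Hphi Ht) as (C & _ & HD).
  specialize (HD t (Rle_refl t)). fold k in HD.
  assert (HL := line_int_seq C k HD).
  set (E := fun s => even_part phi s * K (PI / 4) s t).
  assert (HcE : forall s, continuous E s).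
  { intros s. apply (continuous_mult (even_part phi) (fun s => K (PI / 4) s t)); [ | now apply K_continuous_s ].
    apply (continuous_scal_r (/ 2) (fun s => phi s + phi (- s))).
    apply (continuous_plus phi (fun s => phi (- s))); [ now apply schwartz_continuous | ].
    apply (continuous_comp Ropp phi); [ derive_continuous | now apply schwartz_continuous ]. }
  assert (HiE : forall a b, ex_RInt E a b) by (intros; apply (ex_RInt_continuous E); auto).
  assert (Hik : forall a b, ex_RInt k a b) by (intros; now apply (ex_RInt_decay C)).
  assert (HE : forall b, RInt k (- b) b = 2 * RInt E 0 b).
  { intros b. rewrite <- (RInt_chasles_R k (- b) 0 b) by auto.
    replace (RInt k (- b) 0) with (RInt (fun x => k (- x)) 0 b).
    2: { rewrite <- RInt_opp_arg by apply HD. now rewrite Ropp_0. }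
    rewrite <- RInt_plus_R; auto.
    2: { apply (ex_RInt_continuous (fun x => k (- x))); intros; now apply (decay_opp_arg C k HD). }
    rewrite <- RInt_scal_R by apply HiE. apply RInt_ext; intros x _.
    unfold k, E, even_part.
    replace (K (PI / 4) (- x) t) with (K (PI / 4) x t)
      by (unfold K; now replace ((- x) ^ 2) with (x ^ 2) by ring).
    real_eq; field. }
  assert (L2 : is_lim_seq (fun n => RInt k (- INR (S n)) (INR (S n)))
      (2 * (0 + fresnel_int (PI / 4) (even_part phi) t))).
  { apply (is_lim_seq_ext (fun n => 2 * (RInt E 0 (/ INR (S n)) + RInt E (/ INR (S n)) (INR (S n))))).
    - intros n; rewrite HE. f_equal. now apply RInt_chasles_R.
    - apply (is_lim_seq_scal_l _ 2 (Finite (0 + fresnel_int (PI / 4) (even_part phi) t))).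
      apply is_lim_seq_plus'; [ | exact HS ].
      assert (HE0 : RInt E 0 0 = 0) by apply (RInt_point 0 E).
      assert (L := is_lim_seq_continuous (RInt E 0) (fun n => / INR (S n)) 0
        (proj2 (continuity_pt_filterlim (RInt E 0) 0)
          (continuous_of_derive _ _ _ (is_derive_RInt_upper E 0 HcE))) is_lim_seq_inv_S).
      now rewrite HE0 in L. }
  assert (HU := is_lim_seq_unique _ _ HL). rewrite (is_lim_seq_unique _ _ L2) in HU.
  injection HU as HU. unfold pairing. fold k. rewrite <- HU. ring.
Qed.

Lemma pairing_iter_kernel_S (k : nat) (phi f1 : R -> R) (F t : R) :
  curve_bound F (pairing (iter_kernel k) phi) f1 -> schwartz phi -> 0 < t ->
  pairing (iter_kernel (S k)) phi t = 2 * fresnel_int (PI / 4) (pairing (iter_kernel k) phi) t.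
Proof.
  intros HC Hphi Ht.
  rewrite <- (pairing_fresnel (iter_kernel k) (PI / 4) t phi _ F (smooth_iter_kernel k) Hphi Ht
     (curve_low_bound _ _ _ HC) (curve_high_bound _ _ _ HC)).
  assert (Hk : kernel0 (fun x t => fresnel_int (PI / 4) (iter_kernel k x) t)).
  { destruct (smooth_kernel_step 1 (PI / 4) _ (smooth_iter_kernel k)) as [Hk _].
    apply (kernel_ext 0 (fun x t => 1 * fresnel_int (PI / 4) (iter_kernel k x) t)); [ intros; ring | apply Hk ]. }
  destruct (decay_kernel_pairing _ phi t Hk Hphi Ht) as (A & _ & HD).
  assert (HL := line_int_linear A A 2 0 _ _ (HD t (Rle_refl t)) (HD t (Rle_refl t))).
  rewrite Rmult_0_l, Rplus_0_r in HL. unfold pairing. rewrite <- HL.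
  apply line_int_ext; intros x; simpl; ring.
Qed.

Definition wave_speed (k : nat) : R := - / 2 ^ (2 * (2 ^ (k + 1) - 1)).

Lemma wave_speed_S (k : nat) : wave_speed (S k) = - (wave_speed k ^ 2 / 4).
Proof.
  unfold wave_speed.
  assert (Hk : (2 ^ (S k + 1) = 2 * 2 ^ (k + 1))%nat) by (simpl; lia).
  assert (Hp : (1 <= 2 ^ (k + 1))%nat) by (apply Nat.neq_0_lt_0, Nat.pow_nonzero; lia).
  rewrite Hk.
  replace (2 * (2 * 2 ^ (k + 1) - 1))%nat
    with (2 * (2 ^ (k + 1) - 1) + 2 * (2 ^ (k + 1) - 1) + 2)%nat by lia.
  rewrite !pow_add. set (p := 2 ^ (2 * (2 ^ (k + 1) - 1))).
  assert (p <> 0) by (apply pow_nonzero; lra). simpl; field; auto.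
Qed.

Lemma wave_iter_kernel (k : nat) (h : R -> R -> R) :
  kernel 1 h ->
  (forall x s, 0 < s -> is_derive (iter_kernel k x) s (h x s / s)) ->
  wave (wave_speed k) (2 ^ (k + 2)) (pairing (iter_kernel k)) (pairing (fun x t => h x t / t)).
Proof.
  revert h; induction k as [ | k IH ]; intros h Hh Hkh.
  - replace (wave_speed 0) with (- (1 ^ 2 / 4)) by (unfold wave_speed; simpl; field).
    apply (wave_kernel 1 2 even_part even_part_derivative _ h wave_even_part); auto.
    + apply (proj1 (smooth_iter_kernel 0)).
    + intros phi t; apply pairing_fresnel_density.
  - destruct (proj1 (smooth_iter_kernel k) 2%nat) as [_ (h' & Hh' & Hk')].
    assert (HW := IH h' Hk' Hh').
    rewrite wave_speed_S.
    replace (2 ^ (S k + 2))%nat with (2 ^ (k + 2) + 2 ^ (k + 2))%nat by (simpl; lia).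
    apply (wave_kernel _ _ _ _ _ h HW); auto.
    + apply (proj1 (smooth_iter_kernel (S k))).
    + intros phi t Hphi Ht. destruct (HW phi Hphi) as ([F HC] & _).
      exact (pairing_iter_kernel_S k phi _ F t HC Hphi Ht).
Qed.

Lemma tempered_function_kernel (g : R -> R -> R) (t : R) :
  kernel0 g -> 0 < t -> tempered_function (fun x => g x t).
Proof.
  intros [Hc Hb] Ht.
  destruct (poly_bound_slice g Hb) as [N HN]; destruct (HN t Ht) as (A & HA & HgA).
  apply (tempered_function_poly _ A N HA).
  - intros x; now apply Hc.
  - intros x; apply HgA; lra.
Qed.

Lemma Derive_n_linear (a b : R) (phi psi : R -> R) (k : nat) :
  schwartz phi -> schwartz psi ->
  Derive_n (fun x => a * phi x + b * psi x) k = (fun x => a * Derive_n phi k x + b * Derive_n psi k x).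
Proof.
  intros Hphi Hpsi; induction k as [ | k IH ]; [ reflexivity | ].
  apply functional_extensionality; intros x. simpl. rewrite IH.
  apply is_derive_unique.
  assert (HD : forall f, schwartz f -> is_derive (Derive_n f k) x (Derive (Derive_n f k) x)).
  { intros f [Hf _]; apply Derive_correct, (Hf (S k) x). }
  apply (is_derive_plus (fun x => a * Derive_n phi k x) (fun x => b * Derive_n psi k x));
    [ apply (is_derive_scal (Derive_n phi k) x a) | apply (is_derive_scal (Derive_n psi k) x b) ]; auto.
Qed.

Lemma tempered_scal_Derive_n (T : functional) (c : R) (k : nat) :
  tempered T -> tempered (fun phi => c * distr_Derive_n T k phi).
Proof.
  intros [HL (N & C & HC)]; unfold distr_Derive_n; split.
  - intros a b phi psi Hphi Hpsi. rewrite Derive_n_linear by assumption.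
    rewrite HL by now apply schwartz_Derive_n. ring.
  - exists (N + k)%nat, (Rabs c * C). intros phi Hphi M HM.
    rewrite !Rabs_mult, pow_1_abs, Rmult_1_l, Rmult_assoc.
    apply Rmult_le_compat_l; [ apply Rabs_pos | ].
    apply HC; [ now apply schwartz_Derive_n | ].
    intros i j x Hi Hj. rewrite Derive_n_Derive_n. apply HM; lia.
Qed.

Theorem theorem6p3 (n : nat) (hn : (1 <= n)%nat) :
  (forall x t : R, 0 < t ->
     ex_iterated_RInt n (fresnel_chain n) (fresnel_ends n x t)) /\
  (forall t : R, 0 < t ->
     tempered_function (fun x => iterated_fresnel_density n x t)) /\
  let u : R -> functional :=
    fun t => regular_distr (fun x => iterated_fresnel_density n x t) in
  exists ut : R -> functional,
    (forall t : R, 0 < t -> is_distr_derive u t (ut t)) /\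
    (forall t : R, 0 < t ->
       is_distr_derive ut t
         (fun phi => - / 2 ^ (2 * (2 ^ (n + 1) - 1))
                     * distr_Derive_n (u t) (2 ^ (n + 2)) phi)) /\
    distr_lim_0 u dirac /\
    distr_lim_0 ut (fun _ => 0).
Proof.
  assert (HE : forall t, 0 < t ->
    (fun x => iter_kernel n x t) = (fun x => iterated_fresnel_density n x t)).
  { intros t Ht; apply functional_extensionality; intros x; symmetry; now apply iterated_fresnel_ends. }
  assert (HT : forall t, 0 < t -> tempered_function (fun x => iterated_fresnel_density n x t)).
  { intros t Ht; rewrite <- HE by exact Ht.
    apply tempered_function_kernel; [ apply (proj1 (smooth_iter_kernel n) 0%nat) | exact Ht ]. }
  split; [ intros x t Ht; now apply iterated_fresnel_ends | split; [ exact HT | ] ].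
  intros u.
  assert (Hu : forall phi t, 0 < t -> pairing (iter_kernel n) phi t = u t phi).
  { intros phi t Ht; unfold u; now rewrite <- HE. }
  destruct (proj1 (smooth_iter_kernel n) 2%nat) as [_ (h & Hh & Hk)].
  assert (HW := wave_iter_kernel n h Hk Hh).
  exists (fun t => regular_distr (fun x => h x t / t)).
  split; [ | split; [ | split ] ].
  - intros t Ht; split.
    + apply (tempered_function_kernel (fun x t => h x t / t)); [ | exact Ht ].
      apply (kernel_kernel0 1), kernel_time_derivative, Hk.
    + intros phi Hphi. destruct (HW phi Hphi) as ([F HC] & _).
      apply (is_derive_ext_pos (pairing (iter_kernel n) phi)); [ intros; now apply Hu | exact Ht | ].
      now apply HC.
  - intros t Ht; split; [ apply tempered_scal_Derive_n, HT, Ht | ].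
    intros phi Hphi. destruct (HW phi Hphi) as (_ & HD & _).
    apply (is_derive_eq _ _ _ _ (HD t Ht)).
    unfold distr_Derive_n. rewrite <- Hu by exact Ht.
    (* An even number of derivatives moved to phi leaves no sign. *)
    replace (2 ^ (n + 2))%nat with (2 * 2 ^ (n + 1))%nat at 2
      by (replace (n + 2)%nat with (S (n + 1)) by lia; reflexivity).
    rewrite pow_1_even. unfold wave_speed. ring.
  - intros phi Hphi. destruct (HW phi Hphi) as (_ & _ & HL & _).
    apply (at_right_ext (pairing (iter_kernel n) phi)); [ intros; now apply Hu | exact HL ].
  - intros phi Hphi. now destruct (HW phi Hphi) as (_ & _ & _ & HL).
Qed.
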